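(* Let $n\ge2$, let $\mathfrak{d}_0,\mathfrak{d}_\infty\in\left(-1,\frac1{n-1}\right)$, and let $r_{0,j}=1-\mathfrak{d}_0(n-j)$ and $r_{\infty,j}=1-\mathfrak{d}_\infty(n-j)$ for $j\in\{1,\dots,n\}$. Let $i\in\{1,\dots,n-1\}$ and let $K_{i+1}:\mathbb{R}^{n-i}\to\mathbb{R}^{n-i}$ be a homogeneous in the bi-limit vector field with associated triples $\left((r_{0,i+1},\dots,r_{0,n}),\mathfrak{d}_0,K_{i+1,0}\right)$ and $\left((r_{\infty,i+1},\dots,r_{\infty,n}),\mathfrak{d}_\infty,K_{i+1,\infty}\right)$. Suppose that the origin is a globally asymptotically stable equilibrium of each of the systems, with state $E_{i+1}=(e_{i+1},\dots,e_n)^T\in\mathbb{R}^{n-i}$, $$\dot E_{i+1}=\mathcal{S}_{n-i}E_{i+1}+K_{i+1}(e_{i+1}),\quad \dot E_{i+1}=\mathcal{S}_{n-i}E_{i+1}+K_{i+1,0}(e_{i+1}),\quad \dot E_{i+1}=\mathcal{S}_{n-i}E_{i+1}+K_{i+1,\infty}(e_{i+1}).$$ Then there exists a homogeneous in the bi-limit vector field $K_i:\mathbb{R}^{n-i+1}\to\mathbb{R}^{n-i+1}$, with associated triples $\left((r_{0,i},\dots,r_{0,n}),\mathfrak{d}_0,K_{i,0}\right)$ and $\left((r_{\infty,i},\dots,r_{\infty,n}),\mathfrak{d}_\infty,K_{i,\infty}\right)$, such that the origin is a globally asymptotically stable equilibrium of each of the systems, with state $E_i=(e_i,\dots,e_n)^T\in\mathbb{R}^{n-i+1}$,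 $$\dot E_i=\mathcal{S}_{n-i+1}E_i+K_i(e_i),\quad \dot E_i=\mathcal{S}_{n-i+1}E_i+K_{i,0}(e_i),\quad \dot E_i=\mathcal{S}_{n-i+1}E_i+K_{i,\infty}(e_i).$$
   Context: $\mathbb{R}_+=[0,+\infty)$. $\mathcal{S}_k$ denotes the shift matrix of order $k$: $\mathcal{S}_k(v_1,\dots,v_k)^T=(v_2,\dots,v_k,0)^T$. For a vector field $K$ on $\mathbb{R}^k$ and a scalar $e$, the compact notation $K(e)$ stands for $K(e,0,\dots,0)$. For $r\in(\mathbb{R}_+\setminus\{0\})^N$, $\lambda\in\mathbb{R}_+$ and $x\in\mathbb{R}^N$, $\lambda^r\diamond x=(\lambda^{r_1}x_1,\dots,\lambda^{r_N}x_N)$. A function $\phi:\mathbb{R}^N\to\mathbb{R}$ is homogeneous in the $0$-limit with associated triple $(r_0,d_0,\phi_0)$ (weight $r_0\in(\mathbb{R}_+\setminus\{0\})^N$, degree $d_0\in\mathbb{R}_+$, approximating function $\phi_0:\mathbb{R}^N\to\mathbb{R}$) if $\phi$ is continuous, $\phi_0$ is continuous and not identically zero, and for each compact set $C\subset\mathbb{R}^N\setminus\{0\}$ and each $\varepsilon>0$ there exists $\lambda_0>0$ such that $\max_{x\in C}\left|\frac{\phi(\lambda^{r_0}\diamond x)}{\lambda^{d_0}}-\phi_0(x)\right|\le\varepsilon$ for all $\lambda\in(0,\lambda_0]$. It is homogeneous in the $\infty$-limit with associated triple $(r_\infty,d_\infty,\phi_\infty)$ if the same holds with $(r_\infty,d_\infty,\phi_\infty)$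 in place of $(r_0,d_0,\phi_0)$ and ''there exists $\lambda_\infty>0$ such that ... for all $\lambda\ge\lambda_\infty$''. A vector field $f=(f_1,\dots,f_N)$ on $\mathbb{R}^N$ is homogeneous in the $0$-limit with associated triple $(r_0,\mathfrak{d}_0,f_0)$, with $\mathfrak{d}_0\in\mathbb{R}$ and $f_0=(f_{0,1},\dots,f_{0,N})$, if for each component $k$, $\mathfrak{d}_0+r_{0,k}\ge 0$ (where $r_{0,k}$ is the $k$-th entry of the weight $r_0$) and $f_k$ is homogeneous in the $0$-limit with associated triple $(r_0,\mathfrak{d}_0+r_{0,k},f_{0,k})$; similarly in the $\infty$-limit. It is homogeneous in the bi-limit if it is homogeneous in both limits; its associated triples are the two corresponding triples. *)

(* Defs.v *)
From HB Require Import structures.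
From mathcomp Require Import all_boot all_order all_algebra.
From mathcomp Require Import all_classical all_reals all_analysis.

Set Implicit Arguments.
Unset Strict Implicit.
Unset Printing Implicit Defensive.

Import Order.TTheory GRing.Theory Num.Theory.
Import numFieldNormedType.Exports.

Local Open Scope classical_set_scope.
Local Open Scope ring_scope.

Section Homogeneity.
Context {R : realType} {N : nat}.
Implicit Types (r : 'I_N -> R) (f : 'cV[R]_N -> 'cV[R]_N).

Definition dilation r (lambda : R) (x : 'cV[R]_N) : 'cV[R]_N :=
  \col_j (lambda `^ r j * x j 0).

Definition homogeneous_0limit (phi : 'cV[R]_N -> R) r (d : R)
    (phi0 : 'cV[R]_N -> R) : Prop :=
  [/\ forall j, 0 < r j, 0 <= d, continuous phi,
      continuous phi0 /\ (exists x, phi0 x != 0) &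
      forall C : set 'cV[R]_N, compact C -> ~ C 0 ->
      forall eps : R, 0 < eps ->
      exists2 lambda0 : R, 0 < lambda0 &
        forall lambda : R, 0 < lambda <= lambda0 -> forall x, C x ->
          `|phi (dilation r lambda x) / lambda `^ d - phi0 x| <= eps].

Definition homogeneous_oolimit (phi : 'cV[R]_N -> R) r (d : R)
    (phioo : 'cV[R]_N -> R) : Prop :=
  [/\ forall j, 0 < r j, 0 <= d, continuous phi,
      continuous phioo /\ (exists x, phioo x != 0) &
      forall C : set 'cV[R]_N, compact C -> ~ C 0 ->
      forall eps : R, 0 < eps ->
      exists2 lambdaoo : R, 0 < lambdaoo &
        forall lambda : R, lambdaoo <= lambda -> forall x, C x ->
          `|phi (dilation r lambda x) / lambda `^ d - phioo x| <= eps].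

Definition vf_homogeneous_0limit f r (d : R) (f0 : 'cV[R]_N -> 'cV[R]_N) :=
  forall k, 0 <= d + r k /\
    homogeneous_0limit (fun x => f x k 0) r (d + r k) (fun x => f0 x k 0).

Definition vf_homogeneous_oolimit f r (d : R) (foo : 'cV[R]_N -> 'cV[R]_N) :=
  forall k, 0 <= d + r k /\
    homogeneous_oolimit (fun x => f x k 0) r (d + r k) (fun x => foo x k 0).

Definition vf_homogeneous_bilimit f
    r0 (d0 : R) (f0 : 'cV[R]_N -> 'cV[R]_N)
    roo (doo : R) (foo : 'cV[R]_N -> 'cV[R]_N) :=
  vf_homogeneous_0limit f r0 d0 f0 /\ vf_homogeneous_oolimit f roo doo foo.

End Homogeneity.

Section Stability.
Context {R : realType} {N : nat}.
Implicit Types (F : 'cV[R]_N -> 'cV[R]_N) (T : \bar R) (x : R -> 'cV[R]_N).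

(* Forward solutions of x' = F(x) on [0, T[ with 0 < T <= +oo; the values of
   x outside [0, T[ are irrelevant.  As F is only meant to be continuous, several
   solutions may start from the same point. *)
Definition is_solution F T x : Prop :=
  [/\ (0 < T)%E,
      {within [set t : R | 0 <= t /\ (t%:E < T)%E], continuous x} &
      forall t : R, 0 < t -> (t%:E < T)%E -> is_derive t 1 x (F (x t))].

Definition is_maximal_solution F T x : Prop :=
  is_solution F T x /\
  forall T' y, is_solution F T' y -> (T <= T')%E ->
    (forall t : R, 0 <= t -> (t%:E < T)%E -> y t = x t) -> T' = T.

(* Stability and attractivity are required of all solutions, which includes
   that no solution escapes in finite time. *)
Definition globally_asymptotically_stable F : Prop :=
  [/\ F 0 = 0,
      forall eps : R, 0 < eps -> exists2 delta : R, 0 < delta &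
        forall T x, is_solution F T x -> `|x 0| < delta ->
        forall t : R, 0 <= t -> (t%:E < T)%E -> `|x t| < eps &
      forall T x, is_maximal_solution F T x ->
        T = +oo%E /\ x t @[t --> +oo%R] --> (0 : 'cV[R]_N)].

End Stability.

Section Chain.
Context {R : realType}.

Definition shift_mx (k : nat) : 'M[R]_k :=
  \matrix_(i < k, j < k) (j == i.+1 :> nat)%:R.

(* (E_1, ..., E_k) |-> (E_1, 0, ..., 0); composed with K it gives the compact
   notation K(E_1) = K(E_1, 0, ..., 0). *)
Definition first_only (k : nat) (E : 'cV[R]_k) : 'cV[R]_k :=
  \col_j (if j == 0%N :> nat then E j 0 else 0).

Definition error_system (k : nat) (K : 'cV[R]_k -> 'cV[R]_k) (E : 'cV[R]_k) :
    'cV[R]_k :=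
  shift_mx k *m E + K (first_only E).

(* r_j = 1 - d (n - j), with j counted from 1 to n. *)
Definition weight (n : nat) (d : R) (j : nat) : R := 1 - d * (n%:R - j%:R).

(* (r_i, ..., r_(i + k - 1)), indexed from 0. *)
Definition weights_from (n : nat) (d : R) (i k : nat) : 'I_k -> R :=
  fun j => weight n d (i + j).

End Chain.

(* Main.v *)
Require Import Defs.
From HB Require Import structures.
From mathcomp Require Import all_boot all_order all_algebra.
From mathcomp Require Import all_classical all_reals all_analysis.
From mathcomp Require Import ring lra zify.

(* The extended field is K_i(e) = (- q(l e_i), K_(i+1)(q(l e_i))), where q is odd
   and equal to t^(r_(i+1) / r_i) with the exponents of the 0-limit on [0, 1] and
   those of the oo-limit on [1, +oo[, and l is large. With w = l e_i the error
   system becomes w' = l (e_(i+1) - q(w)), E' = S E + K_(i+1)(q(w)): the bounded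
   quantity q(w) tracks e_(i+1) as l grows, so that E nearly follows the reduced
   system.

   Instead of a homogeneous Lyapunov function, the proof uses compactness. Rescale
   space and time by the dilations of parameter exp(u), with the weights of the
   0-limit for u <= 0 and those of the oo-limit for u >= 0. If for every k some
   gain l_k >= k, some u_k and some solution of the rescaled system starting in the
   unit ball neither stays bounded by k + 1 up to time k nor comes near the origin
   before, then the pointwise limit of these solutions along an ultrafilter solves,
   up to its explosion time, the reduced system of a rescaling of K (if u_k stays
   bounded), of K_0 (if u_k tends to -oo) or of K_oo (if u_k tends to +oo), and
   stays away from the origin: this contradicts attractivity. Hence for l large all
   rescaled systems bring the unit ball into a small ball within a common time and
   inside a common larger ball. Undoing the rescaling and iterating gives stability
   and attractivity; Peano's theorem shows that bounded maximal solutions are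
   global. The two limit systems are handled by the same statement, applied to the
   exactly homogeneous fields K_0 and K_oo. *)

Set Implicit Arguments.
Unset Strict Implicit.
Unset Printing Implicit Defensive.
Import Order.TTheory GRing.Theory Num.Theory.
Import numFieldNormedType.Exports.
Local Open Scope classical_set_scope.
Local Open Scope ring_scope.

(** * Vectors, ultrafilters and functions on segments *)

(** This matters because the speed of [w] grows with [l]: only the slow coordinates converge, and
    [w] enters the limit solely through [q w], whose distance to [e_(i+1)] vanishes after any
    positive time. Rescaling reduces initial data of every size to the unit ball, at the price of a
    family of systems indexed by [u]; the exponents of [q] are chosen so that its rescalings satisfy
    bounds uniform in [u]. The bounds on the degrees make [r_1] and [r_(n+1)], equal to 1 plus the
    degree, positive, hence all weights and all degrees of components. Positive degrees make the
    homogeneous approximations uniform up to the origin, a point that the definition excludes. *)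

Lemma cV_norm_leP (R : realType) (N : nat) (x : 'cV[R]_N) (B : R) :
  0 <= B -> `|x| <= B <-> forall i, `|x i 0| <= B.
Proof.
move=> B0; split => [xB i|xB].
  apply: le_trans xB; rewrite [leRHS]/Num.Def.normr/= mx_normrE.
  exact: (le_bigmax _ (fun ij => `|x ij.1 ij.2|) (i, 0)).
rewrite /Num.Def.normr/= mx_normrE; apply: bigmax_le => //= -[i j] _ /=.
by rewrite (ord1 j).
Qed.

Lemma cV_norm_le (R : realType) (N : nat) (x : 'cV[R]_N) i : `|x i 0| <= `|x|.
Proof. by have /cV_norm_leP := lexx `|x|; apply. Qed.

Lemma closed_ball_compact_cV (R : realType) (N : nat) (B : R) :
  compact [set x : 'cV[R]_N | `|x| <= B].
Proof.
have [B0|B0] := ltP B 0.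
  rewrite (_ : [set _ | _] = set0); first exact: compact0.
  by apply/seteqP; split => x //=; rewrite leNgt (lt_le_trans B0).
have -> : [set x : 'cV[R]_N | `|x| <= B] =
    trmx @` [set v : 'rV[R]_N | forall i, `[- B, B]%classic (v ord0 i)].
  apply/seteqP; split => [x /= xB|_ [v /= vB <-] /=].
    exists x^T; last exact: trmxK.
    by move=> i; rewrite mxE /= in_itv /= -ler_norml (le_trans (cV_norm_le _ _)).
  by apply/cV_norm_leP => // i; rewrite mxE ler_norml; have := vB i; rewrite in_itv.
apply: continuous_compact; last first.
  by apply: (@rV_compact _ _ (fun=> `[- B, B]%classic)) => i; exact: segment_compact.
suff ct : continuous (trmx : 'rV[R]_N -> 'cV[R]_N) by exact: continuous_subspaceT.
move=> v A /nbhs_ballP[e e0 eA]; apply/nbhs_ballP; exists e => //= w [_ vw].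
by apply: eA; split => // i j; rewrite !mxE; exact: vw.
Qed.

Lemma continuous_bounded (R : realType) (N : nat) (V : normedModType R)
    (f : 'cV[R]_N -> V) (B : R) : continuous f ->
  exists2 C, 0 < C & forall x, `|x| <= B -> `|f x| <= C.
Proof.
move=> cf; have [C [_ HC]] : bounded_set (f @` [set x | `|x| <= B]).
  apply: compact_bounded; apply: continuous_compact.
    exact: continuous_subspaceT.
  exact: closed_ball_compact_cV.
exists (Num.max C 0 + 1); first by rewrite ltr_pwDr// le_max lexx orbT.
move=> x xB; apply: HC; last by exists x.
by rewrite ltr_pwDr// le_max lexx.
Qed.

(** Were no point of [K] a limit, each would have a neighbourhood that [a] avoids for almost all
    indices, since an ultrafilter decides membership; the near-covering form of compactness makes
    this simultaneous for all points of [K]. *)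
Lemma ultra_compact (X : topologicalType) I (U : set_system I)
    (UU : UltraFilter U) (K : set X) (a : I -> X) :
  compact K -> (\forall k \near U, K (a k)) -> exists2 x, K x & a @ U --> x.
Proof.
move=> /compact_near_coveringP cK aK; apply: contrapT => nlim.
have : \forall k \near U, forall x, K x -> a k <> x.
  apply: cK => x Kx; apply: contrapT => nx; apply: nlim; exists x => // V Vx.
  have [//|UnV] := in_ultra_setVsetC (a @^-1` V) UU.
  case: nx; exists (V, ~` (a @^-1` V)) => //= -[y k] [/= Vy nVk] yk.
  by apply: nVk; rewrite /= yk.
by move=> H; have [k [/(_ (a k)) h /h]] := filter_ex (filterI H aK).
Qed.

Lemma ultra_or I (U : set_system I) (UU : UltraFilter U) (P : I -> Prop) :
  (\forall k \near U, P k) \/ (\forall k \near U, ~ P k).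
Proof. exact: (in_ultra_setVsetC P UU). Qed.

Section OnSegments.
Context {R : realType}.

Lemma within_itvccP {V : normedModType R} (a b : R) (f : R -> V) :
  {within `[a, b], continuous f} <->
  forall t, a <= t <= b -> forall e, 0 < e -> exists2 d, 0 < d &
    forall s, a <= s <= b -> `|s - t| < d -> `|f s - f t| < e.
Proof.
rewrite subspace_continuousP; split => [cf t tab e e0|cf t /= tab].
  have /cf/cvgrPdist_lt/(_ _ e0) : `[a, b]%classic t by rewrite /= in_itv.
  rewrite near_withinE => /nbhs_ballP[d /= d0 H]; exists d => // s sab std.
  rewrite distrC; apply: H; last by rewrite /= in_itv.
  by rewrite /ball /= distrC.
apply/cvgrPdist_lt => e e0; rewrite near_withinE.
have [|d d0 H] := cf t _ e e0; first by move: tab; rewrite in_itv.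
apply/nbhs_ballP; exists d => // s; rewrite /ball /= distrC => std sab.
by rewrite distrC; apply: H => //; move: sab; rewrite in_itv.
Qed.

Lemma last_time (a b c : R) (f : R -> R) :
  a <= b -> {within `[a, b], continuous f} -> f a <= c ->
  exists r, [/\ a <= r <= b, f r <= c & forall t, r < t <= b -> c < f t].
Proof.
move=> ab /within_itvccP cf fa.
pose S := [set r | a <= r <= b /\ f r <= c].
have hS : has_sup S.
  split; first by exists a; rewrite /S /= lexx ab.
  by exists b => r [/andP[]].
have aS : a <= sup S by apply: ub_le_sup; [exact: hS.2|rewrite /S /= lexx ab].
have Sb : sup S <= b by apply: ge_sup; [exact: hS.1|move=> r [/andP[]]].
exists (sup S); split; first by rewrite aS Sb.
- rewrite leNgt; apply/negP => fS.
  have e0 : 0 < f (sup S) - c by rewrite subr_gt0.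
  have [|d d0 H] := cf (sup S) _ _ e0; first by rewrite aS Sb.
  have [r [[rab frc] Sr]] := sup_adherent d0 hS.
  have rS : r <= sup S by apply: ub_le_sup; [exact: hS.2|].
  have := H r rab; rewrite ler0_norm ?subr_le0// => /(_ _)/ltr_normlP [|h1 _].
    by lra.
  by lra.
- move=> t /andP[St tb]; rewrite ltNge; apply/negP => ftc.
  have : t <= sup S.
    apply: ub_le_sup; first exact: hS.2.
    by split => //; rewrite tb (le_trans aS) // ltW.
  by rewrite leNgt St.
Qed.

Lemma first_time (a b c : R) (f : R -> R) :
  a <= b -> {within `[a, b], continuous f} -> f a <= c -> c <= f b ->
  exists r, [/\ a <= r <= b, f r = c & forall t, a <= t <= r -> f t <= c].
Proof.
move=> ab /within_itvccP cf fa fb.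
pose S := [set r | a <= r <= b /\ c <= f r].
have hS : has_inf S.
  split; first by exists b; rewrite /S /= lexx ab.
  by exists a => r [/andP[]].
have Sb : inf S <= b by apply: ge_inf; [exact: hS.2|rewrite /S /= lexx ab].
have aS : a <= inf S by apply: lb_le_inf; [exact: hS.1|move=> r [/andP[]]].
have low t : a <= t < inf S -> f t < c.
  move=> /andP[at' tS]; rewrite ltNge; apply/negP => ctf.
  have : inf S <= t.
    apply: ge_inf; first exact: hS.2.
    by split => //; rewrite at' (le_trans (ltW tS)).
  by rewrite leNgt tS.
have ge : c <= f (inf S).
  rewrite leNgt; apply/negP => fS.
  have e0 : 0 < c - f (inf S) by rewrite subr_gt0.
  have [|d d0 H] := cf (inf S) _ _ e0; first by rewrite aS Sb.
  have [r [rab frc] Sr] := inf_adherent d0 hS.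
  have rS : inf S <= r by apply: ge_inf; [exact: hS.2|].
  have := H r rab; rewrite ger0_norm ?subr_ge0// => /(_ _)/ltr_normlP [|_ h1].
    by lra.
  by lra.
have le : f (inf S) <= c.
  have [<-|aS'] := eqVneq a (inf S); first by [].
  rewrite leNgt; apply/negP => fS.
  have e0 : 0 < f (inf S) - c by rewrite subr_gt0.
  have [|d d0 H] := cf (inf S) _ _ e0; first by rewrite aS Sb.
  have aS2 : a < inf S by rewrite lt_neqAle aS'.
  pose t := Num.max a (inf S - d / 2).
  have tS : t < inf S by rewrite gt_max aS2 /=; lra.
  have ta : a <= t by rewrite le_max lexx.
  have td : inf S - d / 2 <= t by rewrite le_max lexx orbT.
  have := H t _ _; rewrite ta (le_trans (ltW tS) Sb) => /(_ isT).
  rewrite ltr0_norm ?subr_lt0// => /(_ _)/ltr_normlP [|h1 _]; first by lra.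
  by have := low t; rewrite ta tS => /(_ isT); lra.
exists (inf S); split; [by rewrite aS Sb|by apply/eqP; rewrite eq_le le ge|].
move=> t /andP[at' tS]; have [->//|tS'] := eqVneq t (inf S).
by apply/ltW/low; rewrite at' lt_neqAle tS'.
Qed.

(** A form without difference quotients: such an estimate survives limits along an ultrafilter and
    can be checked separately on the two sides of [t]. *)
Lemma is_derive_dist {V : normedModType R} (x : R -> V) (t : R) (g : V) :
  (forall e, 0 < e -> exists2 d, 0 < d &
     forall s, `|s - t| < d -> `|x s - x t - (s - t) *: g| <= e * `|s - t|) ->
  is_derive t 1 x g.
Proof.
move=> H.
have lim : h^-1 *: (x (h *: 1 + t) - x t) @[h --> 0^'] --> g.
  apply/cvgrPdist_le => e e0; have [d d0 Hd] := H _ e0.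
  near=> h.
  have h0 : h != 0 by near: h; exact: nbhs_dnbhs_neq.
  have hd : `|h| < d by near: h; exact: dnbhs0_lt.
  have hE : h *: (1 : R) + t - t = h by rewrite addrK /GRing.scale /= mulr1.
  have := Hd (h *: 1 + t); rewrite hE => /(_ hd) hh.
  rewrite distrC -[X in _ - X](scalerK h0) -scalerBr normrZ normfV.
  by rewrite ler_pdivrMl ?normr_gt0// mulrC.
split; last exact/cvg_lim.
by apply/cvg_ex; exists g.
Unshelve. all: by end_near. Qed.

Lemma is_derive_coord N (x : R -> 'cV[R]_N) (t : R) (g : 'cV[R]_N) i :
  is_derive t 1 x g -> is_derive t 1 (fun s => x s i 0) (g i 0).
Proof.
move=> dx; have dxt : derivable x t 1 by exact: ex_derive.
split; first by move/derivable_mxP : dxt.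
have := derive_mx dxt; rewrite derive_val => ->.
by rewrite mxE.
Qed.

Lemma within_continuous_coord N (A : set R) (x : R -> 'cV[R]_N) i :
  {within A, continuous x} -> {within A, continuous (fun s => x s i 0)}.
Proof.
move=> cx; apply: (@within_continuous_comp _ _ _ _ x (fun y => y i 0)) => //.
by move=> y _; exact: coord_continuous.
Qed.

(** For the maximum norm the scalar mean value theorem on each coordinate suffices, although the
    intermediate point depends on the coordinate. *)
Lemma dist_MVT N (x : R -> 'cV[R]_N) (f : R -> 'cV[R]_N) (a b e : R) (g : 'cV_N) :
  a <= b -> {within `[a, b], continuous x} ->
  (forall t, a < t < b -> is_derive t 1 x (f t)) ->
  0 <= e -> (forall t, a <= t <= b -> `|f t - g| <= e) ->
  `|x b - x a - (b - a) *: g| <= e * (b - a).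
Proof.
move=> ab cx dx e0 fg; apply/cV_norm_leP; first by rewrite mulr_ge0 // subr_ge0.
move=> i; rewrite !mxE.
have [||c cab ->] := @MVT_segment R (fun s => x s i 0) (fun t => f t i 0) a b ab.
- by move=> t tab; apply: is_derive_coord; apply: dx; move: tab; rewrite in_itv.
- exact: within_continuous_coord.
rewrite (mulrC (b - a)) -mulrBl normrM (ger0_norm (_ : 0 <= b - a)) ?subr_ge0//.
rewrite ler_wpM2r ?subr_ge0//; apply: le_trans (fg c _); last first.
  by move: cab; rewrite in_itv.
by have := cV_norm_le (f c - g) i; rewrite !mxE.
Qed.

End OnSegments.

(** * One-sided estimates for the scalar equation w' = l (y - q (w)) *)

Section OneSidedEstimates.
Context {R : realType}.

Lemma noninc_of_derive_le0 (a b : R) (f df : R -> R) :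
  a <= b -> {within `[a, b], continuous f} ->
  (forall t, a < t < b -> is_derive t 1 f (df t)) ->
  (forall t, a < t < b -> df t <= 0) -> f b <= f a.
Proof.
rewrite le_eqVlt => /predU1P[->//|ab] cf dfE df0.
have [|c cab fab] := @MVT R f df a b ab.
  exact: cf.
rewrite -subr_le0 fab mulr_le0_ge0 ?subr_ge0 ?(ltW ab)//.
by apply: df0; move: cab; rewrite in_itv.
Qed.

Lemma within_itvccW (V : topologicalType) (a b c d : R) (f : R -> V) :
  {within `[a, b], continuous f} -> a <= c -> d <= b ->
  {within `[c, d], continuous f}.
Proof.
move=> cf ac db; apply: continuous_subspaceW cf => t /=; rewrite !in_itv /=.
by move=> /andP[ct td]; rewrite (le_trans ac ct) (le_trans td db).
Qed.

Variables (a b l : R) (w y q : R -> R).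
Hypotheses (ab : a <= b) (l0 : 0 < l) (cw : {within `[a, b], continuous w}).
Hypothesis dw : forall t, a < t < b -> is_derive t 1 w (l * (y t - q (w t))).
Hypothesis qmono : {homo q : u v / u <= v}.

(** After the last time at which [w <= W], monotonicity gives [q (w) >= q W >= y], so [w] cannot
    increase. The bound does not depend on [l]. *)
Lemma barrier_le (W : R) :
  w a <= W -> (forall t, a <= t <= b -> y t <= q W) ->
  forall t, a <= t <= b -> w t <= W.
Proof.
move=> waW yW t /andP[at' tb].
have [r [/andP[ar rt] wr H]] := last_time at' (within_itvccW cw (lexx _) tb) waW.
apply: le_trans wr.
apply: (@noninc_of_derive_le0 r t w (fun t => l * (y t - q (w t)))) => //.
- exact: within_itvccW cw ar tb.
- by move=> s /andP[rs st]; apply: dw; rewrite (le_lt_trans ar rs) (lt_le_trans st tb).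
move=> s /andP[rs st]; rewrite pmulr_rle0// subr_le0.
apply: (@le_trans _ _ (q W)).
  by apply: yW; rewrite (le_trans ar (ltW rs)) (le_trans (ltW st) tb).
by apply/qmono/ltW/H; rewrite rs ltW.
Qed.

(* If q (w) exceeds y by more than e / 2 on the whole segment, then w, which has
   speed at most - l * e / 2, drops by more than 2 * W; otherwise, after the last time at
   which the excess is e / 2, w decreases. *)
Lemma layer_le (W e : R) :
  continuous q -> {within `[a, b], continuous y} -> 0 < e ->
  `|w a| <= W -> `|w b| <= W -> (forall t, a <= t <= b -> y t <= y b + e / 4) ->
  2 * W < l * (b - a) * (e / 2) -> q (w b) - y b <= e.
Proof.
move=> cq cy e0 wa wb yb big; rewrite leNgt; apply/negP => fb.
pose f t := q (w t) - y t.
have cf : {within `[a, b], continuous f}.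
  move=> t; apply: cvgB; last exact: cy.
  by apply: (@within_continuous_comp _ _ _ _ w q) => // z _; exact: cq.
have [[s /andP[as' sb] fs]|nf] :=
    pselect (exists2 s, a <= s <= b & f s <= e / 2); last first.
  have ab' : a < b.
    rewrite lt_neqAle ab andbT; apply/eqP => abE.
    by move: big (le_trans (normr_ge0 _) wa); rewrite abE subrr mulr0 mul0r; lra.
  have [|c cab wbwa] := @MVT R w (fun t => l * (y t - q (w t))) a b ab'.
    exact: cw.
  have fc : e / 2 < f c.
    rewrite ltNge; apply/negP => fc; apply: nf; exists c => //.
    by move: cab; rewrite in_itv /= => /andP[/ltW -> /ltW ->].
  have lba : 0 < l * (b - a) by rewrite mulr_gt0 // subr_gt0.
  have : l * (b - a) * (e / 2) < l * (b - a) * f c by rewrite ltr_pM2l.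
  have -> : l * (b - a) * f c = w a - w b.
    by apply: oppr_inj; rewrite opprB wbwa /f; ring.
  move: wa wb; rewrite !ler_norml => /andP[? ?] /andP[? ?]; lra.
have [r [/andP[sr rb] fr H]] := last_time sb (within_itvccW cf as' (lexx _)) fs.
have wbr : w b <= w r.
  apply: (@noninc_of_derive_le0 r b w (fun t => l * (y t - q (w t)))) => //.
  - exact: within_itvccW cw (le_trans as' sr) (lexx _).
  - by move=> t /andP[rt tb]; apply: dw; rewrite tb (le_lt_trans (le_trans as' sr)).
  - move=> t /andP[rt tb]; rewrite pmulr_rle0//.
    have : e / 2 < f t by apply: H; rewrite rt ltW.
    by rewrite /f; lra.
have := qmono wbr; have := yb r; rewrite (le_trans as' sr) rb => /(_ isT).
by move: fr; rewrite /f; lra.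
Qed.

End OneSidedEstimates.

(** * Coordinates, the shift matrix and the splitting into head and tail *)

Section Vectors.
Context {R : realType}.

Lemma cvg_cV (T : Type) (F : set_system T) (FF : Filter F) N
    (f : T -> 'cV[R]_N) (g : 'cV[R]_N) :
  (forall i, f t i 0 @[t --> F] --> g i 0) -> f @ F --> g.
Proof.
move=> fg; apply/cvgrPdist_le => e e0; near=> t.
apply/cV_norm_leP; first exact: ltW.
move=> i; rewrite !mxE; move: i; near: t; apply: filter_forall => i.
by have /cvgrPdist_le := fg i; apply.
Unshelve. all: by end_near. Qed.

Lemma is_derive_cV N (x : R -> 'cV[R]_N) (t : R) (g : 'cV[R]_N) :
  (forall i, is_derive t 1 (fun s => x s i 0) (g i 0)) -> is_derive t 1 x g.
Proof.
move=> dx.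
have dxt : derivable x t 1.
  by apply/derivable_mxP => i j; rewrite (ord1 j); apply: ex_derive.
split=> //; rewrite derive_mx//; apply/matrixP => i j.
by rewrite (ord1 j) mxE; apply: derive_val.
Qed.

Lemma within_continuous_cV N (A : set R) (x : R -> 'cV[R]_N) :
  (forall i, {within A, continuous (fun s => x s i 0)}) ->
  {within A, continuous x}.
Proof. by move=> cx t; apply: cvg_cV => i; exact: cx. Qed.

Lemma continuous_cV (T : topologicalType) N (f : T -> 'cV[R]_N) :
  (forall i, continuous (fun s => f s i 0)) -> continuous f.
Proof. by move=> cx t; apply: cvg_cV => i; exact: cx. Qed.

Lemma increment_sym (V : normedModType R) (a b g : V) (s r : R) :
  `|a - b - (r - s) *: g| = `|b - a - (s - r) *: g|.
Proof. by rewrite -normrN -(opprB s r) scaleNr !opprD !opprK (addrC _ b). Qed.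

Lemma dist_MVT_ball N (x : R -> 'cV[R]_N) (f : R -> 'cV[R]_N) (s d e : R)
    (g : 'cV_N) :
  {within `[s - d, s + d], continuous x} ->
  (forall t, s - d < t < s + d -> is_derive t 1 x (f t)) ->
  0 <= e -> (forall t, `|t - s| <= d -> `|f t - g| <= e) ->
  forall r, `|r - s| <= d -> `|x r - x s - (r - s) *: g| <= e * `|r - s|.
Proof.
move=> cx dx e0 fg r rsd; move: (rsd); rewrite ler_norml => /andP[sdr rsd'].
have [rs|sr] := leP s r.
  rewrite ger0_norm ?subr_ge0//; apply: (dist_MVT (f := f)) => //.
  - by apply: within_itvccW cx _ _; lra.
  - by move=> t /andP[? ?]; apply: dx; apply/andP; split; lra.
  - by move=> t /andP[? ?]; apply: fg; rewrite ler_norml; apply/andP; split; lra.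
rewrite ltr0_norm ?subr_lt0// opprB increment_sym.
apply: (dist_MVT (f := f)) => //; first exact: ltW.
- by apply: within_itvccW cx _ _; lra.
- by move=> t /andP[? ?]; apply: dx; apply/andP; split; lra.
- by move=> t /andP[? ?]; apply: fg; rewrite ler_norml; apply/andP; split; lra.
Qed.

Lemma shift_mxE m (E : 'cV[R]_m) i :
  (shift_mx m *m E) i 0 = \sum_(j < m) (j == i.+1 :> nat)%:R * E j 0.
Proof. by rewrite !mxE; apply: eq_bigr => j _; rewrite mxE. Qed.

Lemma shift_mxE_lt m (E : 'cV[R]_m) (i j : 'I_m) :
  j = i.+1 :> nat -> (shift_mx m *m E) i 0 = E j 0.
Proof.
move=> ji; rewrite shift_mxE (bigD1 j)//= ji eqxx mul1r big1 ?addr0// => k kj.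
by case: eqP => [ki|_]; rewrite ?mul0r//; case/eqP: kj; apply: val_inj; rewrite /= ki.
Qed.

Lemma shift_mxE_max m (E : 'cV[R]_m) (i : 'I_m) :
  (m <= i.+1)%N -> (shift_mx m *m E) i 0 = 0.
Proof.
move=> mi; rewrite shift_mxE big1// => k _.
by case: eqP => [ki|_]; rewrite ?mul0r//; have := ltn_ord k; rewrite ki ltnNge mi.
Qed.

Lemma shift_mx_norm m (E : 'cV[R]_m) : `|shift_mx m *m E| <= `|E|.
Proof.
apply/cV_norm_leP => // i; have [im|mi] := ltnP i.+1 m.
  by rewrite (@shift_mxE_lt _ _ _ (Ordinal im))// cV_norm_le.
by rewrite shift_mxE_max ?normr0.
Qed.

Definition tail m (x : 'cV[R]_m.+2) : 'cV[R]_m.+1 := \col_j x (lift ord0 j) 0.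

Definition on_first m (v : R) : 'cV[R]_m.+1 := \col_j (if j == 0 then v else 0).

Lemma first_onlyE m (x : 'cV[R]_m.+1) : first_only x = on_first m (x 0 0).
Proof.
apply/matrixP => i j; rewrite !mxE; have [->//|i0] := eqVneq i 0.
by rewrite ifF//; apply: contraNF i0 => /eqP i0; apply/eqP/val_inj.
Qed.

Lemma on_first_norm m v : `|on_first m v| = `|v|.
Proof.
apply/eqP; rewrite eq_le; apply/andP; split.
  by apply/cV_norm_leP => // i; rewrite mxE; case: ifP => // _; rewrite normr0.
by have := cV_norm_le (on_first m v) 0; rewrite mxE eqxx.
Qed.

Lemma continuous_on_first m : continuous (on_first m).
Proof.
apply: continuous_cV => i.
have -> : (fun v : R => on_first m v i 0) = (fun v => if i == 0 then v else 0).
  by apply: funext => v; rewrite mxE.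
by case: (i == 0) => v; [exact: cvg_id|exact: cvg_cst].
Qed.

Lemma tail_norm m (x : 'cV[R]_m.+2) : `|tail x| <= `|x|.
Proof. by apply/cV_norm_leP => // i; rewrite mxE cV_norm_le. Qed.

Lemma head_tail_norm m (x : 'cV[R]_m.+2) B :
  `|x 0 0| <= B -> `|tail x| <= B -> `|x| <= B.
Proof.
move=> xB tB; have B0 : 0 <= B := le_trans (normr_ge0 _) xB.
apply/cV_norm_leP => // i; case: (unliftP ord0 i) => [j|] -> //.
by move/cV_norm_leP : tB => /(_ B0 j); rewrite mxE.
Qed.

End Vectors.

(** * Estimates for the extended system *)

Section TwoSidedEstimates.
Context {R : realType}.
Variables (a b l : R) (w y q : R -> R).
Hypotheses (ab : a <= b) (l0 : 0 < l) (cw : {within `[a, b], continuous w}).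
Hypothesis dw : forall t, a < t < b -> is_derive t 1 w (l * (y t - q (w t))).
Hypotheses (qmono : {homo q : u v / u <= v}) (qodd : forall u, q (- u) = - q u).

Let cwN : {within `[a, b], continuous (fun t => - w t)}.
Proof. by move=> t; apply: cvgN; exact: cw. Qed.

(** Since [q] is odd, [- w] solves the same equation with input [- y]; each one-sided estimate thus
    yields its mirror image. *)
Let dwN t : a < t < b ->
  is_derive t 1 (fun t => - w t) (l * (- y t - q (- w t))).
Proof.
move=> tab; have dwt := dw tab; rewrite qodd -opprD mulrN.
exact: is_deriveN.
Qed.

Lemma barrier (W : R) :
  `|w a| <= W -> (forall t, a <= t <= b -> `|y t| <= q W) ->
  forall t, a <= t <= b -> `|w t| <= W.
Proof.
move=> waW yW t tab; rewrite ler_norml; apply/andP; split.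
  rewrite lerNl.
  apply: (@barrier_le R a b l _ (fun t => - y t) q l0 cwN dwN qmono W _ _ t tab) => [|s sab].
    by rewrite (le_trans (ler_norm _))// normrN.
  by rewrite (le_trans (ler_norm _))// normrN yW.
apply: (@barrier_le R a b l w y q l0 cw dw qmono W _ _ t tab) => [|s sab].
  exact: le_trans (ler_norm _) waW.
by rewrite (le_trans (ler_norm _))// yW.
Qed.

Lemma layer (W e : R) :
  continuous q -> {within `[a, b], continuous y} -> 0 < e ->
  `|w a| <= W -> `|w b| <= W -> (forall t, a <= t <= b -> `|y t - y b| <= e / 4) ->
  2 * W < l * (b - a) * (e / 2) -> `|q (w b) - y b| <= e.
Proof.
move=> cq cy e0 wa wb yb big; rewrite ler_norml; apply/andP; split.
  have cyN : {within `[a, b], continuous (fun t => - y t)}.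
    by move=> t; apply: cvgN; exact: cy.
  rewrite lerNl opprB addrC -[leLHS]addrC -[y b]opprK.
  have := @layer_le R a b l (fun t => - w t) (fun t => - y t) q ab l0 cwN dwN
    qmono W e cq cyN e0; rewrite qodd addrC; apply; rewrite ?normrN//.
  by move=> t /yb; rewrite ler_norml; lra.
apply: (layer_le ab l0 cw dw qmono cq cy e0 wa wb) => // t /yb.
by rewrite ler_norml; lra.
Qed.

End TwoSidedEstimates.

Section ExtendedSystem.
Context {R : realType}.

Definition solves N (F : 'cV[R]_N -> 'cV[R]_N) (b : R) (x : R -> 'cV[R]_N) :=
  {within `[0, b], continuous x} /\
  forall t, 0 < t < b -> is_derive t 1 x (F (x t)).

(* The coordinate [x 0 0] is [w = l * e_i] rather than [e_i], so that [q (x 0 0)]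
   does not peak initially when [l] grows. *)
Definition ext_field m (l : R) (q : R -> R) (kappa : R -> 'cV[R]_m.+1)
    (x : 'cV[R]_m.+2) : 'cV[R]_m.+2 :=
  \col_i if unlift ord0 i is Some j
         then (shift_mx m.+1 *m tail x + kappa (q (x 0 0))) j 0
         else l * (tail x 0 0 - q (x 0 0)).

Variables (m : nat) (l : R) (q : R -> R) (kappa : R -> 'cV[R]_m.+1).
Variables (b : R) (x : R -> 'cV[R]_m.+2).
Hypothesis hx : solves (ext_field l q kappa) b x.

Lemma ext_head_derive t : 0 < t < b ->
  is_derive t 1 (fun s => x s 0 0) (l * (tail (x t) 0 0 - q (x t 0 0))).
Proof.
move=> /hx.2/is_derive_coord => /(_ 0); rewrite mxE.
by case: unliftP => [j /(congr1 val)|].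
Qed.

Lemma ext_tail_derive t : 0 < t < b ->
  is_derive t 1 (fun s => tail (x s))
    (shift_mx m.+1 *m tail (x t) + kappa (q (x t 0 0))).
Proof.
move=> /hx.2 dx; apply: is_derive_cV => i.
have := is_derive_coord (lift ord0 i) dx; rewrite mxE liftK.
by rewrite (_ : (fun s => tail (x s) i 0) = fun s => x s (lift ord0 i) 0)//;
  apply: funext => s; rewrite mxE.
Qed.

Lemma ext_head_continuous c d : 0 <= c -> d <= b ->
  {within `[c, d], continuous (fun s => x s 0 0)}.
Proof.
move=> c0 db; apply: within_continuous_coord.
exact: within_itvccW hx.1 c0 db.
Qed.

Lemma ext_tail_continuous c d : 0 <= c -> d <= b ->
  {within `[c, d], continuous (fun s => tail (x s))}.
Proof.
move=> c0 db; apply: within_continuous_cV => i.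
have -> : (fun s => tail (x s) i 0) = (fun s => x s (lift ord0 i) 0).
  by apply: funext => s; rewrite mxE.
apply: within_continuous_coord; exact: within_itvccW hx.1 c0 db.
Qed.

Hypotheses (l0 : 0 < l).
Hypotheses (qmono : {homo q : u v / u <= v}) (qodd : forall u, q (- u) = - q u).

Lemma odd_mono_norm_le u W : `|u| <= W -> `|q u| <= q W.
Proof.
rewrite !ler_norml => /andP[Wu uW]; rewrite -qodd; apply/andP.
by split; exact: qmono.
Qed.

(** The gain [l] acts on the head only, so the speed of the tail is bounded independently of [l]. *)
Lemma ext_speed_bound c d B W C :
  0 <= c -> c <= d -> d <= b -> 0 <= B -> 0 <= C ->
  (forall v, `|v| <= q W -> `|kappa v| <= C) ->
  (forall s, c <= s <= d -> `|tail (x s)| <= B /\ `|x s 0 0| <= W) ->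
  `|tail (x d) - tail (x c)| <= (B + C) * (d - c).
Proof.
move=> c0 cd db B0 C0 kC xB.
have := @dist_MVT R _ (fun s => tail (x s))
  (fun t => shift_mx m.+1 *m tail (x t) + kappa (q (x t 0 0))) c d (B + C) 0 cd.
rewrite scaler0 subr0; apply => //.
- exact: ext_tail_continuous.
- move=> t /andP[ct td]; apply: ext_tail_derive.
  by rewrite (le_lt_trans c0 ct) (lt_le_trans td db).
- exact: addr_ge0.
move=> t /xB[tB tW]; rewrite subr0 (le_trans (ler_normD _ _))// lerD//.
  exact: le_trans (shift_mx_norm _) tB.
by apply: kC; exact: odd_mono_norm_le.
Qed.

(** A continuity argument. Up to the first time at which the tail has norm [2 * B], [barrier] keeps
    the head below [W], so the tail has moved by at most [(2 * B + C) * (d - c) <= B / 2] and is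
    still below [3 * B / 2]. No constant involves [l]. *)
Lemma ext_bound c d B W C :
  0 <= c -> c <= d -> d <= b -> 0 < B -> 0 <= C -> `|x c| <= B -> B <= W ->
  2 * B <= q W -> (forall v, `|v| <= q W -> `|kappa v| <= C) ->
  (2 * B + C) * (d - c) <= B / 2 ->
  forall s, c <= s <= d -> `|tail (x s)| <= 2 * B /\ `|x s 0 0| <= W.
Proof.
move=> c0 cd db B0 C0 xcB BW BqW kC small.
have head r : c <= r <= d ->
    (forall s, c <= s <= r -> `|tail (x s)| <= 2 * B) ->
    forall s, c <= s <= r -> `|x s 0 0| <= W.
  move=> /andP[cr rd] tB.
  apply: (@barrier R c r l (fun s => x s 0 0) (fun s => tail (x s) 0 0) q) => //.
  - exact: ext_head_continuous c0 (le_trans rd db).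
  - move=> t /andP[ct tr]; apply: ext_head_derive.
    by rewrite (le_lt_trans c0 ct) (lt_le_trans tr (le_trans rd db)).
  - by rewrite (le_trans _ BW)// (le_trans _ xcB)// cV_norm_le.
  - move=> t /tB tb; apply: le_trans BqW; apply: le_trans tb; exact: cV_norm_le.
have tB s : c <= s <= d -> `|tail (x s)| <= 2 * B.
  move=> /andP[cs sd]; rewrite leNgt; apply/negP => xs.
  have cn : {within `[c, s], continuous (fun r => `|tail (x r)|)}.
    move=> r; apply: cvg_norm; apply: ext_tail_continuous => //.
    exact: le_trans sd db.
  have x0B : `|tail (x c)| <= B by apply: le_trans xcB; exact: tail_norm.
  have [||r [/andP[cr rs] rE rB]] := first_time (c := 2 * B) cs cn.
  - by apply: (le_trans x0B); lra.
  - exact: ltW.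
  have rd := le_trans rs sd.
  have := @ext_speed_bound c r (2 * B) W C c0 cr (le_trans rd db).
  have -> : 0 <= 2 * B by lra.
  move=> /(_ isT C0 kC) sp.
  have {}sp : `|tail (x r) - tail (x c)| <= (2 * B + C) * (r - c).
    apply: sp => u cur; split; first exact: rB.
    by move: u cur; apply: head; rewrite ?cr ?rd.
  have : (2 * B + C) * (r - c) <= (2 * B + C) * (d - c).
    by rewrite ler_wpM2l ?lerB//; lra.
  have := ler_normB (tail (x r) - tail (x c)) (- tail (x c)).
  rewrite opprK subrK normrN rE; lra.
by move=> s csd; split; [exact: tB|move: s csd; apply: head; rewrite ?cd ?lexx].
Qed.

End ExtendedSystem.

(** The estimate that passes to the limit in [ultra_limit_derive]; [Es] and [kv] stand for the limit
    state and its gain. On the window the shift term errs by at most [e / 4 + e / 4], and the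
    argument of [kappa] lies within [d1] of [Es 0 0]: the layer, the displacement and the distance
    from the tail to [Es] count at most [d1 / 4] each. *)
Lemma ext_tail_increment (R : realType) m l q (kappa : R -> 'cV[R]_m.+1) b x
    (c t s d d1 C e : R) (Es kv : 'cV[R]_m.+1) :
  solves (ext_field l q kappa) b x ->
  0 <= c -> c <= s - d -> s + d <= t -> t <= b -> 0 <= C ->
  C * d <= e / 4 -> C * d <= d1 / 4 ->
  (forall r u, c <= r -> r <= u -> u <= t ->
     `|tail (x u) - tail (x r)| <= C * (u - r)) ->
  (forall r, c <= r <= t -> `|q (x r 0 0) - tail (x r) 0 0| <= d1 / 4) ->
  (forall v, `|v - Es 0 0| < d1 -> `|kappa v - kv| <= e / 2) ->
  `|Es - tail (x s)| < e / 4 -> `|Es - tail (x s)| < d1 / 4 ->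
  forall r, `|r - s| <= d ->
    `|tail (x r) - tail (x s) - (r - s) *: (shift_mx m.+1 *m Es + kv)|
      <= e * `|r - s|.
Proof.
move=> hx c0 csd sdt tb C0 Cde Cd1 lip lay hk nse nsd r rsd.
have d0 : 0 <= d := le_trans (normr_ge0 _) rsd.
have close u : `|u - s| <= d -> `|tail (x u) - tail (x s)| <= C * d.
  rewrite ler_norml => /andP[u1 u2]; have [us|su] := leP u s.
    have cu : c <= u by clear -u1 csd; lra.
    have st : s <= t by clear -d0 sdt; lra.
    rewrite distrC; apply: (le_trans (lip u s cu us st)).
    by rewrite ler_wpM2l//; clear -u1; lra.
  have cs : c <= s by clear -d0 csd; lra.
  have ut : u <= t by clear -u2 sdt; lra.
  apply: (le_trans (lip s u cs (ltW su) ut)).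
  by rewrite ler_wpM2l//; clear -u2; lra.
apply: (@dist_MVT_ball R _ (fun u => tail (x u)) (fun u =>
  shift_mx m.+1 *m tail (x u) + kappa (q (x u 0 0))) s d e) => //.
- by apply: (ext_tail_continuous hx); clear -c0 csd sdt tb; lra.
- move=> u /andP[u1 u2]; apply: (ext_tail_derive hx).
  by clear -c0 csd sdt tb u1 u2; apply/andP; split; lra.
- by have := normr_ge0 (Es - tail (x s)); clear -nse; lra.
move=> u usd; have cu := close u usd.
have nu : `|tail (x u) - Es| <= C * d + `|Es - tail (x s)|.
  rewrite -[X in `|X|](subrKA (tail (x s))) (le_trans (ler_normD _ _))//.
  by rewrite lerD// distrC.
rewrite opprD addrACA -mulmxBr (le_trans (ler_normD _ _))// (splitr e) lerD//.
  by apply: (le_trans (shift_mx_norm _)); clear -nu Cde nse; lra.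
apply: hk.
have lu : `|q (x u 0 0) - tail (x u) 0 0| <= d1 / 4.
  apply: lay; move: usd; rewrite ler_norml => /andP[u1 u2].
  by clear -u1 u2 csd sdt; apply/andP; split; lra.
rewrite -[X in `|X|](subrKA (tail (x u) 0 0)).
apply: (le_lt_trans (ler_normD _ _)).
have := cV_norm_le (tail (x u) - Es) 0; rewrite mxE [(- Es) _ _]mxE => h.
by have := normr_ge0 (Es - tail (x s)); clear -h lu nu Cd1 nsd; lra.
Qed.

(** * Limits of solutions along an ultrafilter *)

(** What the compactness argument uses of global asymptotic stability: a visit to each ball around
    the origin. Maximality is replaced by a condition that can be verified for a pointwise limit of
    solutions. *)
Definition attractive (R : realType) N (F : 'cV[R]_N -> 'cV[R]_N) :=
  forall T x, is_solution F T x ->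
    T = +oo%E \/ (forall B, exists t, [/\ 0 <= t, (t%:E < T)%E & B < `|x t|]) ->
    forall e, 0 < e -> exists t, [/\ 0 < t, (t%:E < T)%E & `|x t| < e].

Lemma cvg_norm_le (R : realType) (V : normedModType R) (U : set_system nat)
    (UU : ProperFilter U) (f : nat -> V) a c :
  f @ U --> a -> (\forall k \near U, `|f k| <= c) -> `|a| <= c.
Proof.
move=> /cvgrPdist_le fa fc; apply/ler_addgt0Pr => e e0.
have [k [ak ck]] := filter_ex (filterI (fa _ e0) fc).
have := ler_normD (a - f k) (f k); rewrite subrK; lra.
Qed.

Section UltraLimit.
Context {R : realType}.
Variables (U : set_system nat) (UU : UltraFilter U).
Hypothesis hU : forall n, \forall k \near U, (n <= k)%N.
Variables (m : nat) (l sigma : nat -> R) (q : nat -> R -> R).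
Variables (kappa : nat -> R -> 'cV[R]_m.+1) (x : nat -> R -> 'cV[R]_m.+2).
Variable Kst : 'cV[R]_m.+1 -> 'cV[R]_m.+1.
Hypothesis hx : forall k, solves (ext_field (l k) (q k) (kappa k)) (sigma k) (x k).
Hypothesis x0 : forall k, `|x k 0| <= 1.
Hypothesis sigma0 : forall k, 0 <= sigma k.
Hypothesis hsigma : forall k, sigma k = k%:R \/ k%:R <= `|x k (sigma k)|.
Hypothesis l0 : forall k, 0 < l k.
Hypothesis lk : forall k, k%:R <= l k.
Hypothesis qcont : forall k, continuous (q k).
Hypothesis qmono : forall k, {homo q k : u v / u <= v}.
Hypothesis qodd : forall k u, q k (- u) = - q k u.
Hypothesis qbig : forall B, exists W, forall k, B <= q k W.
Hypothesis qbounded : forall W, exists B, forall k, q k W <= B.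
(** Convergence uniform near each point, so that it can be used at arguments [q k (w)] that move
    with [k]. *)
Hypothesis hkappa : forall v e, 0 < e -> exists2 d, 0 < d &
  \forall k \near U, forall v', `|v' - v| < d ->
    `|kappa k v' - Kst (on_first m v)| <= e.
Hypothesis Kcont : continuous Kst.

Lemma near_nat_ge (r : R) : \forall k \near U, r <= k%:R.
Proof.
have [n rn] : exists n : nat, r <= n%:R.
  by exists (Num.truncn r).+1; exact/ltW/truncnS_gt.
by apply: filterS (hU n) => k nk; apply: le_trans rn _; rewrite ler_nat.
Qed.

Lemma kappa_bounded B : exists2 C, 0 <= C &
  \forall k \near U, forall v, `|v| <= B -> `|kappa k v| <= C.
Proof.
have [C C0 CB] := continuous_bounded B Kcont.
exists (C + 1); first by rewrite addr_ge0// ltW.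
have cpt : compact [set v : R | `|v| <= B].
  rewrite (_ : [set v | _] = `[- B, B]%classic); first exact: segment_compact.
  by apply/seteqP; split => v /=; rewrite in_itv /= ler_norml.
move/compact_near_coveringP : cpt; apply => v vB.
have [d d0 dk] := hkappa v ltr01.
exists ([set v' | `|v' - v| < d],
        [set k | forall v', `|v' - v| < d -> `|kappa k v' - Kst (on_first m v)| <= 1]).
  split => //=; apply/nbhs_ballP; exists d => // v'.
  by rewrite /ball /= distrC.
move=> [v' k] [/= vv' /(_ v' vv') h].
have : `|Kst (on_first m v)| <= C by apply: CB; rewrite on_first_norm.
have := ler_normD (kappa k v' - Kst (on_first m v)) (Kst (on_first m v)).
rewrite subrK; lra.
Qed.

(** A common lifetime after any time of norm at most [B]: [ext_bound] bounds the solution by [B']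
    while it lasts, and [hsigma] forbids that it ends there once [k] is large. *)
Lemma step_bound B : 0 < B -> exists h B', 0 < h /\
  forall t0, 0 <= t0 -> \forall k \near U, t0 <= sigma k -> `|x k t0| <= B ->
    t0 + h <= sigma k /\ forall s, t0 <= s <= t0 + h -> `|x k s| <= B'.
Proof.
move=> B0; have [W' qW'] := qbig (2 * B).
pose W := Num.max W' B.
have qW k : 2 * B <= q k W.
  by apply: le_trans (qW' k) _; apply: qmono; rewrite le_max lexx.
have BW : B <= W by rewrite le_max lexx orbT.
have [Q qQ] := qbounded W.
have [C C0 kC] := kappa_bounded Q.
(* Chosen so that [(2 * B + C) * h = B / 2], the smallness condition of [ext_bound]. *)
pose h := B / (2 * (2 * B + C)).
have c0 : 0 < 2 * B + C by lra.
have h0 : 0 < h by rewrite divr_gt0 // mulr_gt0.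
pose B' := Num.max (2 * B) W.
exists h, B'; split => // t0 t00.
near=> k => t0s xB.
have kCk : forall v, `|v| <= Q -> `|kappa k v| <= C by near: k.
have bound t1 : t0 <= t1 -> t1 <= sigma k -> t1 <= t0 + h ->
    forall s, t0 <= s <= t1 -> `|x k s| <= B'.
  move=> t01 t1s t1h s st.
  have [||tB wW] := @ext_bound R m _ _ _ _ _ (hx k) (l0 k) (qmono k) (qodd k)
    t0 t1 B W C t00 t01 t1s B0 C0 xB BW (qW k) _ _ s st.
  - move=> v vq; apply: kCk; exact: le_trans vq (qQ k).
  - have : (2 * B + C) * (t1 - t0) <= (2 * B + C) * h.
      by rewrite ler_pM2l//; lra.
    suff -> : (2 * B + C) * h = B / 2 by [].
    by rewrite /h; field; rewrite gt_eqF.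
  - apply: head_tail_norm; rewrite le_max ?wW ?orbT//.
    by rewrite tB.
suff hs : t0 + h <= sigma k by split => //; apply: bound => //; lra.
rewrite leNgt; apply/negP => sh.
have [sk|kx] := hsigma k.
  have : t0 + h <= k%:R by near: k; exact: near_nat_ge.
  by rewrite leNgt -sk sh.
have : B' + 1 <= k%:R by near: k; exact: near_nat_ge.
have := bound (sigma k) t0s (lexx _) (ltW sh) (sigma k).
by rewrite lexx t0s => /(_ isT); lra.
Unshelve. all: by end_near. Qed.

(* Times up to which almost all of the solutions exist and are bounded by a common
   constant. *)
Definition good (t : R) := 0 <= t /\ exists B,
  \forall k \near U, t <= sigma k /\ forall s, 0 <= s <= t -> `|x k s| <= B.

Lemma good0 : good 0.
Proof.
split=> //; exists 1; apply: nearW => k; split => // s /andP[s0 s1].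
by have -> : s = 0 by apply/eqP; rewrite eq_le s0 s1.
Qed.

Lemma good_le s t : 0 <= s -> s <= t -> good t -> good s.
Proof.
move=> s0 st [t0 [B gt]]; split => //; exists B.
apply: filterS gt => k [tk xB]; split; first exact: le_trans tk.
by move=> r /andP[r0 rs]; apply: xB; rewrite r0 (le_trans rs).
Qed.

Lemma good_step t B h B' : good t ->
  (\forall k \near U, `|x k t| <= B) ->
  (forall t0, 0 <= t0 -> \forall k \near U, t0 <= sigma k -> `|x k t0| <= B ->
    t0 + h <= sigma k /\ forall s, t0 <= s <= t0 + h -> `|x k s| <= B') ->
  0 < h -> good (t + h).
Proof.
move=> [t0 [C gt]] xB st h0; split; first lra.
exists (Num.max C B'); near=> k.
have [tk xC] : t <= sigma k /\ forall s, 0 <= s <= t -> `|x k s| <= C by near: k.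
have xkB : `|x k t| <= B by near: k.
have [thk xB'] : t + h <= sigma k /\ forall s, t <= s <= t + h -> `|x k s| <= B'.
  by move: tk xkB; near: k; exact: st.
split => // s /andP[s0 sth]; rewrite le_max.
have [st'|ts] := leP s t; first by rewrite xC ?s0.
by rewrite xB' ?orbT// (ltW ts).
Unshelve. all: by end_near. Qed.

Lemma good_open t : good t -> exists2 h, 0 < h & good (t + h).
Proof.
move=> gt; have [t0 [B gB]] := gt.
have B1 : 0 < Num.max 1 B by rewrite lt_max ltr01.
have [h [B' [h0 H]]] := step_bound B1.
exists h => //; apply: (good_step gt _ H h0).
by apply: filterS gB => k [tk xB]; rewrite le_max xB ?orbT// t0 lexx.
Qed.

Lemma good_lip t : good t -> exists2 C, 0 < C &
  \forall k \near U, forall r s, 0 <= r -> r <= s -> s <= t ->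
    `|tail (x k s) - tail (x k r)| <= C * (s - r).
Proof.
move=> [t0 [B gB]]; have [Q qQ] := qbounded B; have [C C0 kC] := kappa_bounded Q.
have B0 : 0 <= B.
  by have [k [_ /(_ 0)]] := filter_ex gB; rewrite lexx t0 => /(_ isT); exact: le_trans.
exists (B + C + 1); first by lra.
near=> k => r s r0 rs st.
have [tk xB] : t <= sigma k /\ forall s, 0 <= s <= t -> `|x k s| <= B by near: k.
have kCk : forall v, `|v| <= Q -> `|kappa k v| <= C by near: k.
apply: (@le_trans _ _ ((B + C) * (s - r))); last by rewrite ler_wpM2r; lra.
apply: (@ext_speed_bound R m _ _ _ _ _ (hx k) (qmono k) (qodd k) r s B B C) => //.
- exact: le_trans tk.
- move=> v vq; apply: kCk; exact: le_trans vq (qQ k).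
move=> u /andP[ru us].
have xuB : `|x k u| <= B by apply: xB; rewrite (le_trans r0) //= (le_trans us).
by split; apply: le_trans xuB; [exact: tail_norm|exact: cV_norm_le].
Unshelve. all: by end_near. Qed.

(** Since [l k] tends to infinity along [U], [layer] applies on a window [[r - h, r]] of fixed
    length: [h] is so small that the tail varies by at most [e / 4] on it, and [h <= eta] keeps it
    inside nonnegative times. *)
Lemma good_layer t eta e : good t -> 0 < eta -> 0 < e ->
  \forall k \near U, forall r, eta <= r <= t ->
    `|q k (x k r 0 0) - tail (x k r) 0 0| <= e.
Proof.
move=> gt eta0 e0; have [t0 [B gB]] := gt; have [C C0 Clip] := good_lip gt.
pose h := Num.min eta (e / (4 * C)).
have h0 : 0 < h by rewrite lt_min eta0 divr_gt0// mulr_gt0.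
have heta : h <= eta by rewrite ge_min lexx.
have hC : C * h <= e / 4.
  apply: (@le_trans _ _ (C * (e / (4 * C)))); first by rewrite ler_pM2l// ge_min lexx orbT.
  by rewrite le_eqVlt; apply/orP; left; apply/eqP; field; rewrite gt_eqF.
near=> k => r /andP[er rt].
have [tk xB] : t <= sigma k /\ forall s, 0 <= s <= t -> `|x k s| <= B by near: k.
have lip : forall r s, 0 <= r -> r <= s -> s <= t ->
    `|tail (x k s) - tail (x k r)| <= C * (s - r) by near: k.
have rh : r - h <= r by lra.
have rh0 : 0 <= r - h by lra.
apply: (@layer R (r - h) r (l k) (fun s => x k s 0 0) (fun s => tail (x k s) 0 0)
  (q k) rh (l0 k) _ _ (qmono k) (qodd k) B e (@qcont k) _ e0).
- exact: (ext_head_continuous (hx k) rh0 (le_trans rt tk)).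
- move=> s /andP[rs sr]; apply: (ext_head_derive (hx k)).
  by rewrite (le_lt_trans rh0 rs) (lt_le_trans sr (le_trans rt tk)).
- apply: within_continuous_coord.
  exact: (ext_tail_continuous (hx k) rh0 (le_trans rt tk)).
- by rewrite /= (le_trans (cV_norm_le _ _))// xB// rh0 (le_trans rh rt).
- by rewrite /= (le_trans (cV_norm_le _ _))// xB// rt (le_trans rh0 rh).
- move=> s /andP[rs sr] /=.
  have := lip s r (le_trans rh0 rs) sr rt.
  have : C * (r - s) <= C * h by rewrite ler_pM2l//; lra.
  have := cV_norm_le (tail (x k r) - tail (x k s)) 0.
  by rewrite mxE [(- tail _) _ _]mxE distrC; lra.
- have -> : r - (r - h) = h by lra.
  have h2 : 0 < h * (e / 2) by rewrite mulr_gt0//; lra.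
  have : (2 * B + 1) / (h * (e / 2)) <= l k.
    by apply: le_trans (lk k); near: k; exact: near_nat_ge.
  rewrite ler_pdivrMr// -mulrA; lra.
Unshelve. all: by end_near. Qed.

(** Only the tails are shown to converge; the heads need not be equicontinuous near time 0. The
    value is meaningful at good times only. *)
Definition ultra_limit (t : R) := lim (tail (x k t) @[k --> U]).

Lemma good_cvg t : good t -> tail (x k t) @[k --> U] --> ultra_limit t.
Proof.
move=> [t0 [B gB]].
have [|y _ yE] := @ultra_compact _ _ U UU _ (fun k => tail (x k t))
    (@closed_ball_compact_cV R m.+1 B).
  apply: filterS gB => k [tk xB] /=; apply: (le_trans (tail_norm _)).
  by apply: xB; rewrite t0 lexx.
by apply/cvg_ex; exists y.
Qed.

Lemma ultra_limit_lip t : good t -> exists2 C, 0 < C &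
  forall r s, 0 <= r -> r <= s -> s <= t -> `|ultra_limit s - ultra_limit r| <= C * (s - r).
Proof.
move=> gt; have [C C0 lip] := good_lip gt; exists C => // r s r0 rs st.
have cs := good_cvg (good_le (le_trans r0 rs) st gt).
have cr := good_cvg (good_le r0 (le_trans rs st) gt).
apply: (@cvg_norm_le _ _ U _ (fun k => tail (x k s) - tail (x k r))).
  exact: cvgB.
by apply: filterS lip => k; apply.
Qed.

Lemma ultra_limit_derive t s : good t -> 0 < s < t ->
  is_derive s 1 ultra_limit (error_system Kst (ultra_limit s)).
Proof.
move=> gt /andP[s0 st]; apply: is_derive_dist => e e0.
have [C C0 lip] := good_lip gt.
have e2 : 0 < e / 2 by lra.
have [d1 d10 hk] := hkappa (ultra_limit s 0 0) e2.
have gs : good s := good_le (ltW s0) (ltW st) gt.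
(* The first two terms keep the window inside [[s / 2, t]], beyond the initial layer and within the
   good times; the other two bound the displacement [C * d]. *)
pose d := Num.min (Num.min (s / 2) (t - s)) (Num.min (d1 / (4 * C)) (e / (4 * C))).
have C4 : 0 < 4 * C by lra.
have d0 : 0 < d by rewrite !lt_min !divr_gt0//; lra.
have ds : d <= s / 2 by rewrite !ge_min lexx.
have dts : d <= t - s by rewrite !ge_min lexx orbT.
have dd1 : C * d <= d1 / 4.
  rewrite mulrC -ler_pdivlMr// (_ : _ / C = d1 / (4 * C)).
    by rewrite /d !ge_min lexx !orbT.
  by field; rewrite gt_eqF.
have de : C * d <= e / 4.
  rewrite mulrC -ler_pdivlMr// (_ : _ / C = e / (4 * C)).
    by rewrite /d !ge_min lexx !orbT.
  by field; rewrite gt_eqF.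
have sd2 : s / 2 <= s - d by lra.
have sdt : s + d <= t by lra.
exists d => // r rsd.
have [rd1 rd2] : s - d < r /\ r < s + d by move: rsd; rewrite ltr_norml; lra.
have gr : good r by apply: good_le gt; lra.
set g := error_system Kst (ultra_limit s).
have cr := good_cvg gr; have cs := good_cvg gs.
apply: (@cvg_norm_le _ _ U _ (fun k => tail (x k r) - tail (x k s) - (r - s) *: g)).
  by apply: cvgB; [exact: cvgB|exact: cvg_cst].
have s2 : 0 < s / 2 by lra.
have d14 : 0 < d1 / 4 by lra.
have lay := good_layer gt s2 d14.
have e4 : 0 < Num.min (e / 4) (d1 / 4) by rewrite lt_min; lra.
have near_s : \forall k \near U, `|ultra_limit s - tail (x k s)| < Num.min (e / 4) (d1 / 4).
  by move/cvgrPdist_lt : cs; apply.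
have [t0 [B gB]] := gt.
near=> k.
have [tk _] : t <= sigma k /\ forall s, 0 <= s <= t -> `|x k s| <= B by near: k.
have lipk : forall r s, 0 <= r -> r <= s -> s <= t ->
    `|tail (x k s) - tail (x k r)| <= C * (s - r) by near: k.
have layk : forall r, s / 2 <= r <= t ->
    `|q k (x k r 0 0) - tail (x k r) 0 0| <= d1 / 4 by near: k.
have hkk : forall v', `|v' - ultra_limit s 0 0| < d1 ->
    `|kappa k v' - Kst (on_first m (ultra_limit s 0 0))| <= e / 2 by near: k.
have : `|ultra_limit s - tail (x k s)| < Num.min (e / 4) (d1 / 4) by near: k.
rewrite lt_min => /andP[nse nsd].
rewrite /g /error_system first_onlyE.
apply: (@ext_tail_increment R m _ _ _ _ _ (s / 2) t s d d1 C e _ _ (hx k)) => //;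
  try exact: ltW.
by move=> r' u ru; apply: lipk; exact: le_trans (ltW s2) ru.
Unshelve. all: by end_near. Qed.

(** [T] is the supremum of the good times and is not itself good. Were it finite and the limit
    bounded by [B], then shortly before [T] almost all tails would be bounded by [B + 1], the layer
    estimate would bound the heads, and [step_bound] would give a good time beyond [T]. *)
Lemma ultra_solution : exists T, [/\ is_solution (error_system Kst) T ultra_limit,
  forall t, 0 <= t -> (t%:E < T)%E -> good t &
  T = +oo%E \/ forall B, exists t, [/\ 0 <= t, (t%:E < T)%E & B < `|ultra_limit t|]].
Proof.
pose T := ereal_sup [set t%:E | t in good].
have Tgood t : 0 <= t -> (t%:E < T)%E -> good t.
  move=> t0 /ereal_sup_gt[_ [s gs <-]]; rewrite lte_fin => ts.
  exact: good_le (ltW ts) gs.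
have goodT t : good t -> (t%:E < T)%E.
  move=> /good_open[h h0 gth]; apply: (@lt_le_trans _ _ (t + h)%:E).
    by rewrite lte_fin ltrDl.
  by apply: ereal_sup_ubound; exists (t + h).
have T0 : (0 < T)%E by have := goodT 0 good0.
have next t : good t -> exists2 s, t < s & good s.
  by move=> /good_open[h h0 gth]; exists (t + h) => //; rewrite ltrDl.
exists T; split => //.
- split => //.
    apply/subspace_continuousP => t /= [t0 tT].
    have [s ts gs] := next _ (Tgood _ t0 tT).
    have [C C0 lip] := ultra_limit_lip gs.
    apply/cvgrPdist_lt => e e0; rewrite near_withinE; near=> r => /= -[r0 rT].
    have rs : r <= s.
      by apply/ltW; near: r; exact: lt_nbhsl.
    have rt : `|t - r| < e / C.
      by near: r; apply: cvgr_dist_lt; rewrite ?divr_gt0.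
    have [tr|rt'] := leP t r.
      rewrite distrC (le_lt_trans (lip t r t0 tr rs))//.
      by rewrite mulrC -ltr_pdivlMr// -(ger0_norm (_ : 0 <= r - t)) ?subr_ge0// distrC.
    rewrite (le_lt_trans (lip r t r0 (ltW rt') (ltW ts)))//.
    by rewrite mulrC -ltr_pdivlMr// -(gtr0_norm (_ : 0 < t - r)) ?subr_gt0.
  move=> t t0 tT; have [s ts gs] := next _ (Tgood _ (ltW t0) tT).
  by apply: (ultra_limit_derive gs); rewrite t0.
- move: goodT T0 Tgood; clearbody T; case: T => [T| |] //; last by left.
  rewrite lte_fin => goodT T0 Tgood; right => B; apply: contrapT => nB.
  have EB t : 0 <= t -> t < T -> `|ultra_limit t| <= B.
    by move=> t0 tT; rewrite leNgt; apply/negP => Bt; apply: nB; exists t; rewrite lte_fin.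
  have B0 : 0 <= B by apply: le_trans (EB 0 _ T0).
  (* [q (w)] will have absolute value at most [B + 2]: [B + 1] from the tail and 1 from the layer.
     Being below [q k W], this forces the head below [W]. *)
  have [W qW] := qbig (B + 3).
  pose B' := Num.max (B + 1) W.
  have B'0 : 0 < B' by rewrite lt_max; apply/orP; left; lra.
  have [h [B'' [h0 step]]] := step_bound B'0.
  (* Late enough for one step of length [h] to cross [T], and positive so that the layer estimate
     applies. *)
  pose t := Num.max (T / 2) (T - h / 2).
  have t0 : 0 < t by rewrite lt_max; apply/orP; left; lra.
  have tT : t < T by rewrite gt_max; apply/andP; split; lra.
  have gt : good t by apply: Tgood; [exact: ltW|rewrite lte_fin].
  suff /goodT : good (t + h).
    rewrite lte_fin => thT; have : T - h / 2 <= t by rewrite le_max lexx orbT.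
    by lra.
  apply: (good_step gt _ step h0).
  have t2 : 0 < t / 2 by lra.
  have lay := good_layer gt t2 ltr01.
  have /cvgrPdist_lt/(_ _ ltr01) cE := good_cvg gt.
  near=> k.
  have Ek : `|ultra_limit t - tail (x k t)| < 1 by near: k.
  have layk : forall r, t / 2 <= r <= t ->
      `|q k (x k r 0 0) - tail (x k r) 0 0| <= 1 by near: k.
  have tk : `|tail (x k t)| <= B + 1.
    have := ler_normB (ultra_limit t) (ultra_limit t - tail (x k t)).
    by rewrite opprB addrC subrK; have := EB t (ltW t0) tT; lra.
  have {}layk : `|q k (x k t 0 0) - tail (x k t) 0 0| <= 1.
    by apply: layk; rewrite lexx andbT; lra.
  have qk : `|q k (x k t 0 0)| < B + 3.
    have := ler_normD (q k (x k t 0 0) - tail (x k t) 0 0) (tail (x k t) 0 0).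
    by rewrite subrK; have := cV_norm_le (tail (x k t)) 0; lra.
  apply: head_tail_norm; last by rewrite le_max tk.
  rewrite le_max; apply/orP; right; rewrite ler_norml; apply/andP; split.
    rewrite leNgt; apply/negP => xW.
    have := @qmono k _ _ (ltW xW); rewrite qodd; have := qW k.
    by move: qk; rewrite ltr_norml; lra.
  rewrite leNgt; apply/negP => xW.
  have := @qmono k _ _ (ltW xW); have := qW k.
  by move: qk; rewrite ltr_norml; lra.
Unshelve. all: by end_near. Qed.

(** The limit enters the ball of radius [e / 4] and almost all tails follow it; the layer estimate
    then gives [|q (w)| < eta <= q rho], hence [|w| <= rho] by monotonicity and oddness. *)
Lemma ultra_hit rho : 0 < rho -> attractive (error_system Kst) ->
  (exists2 eta, 0 < eta & forall k, eta <= q k rho) ->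
  exists k t, 0 <= t <= sigma k /\ `|x k t| <= rho.
Proof.
move=> rho0 att [eta eta0 qrho]; have [T [sol Tg Tend]] := ultra_solution.
pose e := Num.min rho eta.
have e0 : 0 < e by rewrite lt_min rho0.
have e4 : 0 < e / 4 by lra.
have [t [t0 tT Et]] := att _ _ sol Tend _ e4.
have gt := Tg _ (ltW t0) tT.
have t2 : 0 < t / 2 by lra.
have lay := good_layer gt t2 e4.
have /cvgrPdist_lt/(_ _ e4) cE := good_cvg gt.
have [_ [B gB]] := gt.
have [k [[layk Ek] [tk _]]] := filter_ex (filterI (filterI lay cE) gB).
exists k, t; split; first by rewrite (ltW t0).
have tek : `|tail (x k t)| <= e / 2.
  have := ler_normB (ultra_limit t) (ultra_limit t - tail (x k t)).
  by rewrite opprB addrC subrK; lra.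
have {}layk : `|q k (x k t 0 0) - tail (x k t) 0 0| <= e / 4.
  by apply: layk; rewrite lexx andbT; lra.
have qk : `|q k (x k t 0 0)| < eta.
  have := ler_normD (q k (x k t 0 0) - tail (x k t) 0 0) (tail (x k t) 0 0).
  have ee : e <= eta by rewrite ge_min lexx orbT.
  by rewrite subrK; have := cV_norm_le (tail (x k t)) 0; lra.
have er : e <= rho by rewrite ge_min lexx.
apply: head_tail_norm; last by lra.
have := qrho k; rewrite ler_norml => qk'; apply/andP; split.
  rewrite leNgt; apply/negP => xW.
  have := @qmono k _ _ (ltW xW); rewrite qodd.
  by move: qk; rewrite ltr_norml; lra.
rewrite leNgt; apply/negP => xW.
by have := @qmono k _ _ (ltW xW); move: qk; rewrite ltr_norml; lra.
Qed.

End UltraLimit.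

Lemma solves_le (R : realType) N (F : 'cV[R]_N -> 'cV[R]_N) (a b : R) x :
  a <= b -> solves F b x -> solves F a x.
Proof.
move=> ab [cx dx]; split; first exact: within_itvccW cx (lexx _) ab.
by move=> t /andP[t0 ta]; apply: dx; rewrite t0 (lt_le_trans ta).
Qed.

(** * Uniform contraction, by contradiction and compactness *)

Section UniformContraction.
Context {R : realType}.
Variables (m : nat) (q : R -> R -> R) (kappa : R -> R -> 'cV[R]_m.+1).
Hypothesis qcont : forall u : R, continuous (q u).
Hypothesis qmono : forall u : R, {homo q u : v w / v <= w}.
Hypothesis qodd : forall u v : R, q u (- v) = - q u v.
Hypothesis qbig : forall B : R, exists W, forall u, B <= q u W.
Hypothesis qbounded : forall W : R, exists B, forall u, q u W <= B.
Hypothesis qlow : forall rho : R, 0 < rho ->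
  exists2 eta : R, 0 < eta & forall u, eta <= q u rho.
Hypothesis hfam : forall U : set_system nat, UltraFilter U ->
  forall u : nat -> R, exists Kst : 'cV[R]_m.+1 -> 'cV[R]_m.+1,
  [/\ continuous Kst, attractive (error_system Kst) &
    forall v e : R, 0 < e -> exists2 d : R, 0 < d &
      \forall k \near U, forall v' : R, `|v' - v| < d ->
        `|kappa (u k) v' - Kst (on_first m v)| <= e].

(** The second alternative is for solutions that end before the common time [T]: they are still
    bounded by [M], which later excludes escape in finite time. *)
Lemma uniform_contraction (rho : R) : 0 < rho -> exists T M L : R,
  forall l u sigma x, 0 < l -> L <= l -> 0 <= sigma ->
    solves (ext_field l (q u) (kappa u)) sigma x -> `|x 0| <= 1 ->
    (exists t, [/\ 0 <= t <= sigma, t <= T, `|x t| <= rho &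
       forall s, 0 <= s <= t -> `|x s| <= M]) \/
    (sigma < T /\ forall s, 0 <= s <= sigma -> `|x s| <= M).
Proof.
move=> rho0; apply: contrapT => nTML.
have bad (k : nat) : exists p : (R * R) * (R * (R -> 'cV[R]_m.+2)),
    [/\ 0 < p.1.1 /\ k%:R <= p.1.1, 0 <= p.2.1,
      solves (ext_field p.1.1 (q p.1.2) (kappa p.1.2)) p.2.1 p.2.2,
      `|p.2.2 0| <= 1 /\ (p.2.1 = k%:R \/ k%:R <= `|p.2.2 p.2.1|) &
      forall t, 0 <= t <= p.2.1 -> rho < `|p.2.2 t|].
  apply: contrapT => nbad; apply: nTML; exists k%:R, (k%:R + 1), k%:R.
  move=> l u sigma x l0 Ll s0 hx x01; apply: contrapT => nAB.
  (* A solution violating both alternatives, cut at a time up to which it is bounded by [k + 1],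
     cannot have visited the ball of radius [rho]; so it qualifies for the bad sequence as soon as
     [s = k] or its norm at [s] is at least [k]. *)
  have mk s : 0 <= s -> s <= sigma -> s <= k%:R -> s = k%:R \/ k%:R <= `|x s| ->
      (forall r, 0 <= r <= s -> `|x r| <= k%:R + 1) -> False.
    move=> s0' ss sk send xk; apply: nbad; exists ((l, u), (s, x)); split => //=.
      exact: solves_le hx.
    move=> t /andP[t0 ts]; rewrite ltNge; apply/negP => xt; apply: nAB; left.
    exists t; split => //; first by rewrite t0 (le_trans ts ss).
      exact: le_trans ts sk.
    by move=> r /andP[r0 rt]; apply: xk; rewrite r0 (le_trans rt ts).
  have xk0 : `|x 0| <= k%:R + 1 by rewrite (le_trans x01)// lerDr.
  have [nk|] := pselect (exists2 s, 0 <= s <= Num.min sigma k%:R & k%:R + 1 < `|x s|).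
    have [s /andP[s0' ss] ks] := nk.
    move: ss; rewrite le_min => /andP[ss sk].
    have cn : {within `[0, s], continuous (fun r => `|x r|)}.
      by move=> r; apply: cvg_norm; apply: within_itvccW hx.1 (lexx _) ss _.
    have [r [/andP[r0 rs] rE rle]] := first_time s0' cn xk0 (ltW ks).
    apply: (mk r) => //; [exact: le_trans ss|exact: le_trans sk|].
    by right; rewrite rE lerDl.
  move=> nk.
  have xle s : 0 <= s -> s <= sigma -> s <= k%:R -> `|x s| <= k%:R + 1.
    move=> s0' ss sk; rewrite leNgt; apply/negP => ks; apply: nk; exists s => //.
    by rewrite s0' le_min ss.
  have [sk|ks] := ltP sigma k%:R.
    apply: nAB; right; split => // s /andP[s0' ss]; apply: xle => //.
    exact: le_trans (ltW sk).
  apply: (mk k%:R) => //; first by left.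
  by move=> r /andP[r0 rk]; apply: xle => //; exact: le_trans ks.
have [p hp] := choice bad.
have [U [UU oU]] := ultraFilterLemma (eventually_filter).
have hU n : \forall k \near U, (n <= k)%N by apply: oU; exact: nbhs_infty_ge.
have [Kst [Kc Ka Kk]] := hfam UU (fun k => (p k).1.2).
have [k [t [tk]]] := @ultra_hit R U UU hU m (fun k => (p k).1.1)
  (fun k => (p k).2.1) (fun k => q (p k).1.2) (fun k => kappa (p k).1.2)
  (fun k => (p k).2.2) Kst
  (fun k => let: And5 _ _ h _ _ := hp k in h)
  (fun k => let: And5 _ _ _ h _ := hp k in h.1)
  (fun k => let: And5 _ h _ _ _ := hp k in h)
  (fun k => let: And5 _ _ _ h _ := hp k in h.2)
  (fun k => let: And5 h _ _ _ _ := hp k in h.1)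
  (fun k => let: And5 h _ _ _ _ := hp k in h.2)
  (fun k => @qcont _) (fun k => @qmono _) (fun k => @qodd _)
  (fun B => let: ex_intro W h := qbig B in ex_intro _ W (fun k => h _))
  (fun B => let: ex_intro W h := qbounded B in ex_intro _ W (fun k => h _))
  Kk Kc rho rho0 Ka
  (let: ex_intro2 eta e0 h := qlow rho0 in ex_intro2 _ _ eta e0 (fun k => h _)).
by have [_ _ _ _ /(_ t tk)] := hp k; rewrite ltNge => /negP.
Qed.

End UniformContraction.

(** * Peano's theorem and extension of bounded solutions *)

Section Peano.
Context {R : realType}.
Variables (N : nat) (F : 'cV[R]_N -> 'cV[R]_N).
Hypothesis cF : continuous F.

Fixpoint euler (step : R) (x0 : 'cV[R]_N) (j : nat) : 'cV[R]_N :=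
  if j is j'.+1 then euler step x0 j' + step *: F (euler step x0 j') else x0.

Lemma euler_bounded (step C h : R) x0 j : 0 <= step -> 0 <= C -> C * h <= 1 ->
  (forall x, `|x| <= `|x0| + 1 -> `|F x| <= C) -> j%:R * step <= h ->
  `|euler step x0 j - x0| <= C * (j%:R * step).
Proof.
move=> s0 C0 Ch FC; elim: j => [|j IH] jh; first by rewrite subrr normr0 mul0r mulr0.
have jsh : j%:R * step <= h.
  by apply: le_trans jh; rewrite ler_wpM2r// ler_nat.
have {}IH := IH jsh; rewrite /= addrAC (le_trans (ler_normD _ _))//.
rewrite -natr1 mulrDl mul1r mulrDr lerD// normrZ ger0_norm// mulrC ler_wpM2r//.
apply: FC; rewrite -[X in `|X|](subrK x0) (le_trans (ler_normD _ _))// addrC lerD2l.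
by apply: (le_trans IH); apply: le_trans Ch; rewrite ler_wpM2l.
Qed.

Lemma euler_increment (step e : R) x0 g a b : 0 <= step -> (a <= b)%N ->
  (forall j, (a <= j < b)%N -> `|F (euler step x0 j) - g| <= e) ->
  `|euler step x0 b - euler step x0 a - ((b%:R - a%:R) * step) *: g|
    <= e * ((b%:R - a%:R) * step).
Proof.
move=> s0 /subnKC <-; elim: (b - a)%N => [|j IH] Fg.
  by rewrite addn0 !subrr mul0r scale0r subr0 normr0 mulr0.
have {}IH : `|euler step x0 (a + j) - euler step x0 a -
    (((a + j)%:R - a%:R) * step) *: g| <= e * (((a + j)%:R - a%:R) * step).
  by apply: IH => i /andP[ai ij]; apply: Fg; rewrite ai addnS ltnW.
have Fj := Fg (a + j)%N; rewrite leq_addr addnS leqnn in Fj.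
have {}Fj := Fj isT.
rewrite addnS /= -natr1.
set y := euler step x0 (a + j) in IH Fj *.
set c := (a + j)%:R - a%:R in IH *.
have -> : (a + j)%:R + 1 - a%:R = c + 1 by rewrite /c addrAC.
have -> : y + step *: F y - euler step x0 a - ((c + 1) * step) *: g =
    (y - euler step x0 a - (c * step) *: g) + step *: (F y - g).
  have -> : (c + 1) * step = c * step + step by ring.
  rewrite scalerDl scalerBr opprD !addrA.
  by rewrite (addrAC y) (addrAC _ (step *: F y)).
have -> : e * ((c + 1) * step) = e * (c * step) + e * step by ring.
rewrite (le_trans (ler_normD _ _))// lerD// normrZ ger0_norm//.
by rewrite mulrC ler_wpM2r.
Qed.

(** The last clause is a strict form of [z' = F (z)], with both endpoints free near [t]; it contains
    the one-sided derivatives at 0 and [h], which gluing to another solution requires. Limits along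
    an ultrafilter replace the Arzela-Ascoli theorem. *)
Lemma peano x0 : exists (h C : R) (z : R -> 'cV[R]_N), [/\ 0 < h, z 0 = x0, 0 < C,
  forall s r, 0 <= s -> s <= r -> r <= h -> `|z r - z s| <= C * (r - s) &
  forall (t e : R), 0 <= t -> t <= h -> 0 < e -> exists2 d, 0 < d &
    forall s r, 0 <= s -> s <= r -> r <= h -> `|s - t| < d -> `|r - t| < d ->
      `|z r - z s - (r - s) *: F (z t)| <= e * (r - s)].
Proof.
have [C C0 FC] := continuous_bounded (`|x0| + 1) cF.
(* Up to time [1 / C] the Euler points stay within distance 1 of [x0], in the ball where [C] bounds
   [F]. *)
pose h := C^-1; have h0 : 0 < h by rewrite invr_gt0.
have Ch : C * h <= 1 by rewrite divff// gt_eqF.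
have [U [UU oU]] := ultraFilterLemma (eventually_filter).
have hU n : \forall k \near U, (n <= k)%N by apply: oU; exact: nbhs_infty_ge.
pose step (k : nat) : R := k.+1%:R^-1.
have step0 k : 0 < step k by rewrite invr_gt0.
(* Times are rounded down to the grid instead of interpolating; the error is at most one step, which
   tends to 0. *)
pose idx k (t : R) := Num.truncn (t * k.+1%:R).
pose X k j := euler (step k) x0 j.
have idx_le k t : 0 <= t -> (idx k t)%:R * step k <= t.
  by move=> t0; rewrite ler_pdivrMr// truncn_le mulr_ge0.
have idx_gt k t : t < (idx k t)%:R * step k + step k.
  rewrite -[X in _ + X]mul1r -mulrDl ltr_pdivlMr// natr1; exact: truncnS_gt.
have idxW k s t : s <= t -> (idx k s <= idx k t)%N.
  by move=> st; apply: le_truncn; rewrite ler_wpM2r.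
have near_step (e : R) : 0 < e -> \forall k \near U, step k < e.
  move=> e0; apply: filterS (near_nat_ge UU hU e^-1) => k ke.
  rewrite -[e]invrK ltf_pV2 ?posrE ?invr_gt0//.
  by apply: (le_lt_trans ke); rewrite ltr_nat.
have Xball k j : j%:R * step k <= h -> `|X k j| <= `|x0| + 1.
  move=> jh; have := euler_bounded (ltW (step0 k)) (ltW C0) Ch FC jh.
  rewrite -/(X k j) => h1; rewrite -[X in `|X|](subrK x0) (le_trans (ler_normD _ _))//.
  rewrite addrC lerD2l; apply: (le_trans h1); apply: le_trans Ch.
  by rewrite ler_pM2l.
have Xlip k a b : (a <= b)%N -> b%:R * step k <= h ->
    `|X k b - X k a| <= C * ((b%:R - a%:R) * step k).
  move=> ab bh; have := @euler_increment (step k) C x0 0 a b (ltW (step0 k)) ab.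
  rewrite scaler0 subr0; apply => j /andP[_ jb]; rewrite subr0; apply: FC.
  by apply: Xball; apply: le_trans bh; rewrite ler_pM2r// ler_nat ltnW.
pose z t := lim (X k (idx k t) @[k --> U]).
have zcvg t : 0 <= t -> t <= h -> X k (idx k t) @[k --> U] --> z t.
  move=> t0 th.
  have [|y _ yE] := @ultra_compact _ _ U UU _ (fun k => X k (idx k t))
    (@closed_ball_compact_cV R N (`|x0| + 1)).
    by apply: nearW => k /=; apply: Xball; apply: le_trans th; exact: idx_le.
  by apply/cvg_ex; exists y.
exists h, C, z; split => //.
- have zE : (fun k => X k (idx k 0)) = fun=> x0.
    by apply: funext => k; rewrite /idx mul0r truncn0.
  by rewrite /z zE; exact: lim_cst.
- move=> s r s0 sr rh; have r0 := le_trans s0 sr; have sh := le_trans sr rh.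
  apply/ler_addgt0Pr => e e0.
  apply: (@cvg_norm_le _ _ U _ (fun k => X k (idx k r) - X k (idx k s))).
    by apply: cvgB; apply: zcvg.
  apply: filterS (near_step (e / C) _) => [k|]; last by rewrite divr_gt0.
  rewrite ltr_pdivlMr// => ke.
  have ir := idx_le k r (le_trans s0 sr); have is' := idx_gt k s.
  apply: (le_trans (Xlip k _ _ (idxW k _ _ sr) (le_trans ir rh))).
  have : C * (((idx k r)%:R - (idx k s)%:R) * step k) <= C * (r - s + step k).
    by rewrite ler_pM2l// mulrBl; lra.
  by lra.
move=> t e t0 th e0.
have /cvgrPdist_le/(_ _ e0)/nbhs_ballP[d1 /= d10 Fd1] := @cF (z t).
pose d := d1 / (4 * C); have d0 : 0 < d by rewrite divr_gt0// mulr_gt0.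
have Cd : C * d = d1 / 4 by rewrite /d; field; rewrite gt_eqF.
exists d => // s r s0 sr rh std rtd.
have r0 := le_trans s0 sr; have sh := le_trans sr rh.
apply/ler_addgt0Pr => e' e'0.
apply: (@cvg_norm_le _ _ U _
    (fun k => X k (idx k r) - X k (idx k s) - (r - s) *: F (z t))).
  apply: cvgB; last exact: cvg_cst.
  by apply: cvgB; apply: zcvg.
have /cvgrPdist_lt/(_ (d1 / 4)) := zcvg t t0 th.
rewrite divr_gt0// => /(_ isT) zt.
pose G := `|F (z t)| + e; have G0 : 0 < G by rewrite ltr_wpDl.
near=> k.
have ztk : `|z t - X k (idx k t)| < d1 / 4 by near: k.
have sd : step k < d / 2 by near: k; apply: near_step; lra.
have sG : step k * G < e'.
  by rewrite -ltr_pdivlMr//; near: k; apply: near_step; rewrite divr_gt0.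
have ir1 := idx_le k r (le_trans s0 sr); have ir2 := idx_gt k r.
have is1 := idx_le k s s0; have is2 := idx_gt k s.
have it1 := idx_le k t t0; have it2 := idx_gt k t.
have Fj j : (idx k s <= j < idx k r)%N -> `|F (X k j) - F (z t)| <= e.
  move=> /andP[sj jr]; rewrite distrC; apply: Fd1; rewrite -ball_normE /=.
  have sj' : (idx k s)%:R * step k <= j%:R * step k by rewrite ler_pM2r// ler_nat.
  have jr' : j%:R * step k <= (idx k r)%:R * step k by rewrite ler_pM2r// ler_nat ltnW.
  suff : `|X k (idx k t) - X k j| <= C * (2 * d).
    move=> h1; have := ler_normD (z t - X k (idx k t)) (X k (idx k t) - X k j).
    by rewrite subrKA; lra.
  have /ltr_normlP[? ?] := std; have /ltr_normlP[? ?] := rtd.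
  have [jt|tj] := leqP j (idx k t).
    apply: (le_trans (Xlip k _ _ jt (le_trans it1 th))).
    by rewrite ler_pM2l// mulrBl; lra.
  rewrite distrC.
  apply: (le_trans (Xlip k _ _ (ltnW tj) (le_trans jr' (le_trans ir1 rh)))).
  by rewrite ler_pM2l// mulrBl; lra.
have := euler_increment (ltW (step0 k)) (idxW k _ _ sr) Fj.
rewrite -/(X k _) -/(X k _) mulrBl.
set D := _ * step k - _ * step k => h1.
have Drs : `|D - (r - s)| <= step k by rewrite ler_norml /D; apply/andP; split; lra.
clearbody D.
have -> : X k (idx k r) - X k (idx k s) - (r - s) *: F (z t) =
    (X k (idx k r) - X k (idx k s) - D *: F (z t)) + (D - (r - s)) *: F (z t).
  by rewrite [(D - _) *: _]scalerBl addrA subrK.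
apply: (le_trans (ler_normD _ _)); rewrite normrZ.
have : `|D - (r - s)| * `|F (z t)| <= step k * `|F (z t)| by rewrite ler_wpM2r.
have : e * D <= e * (r - s + step k).
  by rewrite ler_pM2l//; move: Drs; rewrite ler_norml; lra.
by move: sG; rewrite /G; lra.
Unshelve. all: by end_near. Qed.

End Peano.

Lemma lipschitz_within (R : realType) (V : normedModType R) (A : set R)
    (f : R -> V) (C : R) : 0 < C ->
  (forall r s, A r -> A s -> r <= s -> `|f s - f r| <= C * (s - r)) ->
  {within A, continuous f}.
Proof.
move=> C0 lip; apply/subspace_continuousP => t At.
apply/cvgrPdist_lt => e e0; rewrite near_withinE; near=> r => Ar.
have rt : `|t - r| < e / C.
  by near: r; apply: cvgr_dist_lt; rewrite ?divr_gt0.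
rewrite ltr_pdivlMr// mulrC in rt; apply: le_lt_trans rt.
have [tr|rt] := leP t r.
  by rewrite distrC (le_trans (lip t r At Ar tr))// ler_pM2l// distrC ler_norm.
by rewrite (le_trans (lip r t Ar At (ltW rt)))// ler_pM2l// ler_norm.
Unshelve. all: by end_near. Qed.

Section Extension.
Context {R : realType}.
Variables (N : nat) (F : 'cV[R]_N -> 'cV[R]_N).
Hypothesis cF : continuous F.

Lemma bounded_solution_lipschitz (T B : R) x :
  is_solution F T%:E x -> (forall t, 0 <= t -> t < T -> `|x t| <= B) ->
  exists2 C, 0 < C &
    forall r s, 0 <= r -> r <= s -> s < T -> `|x s - x r| <= C * (s - r).
Proof.
move=> [_ cx dx] xB; have [C C0 FC] := continuous_bounded B cF.
exists C => // r s r0 rs sT.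
have := @dist_MVT R N x (fun t => F (x t)) r s C 0 rs.
rewrite scaler0 subr0; apply => //; first last.
- by move=> t /andP[rt ts]; rewrite subr0 FC// xB// ?(le_trans r0)// (le_lt_trans ts).
- exact: ltW.
- move=> t /andP[rt ts]; apply: dx; first exact: le_lt_trans rt.
  by rewrite lte_fin (lt_trans ts).
apply: continuous_subspaceW cx => t /=; rewrite in_itv /= => /andP[rt ts].
by rewrite (le_trans r0 rt) lte_fin (le_lt_trans ts).
Qed.

Lemma left_limit (T C : R) (x : R -> 'cV[R]_N) : 0 < T -> 0 < C ->
  (forall r s, 0 <= r -> r <= s -> s < T -> `|x s - x r| <= C * (s - r)) ->
  exists x1, forall t, 0 <= t -> t < T -> `|x1 - x t| <= C * (T - t).
Proof.
move=> T0 C0 lip.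
have [U [UU oU]] := ultraFilterLemma (eventually_filter).
have hU n : \forall k \near U, (n <= k)%N by apply: oU; exact: nbhs_infty_ge.
pose t_ (k : nat) : R := T - T / k.+1%:R.
have t0 k : 0 <= t_ k.
  by rewrite subr_ge0 ler_pdivrMr//; apply: ler_peMr; [exact: ltW|rewrite ler1n].
have tT k : t_ k < T by rewrite gtrBl divr_gt0.
have [|x1 _ x1E] := @ultra_compact _ _ U UU _ (fun k => x (t_ k))
    (@closed_ball_compact_cV R N (`|x 0| + C * T)).
  apply: nearW => k /=; rewrite -[X in `|X|](subrK (x 0)).
  rewrite (le_trans (ler_normD _ _))// addrC lerD2l.
  by apply: (le_trans (lip _ _ _ (t0 k) (tT k))) => //; rewrite subr0 ler_pM2l// ltW.
exists x1 => t t0' tT'.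
apply: (@cvg_norm_le _ _ U _ (fun k => x (t_ k) - x t)).
  by apply: cvgB => //; exact: cvg_cst.
have Tt : 0 < T - t by rewrite subr_gt0.
apply: filterS (near_nat_ge UU hU (T / (T - t))) => k kT.
have ttk : t <= t_ k.
  rewrite /t_ lerBrDr -lerBrDl ler_pdivrMr// mulrC -ler_pdivrMr//.
  by apply: (le_trans kT); rewrite ler_nat.
by apply: (le_trans (lip _ _ t0' ttk (tT k))); rewrite ler_pM2l// lerD2r ltW.
Qed.

(** A bounded solution is Lipschitz, hence has a left limit at [T], where a Peano solution is
    attached; only differentiability at [T] involves both halves. *)
Lemma solution_extends (T B : R) x : 0 < T ->
  is_solution F T%:E x -> (forall t, 0 <= t -> t < T -> `|x t| <= B) ->
  exists T' y, [/\ T < T', is_solution F T'%:E y &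
    forall t, 0 <= t -> t < T -> y t = x t].
Proof.
move=> T0 sx xB; have [C1 C10 lip1] := bounded_solution_lipschitz sx xB.
have [x1 hx1] := left_limit T0 C10 lip1.
have [h [C2 [z [h0 z0 C20 lip2 dz]]]] := peano cF x1.
pose y t := if t < T then x t else z (t - T).
have yT : y T = x1 by rewrite /y ltxx subrr.
pose C := Num.max C1 C2; have C0 : 0 < C by rewrite lt_max C10.
have lip r s : 0 <= r -> r <= s -> s <= T + h -> `|y s - y r| <= C * (s - r).
  move=> r0 rs sT; rewrite /y; have [sT'|Ts] := ltP s T.
    rewrite (le_lt_trans rs sT') (le_trans (lip1 _ _ r0 rs sT'))//.
    by rewrite ler_wpM2r ?subr_ge0// le_max lexx.
  have C2C : C2 <= C by rewrite le_max lexx orbT.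
  have C1C : C1 <= C by rewrite le_max lexx.
  have [rT|Tr] := ltP r T.
    rewrite -(subrKA x1) (le_trans (ler_normD _ _))//.
    have -> : C * (s - r) = C * (s - T) + C * (T - r) by ring.
    rewrite lerD//.
      have := lip2 0 (s - T); rewrite z0 subr0 lexx subr_ge0 lerBlDl => /(_ isT Ts sT) h1.
      by apply: (le_trans h1); rewrite ler_wpM2r// subr_ge0.
    by apply: (le_trans (hx1 _ r0 rT)); rewrite ler_wpM2r// subr_ge0 ltW.
  have := lip2 (r - T) (s - T); rewrite subr_ge0 lerD2r lerBlDl => /(_ Tr rs sT) h1.
  apply: (le_trans h1); rewrite opprB addrA subrK.
  by rewrite ler_wpM2r// subr_ge0.
have cy : {within [set t : R | 0 <= t /\ (t%:E < (T + h)%:E)%E], continuous y}.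
  apply: (lipschitz_within C0) => r s /= [r0 _] [_ sT] rs; apply: lip => //.
  by rewrite lte_fin in sT; exact: ltW.
have [_ _ dx] := sx.
have dyl t : 0 < t -> t < T -> is_derive t 1 y (F (y t)).
  move=> t0 tT.
  have dxt : is_derive t 1 x (F (x t)) by apply: dx; rewrite ?lte_fin.
  have yE : y t = x t by rewrite /y tT.
  rewrite yE; apply: (@near_eq_is_derive _ _ _ x y) => //.
  by near=> r; rewrite /y ifT//; near: r; exact: lt_nbhsl.
exists (T + h), y; split; first by rewrite ltrDl.
  split => //; first by rewrite lte_fin addr_gt0.
  move=> t t0; rewrite lte_fin => tTh; have [tT|Tt|tT] := ltgtP t T; first exact: dyl.
    apply: is_derive_dist => e e0.
    have [||d d0 hd] := dz (t - T) e _ _ e0; [lra|lra|].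
    have dd : 0 < Num.min d (Num.min (t - T) (T + h - t)).
      by rewrite !lt_min d0; apply/andP; split; lra.
    exists (Num.min d (Num.min (t - T) (T + h - t))) => // s.
    rewrite !lt_min => /and3P[sd /ltr_normlP[s1 s2] /ltr_normlP[s3 s4]].
    have sT : T < s by lra.
    have yE u : T < u -> y u = z (u - T) by move=> Tu; rewrite /y ltNge (ltW Tu).
    rewrite !yE//; have [ts|st] := leP t s.
      have := hd (t - T) (s - T); rewrite subrr normr0 d0 !opprB !addrA !subrK.
      rewrite ger0_norm ?subr_ge0//; apply => //; try lra.
      by move: sd; rewrite ger0_norm ?subr_ge0.
    rewrite increment_sym (distrC s t).
    have := hd (s - T) (t - T); rewrite subrr normr0 d0 !opprB !addrA !subrK.
    have ts0 : 0 <= t - s by lra.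
    by rewrite (ger0_norm ts0); apply => //; lra.
  (* At the junction: Peano's estimate on the right; on the left, the mean value theorem and
     continuity of [F] at [x1]. *)
  rewrite tT yT; apply: is_derive_dist => e e0.
  have [||d d0 hd] := dz 0 e _ _ e0; [by []|exact: ltW|].
  have /cvgrPdist_le/(_ _ e0)/nbhs_ballP[d1 /= d10 Fd1] := @cF x1.
  have dd : 0 < Num.min (Num.min d h) (Num.min T (d1 / C)).
    by rewrite !lt_min d0 h0 T0 divr_gt0.
  exists (Num.min (Num.min d h) (Num.min T (d1 / C))) => // s.
  rewrite !lt_min => /andP[/andP[sd sh] /andP[sT sdC]].
  have [Ts|sT'] := leP T s.
    rewrite ger0_norm ?subr_ge0// in sd sh *.
    rewrite yT /y ltNge Ts /= -z0.
    have := hd 0 (s - T); rewrite !subr0 lexx subr_ge0 Ts normr0 d0 z0.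
    by rewrite ger0_norm ?subr_ge0//; apply => //; exact: ltW.
  rewrite increment_sym ltr0_norm ?subr_lt0// opprB in sT sdC *.
  apply: (@dist_MVT R N y (fun t => F (y t)) s T e) => //.
  - exact: ltW.
  - apply: continuous_subspaceW cy => u /=; rewrite in_itv /= => /andP[su uT].
    by split; [lra|rewrite lte_fin; lra].
  - by move=> u /andP[su uT]; apply: dyl => //; lra.
  - exact: ltW.
  move=> u /andP[su uT]; rewrite distrC; apply: Fd1; rewrite -ball_normE /= -yT.
  have u0 : 0 <= u by lra.
  apply: (le_lt_trans (lip u T u0 uT _)); first by lra.
  rewrite mulrC -ltr_pdivlMr//; lra.
by move=> t t0 tT; rewrite /y tT.
Unshelve. all: by end_near. Qed.

End Extension.

(** * From uniform contraction to global asymptotic stability *)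

Section Rescaling.
Context {R : realType}.

Definition scale_cV N (c : 'I_N -> R) (x : 'cV[R]_N) : 'cV[R]_N :=
  \col_j (c j * x j 0).

Lemma continuous_scale_cV N (c : 'I_N -> R) : continuous (scale_cV c).
Proof.
apply: continuous_cV => i.
have -> : (fun x => scale_cV c x i 0) = (fun x => c i * x i 0).
  by apply: funext => x; rewrite mxE.
by move=> x; apply: (@continuous_comp _ _ _ (fun x : 'cV[R]_N => x i 0) ( *%R (c i)));
  [exact: coord_continuous|exact: mulrl_continuous].
Qed.

Lemma is_solution_solves N (F : 'cV[R]_N -> 'cV[R]_N) T x (b : R) :
  is_solution F T x -> (b%:E < T)%E -> solves F b x.
Proof.
move=> [_ cx dx] bT; split.
  apply: continuous_subspaceW cx => t /=; rewrite in_itv /= => /andP[t0 tb].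
  by split => //; apply: le_lt_trans bT; rewrite lee_fin.
by move=> t /andP[t0 tb]; apply: dx => //; apply: lt_trans bT; rewrite lte_fin.
Qed.

Lemma is_derive_affine_comp (f : R -> R) (t0 k s df : R) :
  is_derive (t0 + s * k) 1 f df -> is_derive s 1 (fun s => f (t0 + s * k)) (k * df).
Proof.
move=> dfx.
have da : is_derive s 1 (fun s => t0 + s * k) k.
  apply: is_derive_eq; rewrite add0r /GRing.scale /=; ring.
have := @is_derive1_comp R f (fun s => t0 + s * k) s df k dfx da.
by rewrite mulrC.
Qed.

Lemma solves_rescale N (F G : 'cV[R]_N -> 'cV[R]_N) (b t0 sigma k : R)
    (c : 'I_N -> R) x :
  solves F b x -> 0 <= t0 -> 0 < k -> t0 + sigma * k <= b ->
  (forall y, G (scale_cV c y) = k *: scale_cV c (F y)) ->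
  solves G sigma (fun s => scale_cV c (x (t0 + s * k))).
Proof.
move=> [cx dx] t00 k0 sb GF; split.
  apply: (@within_continuous_comp 'cV[R]_N R 'cV[R]_N _
    (fun s => x (t0 + s * k)) (scale_cV c)).
    by move=> y _; exact: continuous_scale_cV.
  apply/within_itvccP => t /andP[t0' ts] e e0.
  have tb u : 0 <= u -> u <= sigma -> 0 <= t0 + u * k <= b.
    move=> u0 us; rewrite addr_ge0 ?mulr_ge0 ?(ltW k0)//=.
    by apply: le_trans sb; rewrite lerD2l ler_pM2r.
  have /within_itvccP/(_ _ (tb t t0' ts) e e0)[d d0 hd] := cx.
  exists (d / k); first by rewrite divr_gt0.
  move=> s /andP[s0 ss] std; apply: hd; first exact: tb.
  by rewrite opprD addrACA subrr add0r -mulrBl normrM (gtr0_norm k0) -ltr_pdivlMr.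
move=> t /andP[t0' ts].
have dxt : is_derive (t0 + t * k) 1 x (F (x (t0 + t * k))).
  apply: dx; rewrite ltr_wpDl ?mulr_gt0//=.
  by apply: lt_le_trans sb; rewrite ltrD2l ltr_pM2r.
rewrite GF; apply: is_derive_cV => i; rewrite !mxE.
have -> : (fun s => scale_cV c (x (t0 + s * k)) i 0) =
    (fun s => c i *: (x (t0 + s * k) i 0 : R^o)).
  by apply: funext => s; rewrite mxE.
have := is_derive_affine_comp (is_derive_coord i dxt) => dh.
apply: is_derive_eq; rewrite /GRing.scale /=; ring.
Qed.

End Rescaling.

Section ContractionStability.
Context {R : realType}.
Variables (N : nat) (F : 'cV[R]_N -> 'cV[R]_N) (G : R -> 'cV[R]_N -> 'cV[R]_N).
Variables (c : R -> 'I_N -> R) (k : R -> R) (T0 M rho h : R).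
Hypothesis cF : continuous F.
Hypothesis F0 : F 0 = 0.
Hypothesis k0 : forall u, 0 < k u.
Hypothesis GF : forall u y, G u (scale_cV (c u) y) = k u *: scale_cV (c u) (F y).
Hypothesis rho1 : rho < 1.
Hypothesis contraction : forall u sigma y, 0 <= sigma ->
  solves (G u) sigma y -> `|y 0| <= 1 ->
  (exists t, [/\ 0 <= t <= sigma, t <= T0, `|y t| <= rho &
     forall s, 0 <= s <= t -> `|y s| <= M]) \/
  (sigma < T0 /\ forall s, 0 <= s <= sigma -> `|y s| <= M).
(** The sets [|scale_cV (c u) x| <= 1] replace the sublevel sets of a Lyapunov function, [u] being
    the logarithm of the level. They absorb the radii [rho] and [M] after a shift of [u], shrink to
    the origin, are neighbourhoods of it, cover the space and are bounded. *)
Hypothesis scale_rho : forall u x,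
  `|scale_cV (c u) x| <= rho -> `|scale_cV (c (u - 1)) x| <= 1.
Hypothesis scale_M : forall u x,
  `|scale_cV (c u) x| <= M -> `|scale_cV (c (u + h)) x| <= 1.
Hypothesis scale_small : forall e : R, 0 < e -> exists u0, forall u x, u <= u0 ->
  `|scale_cV (c u) x| <= 1 -> `|x| < e.
Hypothesis scale_near0 : forall u, exists2 d : R, 0 < d &
  forall x, `|x| < d -> `|scale_cV (c u) x| <= 1.
Hypothesis scale_all : forall x, exists u, `|scale_cV (c u) x| <= 1.
Hypothesis scale_bounded : forall u, exists B : R,
  forall x, `|scale_cV (c u) x| <= 1 -> `|x| <= B.

(** [contraction] is applied from the last time [r] at which the solution lies in the set of level
    [u]. It cannot reach the smaller ball afterwards, so the bound by [M] holds up to time [t]. *)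
Lemma contraction_invariant T x u (t1 : R) : is_solution F T x -> 0 <= t1 ->
  `|scale_cV (c u) (x t1)| <= 1 ->
  forall t, t1 <= t -> (t%:E < T)%E -> `|scale_cV (c (u + h)) (x t)| <= 1.
Proof.
move=> sx t10 xt1 t t1t tT; apply: scale_M.
have sxt := is_solution_solves sx tT.
pose f s := `|scale_cV (c u) (x s)|.
have cf a b : 0 <= a -> b <= t -> {within `[a, b], continuous f}.
  move=> a0 bt; apply: (@within_continuous_comp 'cV[R]_N R R _ x
    (fun y => `|scale_cV (c u) y|)); last exact: within_itvccW sxt.1 a0 bt.
  by move=> y _; apply: continuous_comp; [exact: continuous_scale_cV|exact: norm_continuous].
have [r [/andP[t1r rt] fr fgt]] := last_time t1t (cf _ _ t10 (lexx t)) xt1.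
have r0 : 0 <= r := le_trans t10 t1r.
pose sigma := (t - r) / k u.
have sigma0 : 0 <= sigma by rewrite divr_ge0 ?subr_ge0// ltW.
have sk : sigma * k u = t - r by rewrite /sigma divfK// gt_eqF.
have st : r + sigma * k u <= t by rewrite sk addrC subrK.
have := contraction sigma0 (solves_rescale sxt r0 (k0 u) st (GF u)).
rewrite mul0r addr0 => /(_ fr) [[t' [/andP[t'0 t's] _ t'rho t'M]]|[_ /(_ sigma)]];
  last by rewrite lexx sigma0 sk (addrC r) subrK; apply.
have [rt'|rt'] := eqVneq r t.
  by rewrite -rt'; have := t'M 0; rewrite lexx t'0 mul0r addr0; apply.
(* A visit to the ball of radius [rho < 1] contradicts the choice of [r]: directly if it occurs
   after [r], by continuity if it occurs at [r]. *)
exfalso; have rt2 : r < t by rewrite lt_neqAle rt'.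
have f1 : f (r + t' * k u) < 1 by exact: le_lt_trans t'rho rho1.
move: t'0; rewrite le_eqVlt => /predU1P[t'0|t'0]; last first.
  have : 1 < f (r + t' * k u).
    apply: fgt; rewrite ltrDl mulr_gt0//=; apply: le_trans st.
    by rewrite lerD2l ler_pM2r.
  by move/(lt_trans f1); rewrite ltxx.
rewrite -t'0 mul0r addr0 in f1.
have /within_itvccP/(_ r) := cf r t r0 (lexx t).
rewrite lexx rt => /(_ isT (1 - f r)); rewrite subr_gt0 => /(_ f1)[d d0 hd].
pose s := Num.min t (r + d / 2).
have rs : r < s by rewrite lt_min rt2 ltrDl divr_gt0.
have st' : s <= t by rewrite ge_min lexx.
have sd : s <= r + d / 2 by rewrite ge_min lexx orbT.
have := hd s; rewrite (ltW rs) st' => /(_ isT).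
have fs : 1 < f s by apply: fgt; rewrite rs st'.
rewrite gtr0_norm ?subr_gt0// => /(_ _)/ltr_normlP[|_]; lra.
Qed.

Lemma contraction_step x u (t1 : R) : is_solution F +oo%E x -> 0 <= t1 ->
  `|scale_cV (c u) (x t1)| <= 1 ->
  exists2 t, 0 <= t & `|scale_cV (c (u - 1)) (x t)| <= 1.
Proof.
move=> sx t10 xt1.
(* A duration of at least [T0] excludes the second alternative of [contraction]. *)
pose sigma := Num.max 0 T0.
have sigma0 : 0 <= sigma by rewrite le_max lexx.
have sxt := is_solution_solves sx (ltry (t1 + sigma * k u)).
have := contraction sigma0 (solves_rescale sxt t10 (k0 u) (lexx _) (GF u)).
rewrite mul0r addr0 => /(_ xt1)[[t [/andP[t0 _] _ trho _]]|[]].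
  exists (t1 + t * k u); first by rewrite addr_ge0// mulr_ge0// ltW.
  exact: scale_rho.
by rewrite ltNge le_max lexx orbT.
Qed.

Lemma contraction_iter x u n : is_solution F +oo%E x ->
  `|scale_cV (c u) (x 0)| <= 1 ->
  exists2 t, 0 <= t & `|scale_cV (c (u - n%:R)) (x t)| <= 1.
Proof.
move=> sx x0; elim: n => [|n [t t0 xt]]; first by exists 0; rewrite ?subr0.
have [s s0 xs] := contraction_step sx t0 xt; exists s => //.
by rewrite -natr1 opprD addrA.
Qed.

Lemma contraction_gas : globally_asymptotically_stable F.
Proof.
split=> // [e e0|T x [sx maxx]].
  have [u0 hu] := scale_small e0.
  have [d d0 hd] := scale_near0 (u0 - h); exists d => // T x sx xd t t0 tT.
  apply: (hu u0) => //; rewrite -(subrK h u0).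
  exact: (contraction_invariant sx (lexx 0) (hd _ xd)).
have [u xu] := scale_all (x 0).
have Too : T = +oo%E.
  case: T sx maxx => [T sx maxx|//|[H _ _]]; last by rewrite ltNge leNye in H.
  have T00 : 0 < T by case: sx; rewrite lte_fin.
  have [B hB] := scale_bounded (u + h).
  have [|T' [y [TT' sy yx]]] := @solution_extends R N F cF T B x T00 sx.
    move=> t t0 tT; apply: hB.
    by apply: (contraction_invariant sx (lexx 0) xu); rewrite ?lte_fin.
  have TT'E : (T%:E <= T'%:E)%E by rewrite lee_fin ltW.
  have yx' t : 0 <= t -> (t%:E < T%:E)%E -> y t = x t.
    by rewrite lte_fin; exact: yx.
  by have [T'T] := maxx T'%:E y sy TT'E yx'; rewrite T'T ltxx in TT'.
split => //; rewrite Too in sx.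
apply/cvgrPdist_lt => e e0; have [u0 hu] := scale_small e0.
have [n un] : exists n : nat, u - n%:R + h <= u0.
  exists (Num.truncn (u + h - u0)).+1.
  have := truncnS_gt (u + h - u0); lra.
have [s s0 xs] := contraction_iter n sx xu.
near=> t; rewrite sub0r normrN; apply: (hu _ _ un).
apply: (contraction_invariant sx s0 xs); last exact: ltry.
by near: t; apply: nbhs_pinfty_ge; exact: num_real.
Unshelve. all: by end_near. Qed.

End ContractionStability.

(** * Powers with two homogeneity degrees *)

Section PiecewiseLinear.
Context {R : realType}.

(* On a logarithmic scale, homogeneity with one degree near the origin and
   another near infinity: the slope is [a] on negative [u] and [b] on positive
   [u]. *)
Definition pl (a b u : R) : R := a * Num.min u 0 + b * Num.max u 0.

Lemma pl0 a b : pl a b 0 = 0.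
Proof. by rewrite /pl minxx maxxx !mulr0 addr0. Qed.

Lemma pl_neg a b u : u <= 0 -> pl a b u = a * u.
Proof. by move=> u0; rewrite /pl min_l// max_r// mulr0 addr0. Qed.

Lemma pl_pos a b u : 0 <= u -> pl a b u = b * u.
Proof. by move=> u0; rewrite /pl min_r// max_l// mulr0 add0r. Qed.

Lemma plD a b c d u : pl (a + c) (b + d) u = pl a b u + pl c d u.
Proof. by rewrite /pl; ring. Qed.

Lemma pl_incr_ge a b r u h : r <= a -> r <= b -> 0 <= h ->
  r * h <= pl a b (u + h) - pl a b u.
Proof.
move=> ra rb h0.
have [d1 d2] : 0 <= Num.min (u + h) 0 - Num.min u 0 /\
    0 <= Num.max (u + h) 0 - Num.max u 0.
  by rewrite /Num.min /Num.max; do 2 case: ifPn => /=; rewrite -?leNgt; lra.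
have dh : h = (Num.min (u + h) 0 - Num.min u 0) + (Num.max (u + h) 0 - Num.max u 0).
  by rewrite /Num.min /Num.max; do 2 case: ifPn => /=; rewrite -?leNgt; lra.
rewrite [X in r * X]dh /pl; move: d1 d2.
set x := _ - _; set y := _ - _ => d1 d2.
have -> : a * Num.min (u + h) 0 + b * Num.max (u + h) 0 -
    (a * Num.min u 0 + b * Num.max u 0) = a * x + b * y by rewrite /x /y; ring.
by rewrite mulrDr lerD// ler_wpM2r.
Qed.

Lemma pl_incr_le a b r u h : a <= r -> b <= r -> 0 <= h ->
  pl a b (u + h) - pl a b u <= r * h.
Proof.
move=> ra rb h0; have := @pl_incr_ge (- a) (- b) (- r) u h.
have plN v : pl (- a) (- b) v = - pl a b v by rewrite /pl; ring.
by rewrite !plN !lerN2 => /(_ ra rb h0); lra.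
Qed.

(** [pl a0 b0] preserves signs, so both functions break at 0 and the slopes multiply. *)
Lemma pl_comp a0 b0 a1 b1 u : 0 < a0 -> 0 < b0 ->
  pl (a1 / a0) (b1 / b0) (pl a0 b0 u) = pl a1 b1 u.
Proof.
move=> a00 b00; have [u0|u0] := leP u 0.
  by rewrite !pl_neg// ?mulrA ?divfK ?gt_eqF// pmulr_rle0.
by rewrite !pl_pos ?(ltW u0)// ?mulrA ?divfK ?gt_eqF// mulr_ge0// ltW.
Qed.

End PiecewiseLinear.

Section PowerFunction.
Context {R : realType}.

Lemma continuous_powR_pos (a t : R) : 0 < t -> {for t, continuous (fun t : R => t `^ a)}.
Proof.
move=> t0; apply/differentiable_continuous/derivable1_diffP.
by apply: derivable_powR; rewrite in_itv /= t0.
Qed.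

Lemma continuous_powR_max0 (a : R) : 0 < a ->
  continuous (fun t : R => Num.max t 0 `^ a).
Proof.
move=> a0 t; have [t0|t0|->] := ltgtP t 0.
- apply/cvgrPdist_lt => e e0; near=> s.
  have s0 : s < 0 by near: s; exact: lt_nbhsl.
  by rewrite !max_r ?subrr ?normr0// ltW.
- apply: (@continuous_comp _ _ _ (fun t : R => Num.max t 0) (fun t => t `^ a)).
    by apply: continuous_max; [exact: cvg_id|exact: cvg_cst].
  by apply: continuous_powR_pos; rewrite lt_max t0.
rewrite /continuous_at maxxx powR0 ?gt_eqF//.
apply/cvgrPdist_lt => e e0; near=> s.
rewrite sub0r normrN ger0_norm ?powR_ge0//.
have -> : e = (e `^ a^-1) `^ a by rewrite -powRrM mulVf ?gt_eqF// powRr1 ?ltW.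
apply: gt0_ltr_powR => //; rewrite ?nnegrE ?powR_ge0 ?le_max ?lexx ?orbT//.
rewrite gt_max powR_gt0// andbT; near: s; apply: lt_nbhsl; exact: powR_gt0.
Unshelve. all: by end_near. Qed.

(** A product rather than a case distinction: one factor is always 1, and continuity and
    monotonicity follow factor by factor. *)
Definition bipow_half (a b t : R) : R :=
  Num.max (Num.min t 1) 0 `^ a * Num.max t 1 `^ b.

(* The odd function equal to [t `^ a] on [0, 1] and to [t `^ b] on [1, +oo[; the
   maximum with 0 is there because [powR] equals 1 on negative numbers. *)
Definition bipow (a b t : R) : R := bipow_half a b t - bipow_half a b (- t).

Variables (a b : R).
Hypotheses (a0 : 0 < a) (b0 : 0 < b).

Lemma bipow_half_neg t : t <= 0 -> bipow_half a b t = 0.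
Proof.
move=> t0; rewrite /bipow_half max_r ?powR0 ?gt_eqF// ?mul0r//.
by rewrite ge_min t0.
Qed.

Lemma bipow_half_le1 t : 0 <= t -> t <= 1 -> bipow_half a b t = t `^ a.
Proof.
by move=> t0 t1; rewrite /bipow_half min_l// max_l// max_r// powR1 mulr1.
Qed.

Lemma bipow_half_ge1 t : 1 <= t -> bipow_half a b t = t `^ b.
Proof.
by move=> t1; rewrite /bipow_half min_r// !max_l// powR1 mul1r.
Qed.

Lemma bipow_half_mono : {homo bipow_half a b : s t / s <= t}.
Proof.
move=> s t st; rewrite /bipow_half.
have mn : Num.min s 1 <= Num.min t 1 by rewrite le_min !ge_min st lexx orbT.
have mx0 : Num.max (Num.min s 1) 0 <= Num.max (Num.min t 1) 0.
  by rewrite ge_max !le_max mn lexx orbT.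
have mx1 : Num.max s 1 <= Num.max t 1 by rewrite ge_max !le_max st lexx orbT.
apply: ler_pM; rewrite ?powR_ge0//; apply: ge0_ler_powR => //; try exact: ltW;
  by rewrite nnegrE le_max ?lexx ?ler01 orbT.
Qed.

Lemma continuous_bipow_half : continuous (bipow_half a b).
Proof.
move=> t; apply: cvgM.
  apply: (@continuous_comp _ _ _ (fun t : R => Num.min t 1)
    (fun t : R => Num.max t 0 `^ a)); last exact: continuous_powR_max0.
  by apply: continuous_min; [exact: cvg_id|exact: cvg_cst].
apply: (@continuous_comp _ _ _ (fun t : R => Num.max t 1) (fun t => t `^ b)).
  by apply: continuous_max; [exact: cvg_id|exact: cvg_cst].
by apply: continuous_powR_pos; rewrite lt_max ltr01 orbT.
Qed.

Lemma continuous_bipow : continuous (bipow a b).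
Proof.
move=> t; apply: cvgB; first exact: continuous_bipow_half.
apply: (@continuous_comp _ _ _ -%R (bipow_half a b)).
  exact: opp_continuous.
exact: continuous_bipow_half.
Qed.

Lemma bipow_odd t : bipow a b (- t) = - bipow a b t.
Proof. by rewrite /bipow opprK opprB. Qed.

Lemma bipow_mono : {homo bipow a b : s t / s <= t}.
Proof. by move=> s t st; rewrite lerB// bipow_half_mono// lerN2. Qed.

Lemma bipow_pos t : 0 <= t -> bipow a b t = bipow_half a b t.
Proof. by move=> t0; rewrite /bipow (@bipow_half_neg (- t)) ?subr0// oppr_le0. Qed.

Lemma bipow0 : bipow a b 0 = 0.
Proof. by rewrite bipow_pos// bipow_half_neg. Qed.

Lemma bipow_expR s : bipow a b (expR s) = expR (pl a b s).
Proof.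
rewrite bipow_pos ?expR_ge0//; have [s0|s0] := leP s 0.
  by rewrite bipow_half_le1 ?expR_ge0 ?expR_le1// -expRM mulrC pl_neg.
by rewrite bipow_half_ge1 -?expRM 1?mulrC ?pl_pos ?(ltW s0)// -expR0 ler_expR ltW.
Qed.

End PowerFunction.

Section RescaledPower.
Context {R : realType}.
Variables (a0 b0 a1 b1 : R).
Hypotheses (a00 : 0 < a0) (b00 : 0 < b0) (a10 : 0 < a1) (b10 : 0 < b1).

Let al := a1 / a0.
Let be := b1 / b0.
Let al0 : 0 < al. Proof. exact: divr_gt0. Qed.
Let be0 : 0 < be. Proof. exact: divr_gt0. Qed.

(** [bipow] in the units of scale [u]: [expR (pl a0 b0 u)] for its argument, [expR (pl a1 b1 u)] for
    its value. *)
Definition rescaled_pow (u w : R) : R :=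
  bipow (a1 / a0) (b1 / b0) (expR (pl a0 b0 u) * w) / expR (pl a1 b1 u).

Lemma continuous_rescaled_pow u : continuous (rescaled_pow u).
Proof.
move=> w; apply: cvgM; last exact: cvg_cst.
apply: (@continuous_comp _ _ _ ( *%R (expR (pl a0 b0 u)))); first exact: mulrl_continuous.
exact: continuous_bipow.
Qed.

Lemma rescaled_pow_mono u : {homo rescaled_pow u : v w / v <= w}.
Proof.
move=> v w vw; rewrite ler_wpM2r ?invr_ge0 ?expR_ge0// bipow_mono//.
by rewrite ler_wpM2l ?expR_ge0.
Qed.

Lemma rescaled_pow_odd u w : rescaled_pow u (- w) = - rescaled_pow u w.
Proof. by rewrite /rescaled_pow mulrN bipow_odd mulNr. Qed.

(** The exponent is an increment of a function with slopes [al] and [be], so it is comparable to [h]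
    uniformly in [u]; the three uniform bounds below rest on this. *)
Lemma rescaled_pow_expR u h : rescaled_pow u (expR h) =
  expR (pl al be (pl a0 b0 u + h) - pl al be (pl a0 b0 u)).
Proof. by rewrite /rescaled_pow -expRD bipow_expR// -expRN -expRD pl_comp. Qed.

Lemma rescaled_pow_large B : exists W, forall u, B <= rescaled_pow u W.
Proof.
pose r := Num.min al be; have r0 : 0 < r by rewrite lt_min al0.
pose h := Num.max 0 (B / r); have h0 : 0 <= h by rewrite le_max lexx.
exists (expR h) => u; rewrite rescaled_pow_expR.
have Bh : B <= r * h by rewrite mulrC -ler_pdivrMr// le_max lexx orbT.
have := @pl_incr_ge R al be r (pl a0 b0 u) h.
rewrite !ge_min !lexx orbT => /(_ isT isT h0).
set z := _ - _ => rz; have := expR_ge1Dx z; lra.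
Qed.

Lemma rescaled_pow_bounded W : exists B, forall u, rescaled_pow u W <= B.
Proof.
pose r := Num.max al be.
pose h := Num.max 0 W; have h0 : 0 <= h by rewrite le_max lexx.
exists (expR (r * h)) => u; apply: (@le_trans _ _ (rescaled_pow u (expR h))).
  apply: rescaled_pow_mono; apply: (@le_trans _ _ h); first by rewrite le_max lexx orbT.
  by have := expR_ge1Dx h; lra.
rewrite rescaled_pow_expR ler_expR.
by apply: pl_incr_le; rewrite // le_max lexx ?orbT.
Qed.

Lemma rescaled_pow_low rho : 0 < rho ->
  exists2 eta, 0 < eta & forall u, eta <= rescaled_pow u rho.
Proof.
move=> rho0; pose r := Num.max al be.
(* Then [expR (- h) <= rho], because [expR h >= 1 + h >= rho^-1]. *)
pose h := rho^-1; have h0 : 0 <= h by rewrite invr_ge0 ltW.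
exists (expR (- (r * h))) => [|u]; first exact: expR_gt0.
apply: (@le_trans _ _ (rescaled_pow u (expR (- h)))); last first.
  apply: rescaled_pow_mono; rewrite expRN -[leRHS]invrK lef_pV2 ?posrE ?expR_gt0 ?invr_gt0//.
  by have := expR_ge1Dx h; rewrite -/h; lra.
rewrite rescaled_pow_expR ler_expR.
have := @pl_incr_le R al be r (pl a0 b0 u - h) h.
by rewrite !le_max !lexx orbT subrK => /(_ isT isT h0); lra.
Qed.

End RescaledPower.

(** * The observer field *)

Lemma pos_lower_bound (R : realType) (f : nat -> R) n :
  (forall j, (j <= n)%N -> 0 < f j) ->
  exists2 r, 0 < r & forall j, (j <= n)%N -> r <= f j.
Proof.
elim: n => [|n IH] f0; first by exists (f 0); [exact: f0|case].
have [r r0 hr] := IH (fun j jn => f0 j (leqW jn)).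
exists (Num.min r (f n.+1)); first by rewrite lt_min r0 f0.
by move=> j; rewrite leq_eqVlt => /predU1P[->|jn]; rewrite ge_min ?lexx ?orbT// hr.
Qed.

Lemma upper_bound (R : realType) (f : nat -> R) n :
  exists r, forall j, (j <= n)%N -> f j <= r.
Proof.
elim: n => [|n [r hr]]; first by exists (f 0) => -[].
exists (Num.max r (f n.+1)) => j; rewrite leq_eqVlt => /predU1P[->|jn].
  by rewrite le_max lexx orbT.
by rewrite le_max hr.
Qed.

Lemma continuous_shift_mx (R : realType) m :
  continuous (fun x : 'cV[R]_m => shift_mx m *m x).
Proof.
apply: continuous_cV => i; have [im|mi] := ltnP i.+1 m.
  have -> : (fun x : 'cV[R]_m => (shift_mx m *m x) i 0) = (fun x => x (Ordinal im) 0).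
    by apply: funext => y; rewrite (@shift_mxE_lt _ _ _ _ (Ordinal im)).
  exact: coord_continuous.
have -> : (fun x : 'cV[R]_m => (shift_mx m *m x) i 0) = fun=> 0.
  by apply: funext => y; rewrite shift_mxE_max.
exact: cst_continuous.
Qed.

Section ObserverField.
Context {R : realType}.
Variable m : nat.
Implicit Types (K : 'cV[R]_m.+1 -> 'cV[R]_m.+1) (q : R -> R) (x : 'cV[R]_m.+2).

Definition obs_arg (l : R) q x : 'cV[R]_m.+1 :=
  \col_j if j == 0 then q (l * x 0 0) else x (lift ord0 j) 0.

(* Only the restriction of this field to the first axis matters for the error
   system; its dependence on the other coordinates keeps the homogeneous
   approximations from vanishing identically. *)
Definition obs_field K (l : R) q x : 'cV[R]_m.+2 :=
  \col_i if unlift ord0 i is Some j then K (obs_arg l q x) j 0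
         else - q (l * x 0 0).

Lemma shift_mx_head x : (shift_mx m.+2 *m x) 0 0 = tail x 0 0.
Proof. by rewrite (@shift_mxE_lt _ _ _ _ (lift ord0 0)) ?mxE. Qed.

Lemma shift_mx_tail x j : (shift_mx m.+2 *m x) (lift ord0 j) 0 =
  (shift_mx m.+1 *m tail x) j 0.
Proof.
have [jm|mj] := ltnP j.+1 m.+1.
  by rewrite (@shift_mxE_lt _ _ _ _ (Ordinal jm))//
    (@shift_mxE_lt _ _ _ _ (lift ord0 (Ordinal jm))) ?mxE.
by rewrite !shift_mxE_max.
Qed.

Lemma obs_field_head K l q x : obs_field K l q x ord0 0 = - q (l * x 0 0).
Proof. by rewrite mxE unlift_none. Qed.

Lemma obs_field_tail K l q x j :
  obs_field K l q x (lift ord0 j) 0 = K (obs_arg l q x) j 0.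
Proof. by rewrite mxE liftK. Qed.

Lemma obs_arg_on_first l q v : obs_arg l q (on_first m.+1 v) = on_first m (q (l * v)).
Proof.
by apply/matrixP => i o; rewrite !mxE; case: ifP => //= _; rewrite eqxx.
Qed.

Lemma error_system_obs K l q x : error_system (obs_field K l q) x =
  \col_i if unlift ord0 i is Some j
         then (shift_mx m.+1 *m tail x + K (on_first m (q (l * x 0 0)))) j 0
         else tail x 0 0 - q (l * x 0 0).
Proof.
apply/matrixP => i o; rewrite (ord1 o) /error_system first_onlyE [LHS]mxE [RHS]mxE.
case: (unliftP ord0 i) => [j|] ->.
  by rewrite obs_field_tail obs_arg_on_first shift_mx_tail [RHS]mxE.
by rewrite obs_field_head shift_mx_head [on_first _ _ _ _]mxE eqxx.
Qed.

End ObserverField.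

Lemma continuous_obs_field (R : realType) m (K : 'cV[R]_m.+1 -> 'cV[R]_m.+1) l q :
  continuous K -> continuous q -> continuous (obs_field K l q).
Proof.
move=> cK cq.
have cqx : continuous (fun x : 'cV[R]_m.+2 => q (l * x 0 0)).
  move=> x; apply: (@continuous_comp _ _ _ (fun x : 'cV[R]_m.+2 => l * x 0 0) q);
    last exact: cq.
  by apply: (@continuous_comp _ _ _ (fun x : 'cV[R]_m.+2 => x 0 0) ( *%R l));
    [exact: coord_continuous|exact: mulrl_continuous].
apply: continuous_cV => i; case: (unliftP ord0 i) => [j|] ->; last first.
  have -> : (fun x => obs_field K l q x ord0 0) = (fun x => - q (l * x 0 0)).
    by apply: funext => x; rewrite obs_field_head.
  by move=> x; apply: (@cvgN _ _ _ (nbhs x)); exact: cqx.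
have -> : (fun x => obs_field K l q x (lift ord0 j) 0) =
    (fun x => K (obs_arg l q x) j 0).
  by apply: funext => x; rewrite obs_field_tail.
suff carg : continuous (@obs_arg R m l q).
  move=> x; apply: (@continuous_comp _ _ _ (fun x => K (obs_arg l q x))
    (fun z : 'cV[R]_m.+1 => z j 0)); last exact: coord_continuous.
  by apply: continuous_comp; [exact: carg|exact: cK].
apply: continuous_cV => j'.
have -> : (fun x : 'cV[R]_m.+2 => obs_arg l q x j' 0) =
    (fun x => if j' == 0 then q (l * x 0 0) else x (lift ord0 j') 0).
  by apply: funext => x; rewrite mxE.
by case: (j' == 0); [exact: cqx|exact: coord_continuous].
Qed.

Lemma continuous_error_system (R : realType) m (K : 'cV[R]_m.+1 -> 'cV[R]_m.+1) :
  continuous K -> continuous (error_system K).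
Proof.
move=> cK; suff cO : continuous (fun x => K (first_only x)).
  by move=> x; apply: (@cvgD _ _ _ (nbhs x)); [exact: continuous_shift_mx|exact: cO].
have -> : (fun x => K (first_only x)) = (fun x => K (on_first m (x 0 0))).
  by apply: funext => x; rewrite first_onlyE.
move=> x; apply: (@continuous_comp _ _ _ (fun x : 'cV[R]_m.+1 => on_first m (x 0 0)) K);
  last exact: cK.
by apply: (@continuous_comp _ _ _ (fun x : 'cV[R]_m.+1 => x 0 0) (on_first m));
  [exact: coord_continuous|exact: continuous_on_first].
Qed.

Section ObserverStability.
Context {R : realType}.
Variables (m : nat) (a b : nat -> R) (d0 doo : R).
Hypotheses (aS : forall j, a j.+1 = a j + d0) (bS : forall j, b j.+1 = b j + doo).
Hypotheses (a_gt0 : forall j, (j <= m.+2)%N -> 0 < a j).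
Hypotheses (b_gt0 : forall j, (j <= m.+2)%N -> 0 < b j).
Variable K : 'cV[R]_m.+1 -> 'cV[R]_m.+1.
Hypotheses (cK : continuous K) (K0 : K 0 = 0).

(** The input has weight index 1; component [j] of [K] is divided by the unit of index [j.+2], since
    its degree is its own weight, of index [j.+1], plus the degree of the field. *)
Definition rescaled_gain (u v : R) : 'cV[R]_m.+1 :=
  \col_j (K (on_first m (expR (pl (a 1) (b 1) u) * v)) j 0 /
          expR (pl (a j.+2) (b j.+2) u)).

Hypothesis hfam : forall U : set_system nat, UltraFilter U ->
  forall u : nat -> R, exists Kst : 'cV[R]_m.+1 -> 'cV[R]_m.+1,
  [/\ continuous Kst, attractive (error_system Kst) &
    forall v e : R, 0 < e -> exists2 d : R, 0 < d &
      \forall k \near U, forall v' : R, `|v' - v| < d ->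
        `|rescaled_gain (u k) v' - Kst (on_first m v)| <= e].

Let q := bipow (a 1 / a 0) (b 1 / b 0).

Let al0 : 0 < a 1 / a 0. Proof. by rewrite divr_gt0// a_gt0. Qed.
Let be0 : 0 < b 1 / b 0. Proof. by rewrite divr_gt0// b_gt0. Qed.

(** The factor [l] on coordinate 0 is the change of variable w = l e_i. *)
Let c (l u : R) (i : 'I_m.+2) : R :=
  (if i == 0 then l else 1) * expR (- pl (a i) (b i) u).

(** Consecutive weights differ by the degree, so the shift, the power and the gain all acquire the
    same factor, which is the change of time. *)
Lemma error_obs_rescaled l u x :
  ext_field l (rescaled_pow (a 0) (b 0) (a 1) (b 1) u) (rescaled_gain u)
    (scale_cV (c l u) x) =
  expR (- pl d0 doo u) *: scale_cV (c l u) (error_system (obs_field K l q) x).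
Proof.
have plS j : pl (a j.+1) (b j.+1) u = pl (a j) (b j) u + pl d0 doo u.
  by rewrite aS bS plD.
have zE : scale_cV (c l u) x 0 0 = l * x 0 0 / expR (pl (a 0) (b 0) u).
  by rewrite mxE /c eqxx expRN; ring.
have qE : rescaled_pow (a 0) (b 0) (a 1) (b 1) u (scale_cV (c l u) x 0 0) =
    q (l * x 0 0) / expR (pl (a 1) (b 1) u).
  by rewrite zE /rescaled_pow mulrCA divff ?gt_eqF ?expR_gt0// mulr1.
have tE j : tail (scale_cV (c l u) x) j 0 = tail x j 0 / expR (pl (a j.+1) (b j.+1) u).
  rewrite !mxE /c (negbTE (_ : lift ord0 j != 0)) ?mul1r; last first.
    by rewrite eq_sym neq_lift.
  by rewrite mulrC expRN lift0.
rewrite error_system_obs; apply/matrixP => i o; rewrite (ord1 o).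
case: (unliftP ord0 i) => [j|] ->; rewrite [LHS]mxE [RHS]mxE [in RHS]mxE [in RHS]mxE
  ?liftK ?unlift_none.
  rewrite /c (negbTE (_ : lift ord0 j != 0)) ?mul1r; last by rewrite eq_sym neq_lift.
  rewrite lift0 mulrA -expRD -opprD (addrC (pl d0 doo u)) -plS [LHS]mxE [in RHS]mxE mulrDr.
  congr (_ + _); last first.
    rewrite qE mxE mulrC expRN; congr (_ * K (on_first m _) j 0).
    by rewrite mulrC divfK// gt_eqF ?expR_gt0.
  have [jm|mj] := ltnP j.+1 m.+1.
    by rewrite !(@shift_mxE_lt _ _ _ _ (Ordinal jm))// tE mulrC expRN.
  by rewrite !shift_mxE_max// mulr0.
have P1 : pl (a 1) (b 1) u = pl (a 0) (b 0) u + pl d0 doo u := plS 0.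
rewrite /c eqxx qE tE /= P1 !expRN expRD invfM; ring.
Qed.

Theorem obs_gas : exists L, forall l, 0 < l -> L <= l ->
  globally_asymptotically_stable (error_system (obs_field K l q)).
Proof.
have [ra ra0 ha] := pos_lower_bound a_gt0; have [rb rb0 hb] := pos_lower_bound b_gt0.
have [sa hsa] := upper_bound a m.+2; have [sb hsb] := upper_bound b m.+2.
pose r := Num.min ra rb; have r0 : 0 < r by rewrite lt_min ra0.
have ra_ i : (i <= m.+2)%N -> r <= a i.
  by move=> im; apply: le_trans (ha _ im); rewrite ge_min lexx.
have rb_ i : (i <= m.+2)%N -> r <= b i.
  by move=> im; apply: le_trans (hb _ im); rewrite ge_min lexx orbT.
pose s := Num.max sa sb.
have sa_ i : (i <= m.+2)%N -> a i <= s.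
  by move=> im; apply: (le_trans (hsa _ im)); rewrite le_max lexx.
have sb_ i : (i <= m.+2)%N -> b i <= s.
  by move=> im; apply: (le_trans (hsb _ im)); rewrite le_max lexx orbT.
have s0 : 0 < s by apply: lt_le_trans (sa_ 0 _) => //; exact: a_gt0.
have io (i : 'I_m.+2) : (i <= m.+2)%N by apply: ltnW; exact: ltn_ord.
(* Lowering [u] by 1 enlarges the rescaled norm by at most [expR s], so radius [rho] becomes at most
   1. *)
pose rho := expR (- s); have rho0 : 0 < rho by exact: expR_gt0.
have [a0 a1] : 0 < a 0 /\ 0 < a 1 by split; exact: a_gt0.
have [b0 b1] : 0 < b 0 /\ 0 < b 1 by split; exact: b_gt0.
pose p := rescaled_pow (a 0) (b 0) (a 1) (b 1).
have cp u : continuous (p u) by exact: continuous_rescaled_pow.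
have mp u : {homo p u : v w / v <= w} by exact: rescaled_pow_mono.
have op u v : p u (- v) = - p u v by exact: rescaled_pow_odd.
have [T [M [L main]]] := uniform_contraction cp mp op
  (rescaled_pow_large a0 b0 a1 b1) (rescaled_pow_bounded a0 b0 a1 b1)
  (rescaled_pow_low a0 b0 a1 b1) hfam rho0.
exists L => l l0 Ll.
have lg i : 0 < (if i == (0 : 'I_m.+2) then l else 1) by case: ifP.
have c_gt0 u i : 0 < c l u i by rewrite /c mulr_gt0 ?expR_gt0.
(* Here [r] and [s] bound all slopes from below and above; [shrink] and [grow] compare the rescaled
   norms at two levels, and [A] and [B] compare level 0 with the original norm. *)
have shrink u h x : 0 <= h ->
    `|scale_cV (c l (u + h)) x| <= expR (- (r * h)) * `|scale_cV (c l u) x|.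
  move=> h0; apply/cV_norm_leP; first by rewrite mulr_ge0// expR_ge0.
  move=> i; rewrite mxE.
  have := cV_norm_le (scale_cV (c l u) x) i; rewrite mxE => le1.
  apply: (@le_trans _ _ (expR (- (r * h)) * `|c l u i * x i 0|)); last first.
    by rewrite ler_pM2l ?expR_gt0.
  rewrite (normrM (c l u i)) (normrM (c l (u + h) i)) mulrA ler_wpM2r//.
  rewrite !(gtr0_norm (c_gt0 _ _)) /c mulrCA ler_pM2l// -expRD ler_expR.
  by have := pl_incr_ge u (ra_ _ (io i)) (rb_ _ (io i)) h0; lra.
have grow u h x : 0 <= h ->
    `|scale_cV (c l u) x| <= expR (s * h) * `|scale_cV (c l (u + h)) x|.
  move=> h0; apply/cV_norm_leP; first by rewrite mulr_ge0// expR_ge0.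
  move=> i; rewrite mxE.
  have := cV_norm_le (scale_cV (c l (u + h)) x) i; rewrite mxE => le1.
  apply: (@le_trans _ _ (expR (s * h) * `|c l (u + h) i * x i 0|)); last first.
    by rewrite ler_pM2l ?expR_gt0.
  rewrite (normrM (c l u i)) (normrM (c l (u + h) i)) mulrA ler_wpM2r//.
  rewrite !(gtr0_norm (c_gt0 _ _)) /c mulrCA ler_pM2l// -expRD ler_expR.
  by have := pl_incr_le u (sa_ _ (io i)) (sb_ _ (io i)) h0; lra.
pose A := 1 + l; pose B := 1 + l^-1.
have A0 : 0 < A by rewrite addr_gt0.
have B0 : 0 < B by rewrite addr_gt0// invr_gt0.
have cA x : `|scale_cV (c l 0) x| <= A * `|x|.
  apply/cV_norm_leP; first by rewrite mulr_ge0// ltW.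
  move=> i; rewrite mxE normrM; apply: ler_pM => //; last exact: cV_norm_le.
  rewrite /c pl0 oppr0 expR0 mulr1 gtr0_norm// /A; case: ifP; lra.
have cB x : `|x| <= B * `|scale_cV (c l 0) x|.
  apply/cV_norm_leP; first by rewrite mulr_ge0// ltW.
  move=> i; apply: (@le_trans _ _ (B * `|scale_cV (c l 0) x i 0|)); last first.
    by rewrite ler_pM2l// cV_norm_le.
  rewrite mxE normrM mulrA; rewrite ler_peMl// /c pl0 oppr0 expR0 mulr1 gtr0_norm//.
  have li : 0 < l^-1 by rewrite invr_gt0.
  by rewrite /B; case: ifP => _; rewrite mulrDl mul1r ?mulVf ?gt_eqF//; lra.
have toA u x : `|scale_cV (c l u) x| <= expR (s * `|u|) * A * `|x|.
  have sA : `|scale_cV (c l u) x| <= expR (s * `|u|) * `|scale_cV (c l 0) x|.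
    have [u0|u0] := leP 0 u.
      rewrite ger0_norm//; have := shrink 0 u x u0; rewrite add0r => h1.
      apply: (le_trans h1); rewrite ler_wpM2r// ler_expR.
      have : 0 <= r * u by rewrite mulr_ge0// ltW.
      have : 0 <= s * u by rewrite mulr_ge0// ltW.
      by lra.
    rewrite ltr0_norm//; have := grow u (- u) x; rewrite subrr oppr_ge0; apply.
    exact: ltW.
  apply: (le_trans sA); rewrite -mulrA ler_pM2l ?expR_gt0//.
have toB u x : `|x| <= B * expR (s * `|u|) * `|scale_cV (c l u) x|.
  apply: (le_trans (cB x)); rewrite -mulrA ler_pM2l//.
  have [u0|u0] := leP 0 u.
    by rewrite ger0_norm//; have := grow 0 u x u0; rewrite add0r.
  rewrite ltr0_norm//; have := shrink u (- u) x; rewrite subrr oppr_ge0 ltW// => /(_ isT) h1.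
  apply: (le_trans h1); rewrite ler_wpM2r// ler_expR.
  have : r * u <= 0 by rewrite pmulr_rle0// ltW.
  have : s * u <= 0 by rewrite pmulr_rle0// ltW.
  by lra.
(* The shift [Num.max 0 (M / r)] is large enough for [shrink] to bring radius [M] down to 1, as
   [expR (r * h) >= 1 + r * h > M]. *)
apply: (@contraction_gas R m.+2 _ (fun u => ext_field l
  (rescaled_pow (a 0) (b 0) (a 1) (b 1) u) (rescaled_gain u)) (c l)
  (fun u => expR (- pl d0 doo u)) T M rho (Num.max 0 (M / r))).
- apply: continuous_error_system; apply: continuous_obs_field => //.
  exact: continuous_bipow.
- rewrite error_system_obs; apply/matrixP => i o; rewrite (ord1 o).
  have q0 : q (l * (0 : 'cV[R]_m.+2) 0 0) = 0 by rewrite mxE mulr0 /q bipow0.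
  have z0 : on_first m (0 : R) = 0 by apply/matrixP => j o'; rewrite !mxE; case: ifP.
  have t0 : tail (0 : 'cV[R]_m.+2) = 0 by apply/matrixP => j o'; rewrite !mxE.
  rewrite mxE q0 t0 z0 K0 mulmx0 addr0 !mxE subr0.
  by case: unlift => // j; rewrite mxE.
- by move=> u; exact: expR_gt0.
- by move=> u y; exact: error_obs_rescaled.
- by rewrite expR_lt1 oppr_lt0.
- by move=> u sigma y sig0 sy y0; apply: main sy y0.
- move=> u x xr; apply: (le_trans (grow (u - 1) 1 x ler01)).
  rewrite mulr1 subrK; apply: (@le_trans _ _ (expR s * rho)).
    by rewrite ler_pM2l ?expR_gt0.
  by rewrite /rho -expRD subrr expR0.
- move=> u x xM; have h0 : 0 <= Num.max 0 (M / r) by rewrite le_max lexx.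
  apply: (le_trans (shrink u _ x h0)).
  have Mh : M <= r * Num.max 0 (M / r) by rewrite mulrC -ler_pdivrMr// le_max lexx orbT.
  rewrite expRN mulrC ler_pdivrMr ?expR_gt0// mul1r; apply: (le_trans xM).
  by have := expR_ge1Dx (r * Num.max 0 (M / r)); lra.
- move=> e e0; exists (- (B / e) / r) => u x uu x1.
  have u0 : 0 <= - u.
    by rewrite oppr_ge0; apply: (le_trans uu); rewrite mulNr oppr_le0 !divr_ge0// ltW.
  have := shrink u (- u) x u0; rewrite subrr mulrN opprK => h1.
  apply: (le_lt_trans (cB x)); rewrite mulrC -ltr_pdivlMr//.
  apply: (le_lt_trans h1); apply: (@le_lt_trans _ _ (expR (r * u))).
    by rewrite ler_piMr// expR_ge0.
  apply: (@le_lt_trans _ _ (expR (- (B / e)))).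
    by rewrite ler_expR mulrC -ler_pdivlMr.
  rewrite expRN -[ltRHS]invrK invf_div ltf_pV2 ?posrE ?expR_gt0 ?divr_gt0//.
  by have := expR_ge1Dx (B / e); lra.
- move=> u; have E0 : 0 < expR (s * `|u|) * A by rewrite mulr_gt0// expR_gt0.
  exists (expR (s * `|u|) * A)^-1; first by rewrite invr_gt0.
  move=> x xd; apply: (le_trans (toA u x)).
  by rewrite mulrC -ler_pdivlMr// mul1r ltW.
- move=> x; pose u := A * `|x| / r.
  have u0 : 0 <= u by rewrite divr_ge0 ?mulr_ge0// ltW.
  exists u; have := shrink 0 u x u0; rewrite add0r => h1; apply: (le_trans h1).
  rewrite expRN mulrC ler_pdivrMr ?expR_gt0// mul1r; apply: (le_trans (cA x)).
  have -> : A * `|x| = r * u by rewrite /u (mulrC r) divfK// gt_eqF.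
  by have := expR_ge1Dx (r * u); lra.
- move=> u; exists (B * expR (s * `|u|)) => x x1.
  apply: (le_trans (toB u x)); rewrite ler_piMr// mulr_ge0 ?expR_ge0//; exact: ltW.
Qed.

End ObserverStability.

(** * Homogeneous approximations *)

Section UniformLimits.
Context {R : realType} {N : nat}.
Implicit Types (phi : 'cV[R]_N -> R) (r : 'I_N -> R) (x z : 'cV[R]_N).

Lemma dilationM r (s t : R) x : 0 <= s -> 0 <= t ->
  dilation r (s * t) x = dilation r s (dilation r t x).
Proof. by move=> s0 t0; apply/matrixP => i j; rewrite !mxE powRM// mulrA. Qed.

Lemma dilation0 r (s : R) : dilation r s 0 = 0.
Proof. by apply/matrixP => i j; rewrite !mxE mulr0. Qed.

(** Polar coordinates for the dilation: [s] is the homogeneous norm of [x], the maximum of the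
    numbers [|x j 0|] to the power [1 / r j], attained at [i]. *)
Lemma dilation_polar r x : (forall j, 0 < r j) -> x != 0 ->
  exists s z i, [/\ 0 < s, `|z| = 1, x = dilation r s z & `|x i 0| = s `^ r i].
Proof.
move=> r0 x0; have [i0 xi0] : exists i, x i 0 != 0.
  apply: contrapT => nx; case/eqP: x0; apply/matrixP => i j; rewrite (ord1 j) mxE.
  by apply/eqP; apply: contrapT => xi; apply: nx; exists i; apply/negP.
pose f i := `|x i 0| `^ (r i)^-1.
have [i _ imax] := @arg_maxP _ R 'I_N i0 xpredT f isT.
have fi0 : 0 < f i.
  by apply: (lt_le_trans _ (imax i0 isT)); rewrite powR_gt0// normr_gt0.
have fK j : f j `^ r j = `|x j 0| by rewrite -powRrM mulVf ?gt_eqF// powRr1.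
have fp j : 0 < f i `^ r j by exact: powR_gt0.
pose z : 'cV[R]_N := \col_j (x j 0 / f i `^ r j).
have zE j : `|z j 0| = `|x j 0| / f i `^ r j.
  by rewrite mxE normrM normfV (ger0_norm (powR_ge0 _ _)).
exists (f i), z, i; split => //.
  apply/eqP; rewrite eq_le; apply/andP; split.
    apply/cV_norm_leP => // j; rewrite zE ler_pdivrMr// mul1r -(fK j).
    apply: ge0_ler_powR; rewrite ?nnegrE ?powR_ge0//; first exact: ltW.
    exact: imax.
  by have := cV_norm_le z i; rewrite zE -(fK i) divff// gt_eqF// powR_gt0.
by apply/matrixP => j o; rewrite (ord1 o) !mxE mulrC divfK// gt_eqF//.
Qed.

Lemma dilation_polar_small r (e : R) : (forall j, 0 < r j) -> 0 < e ->
  exists2 d, 0 < d & forall x, x != 0 -> `|x| < d ->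
    exists s z, [/\ 0 < s, s <= e, `|z| = 1 & x = dilation r s z].
Proof.
move=> r0 e0; pose d := \big[Num.min/1]_j (e `^ r j).
exists d; first by apply: lt_bigmin => // i _; exact: powR_gt0.
move=> x x0 xd; have [s [z [i [s0 z1 xE xi]]]] := dilation_polar r0 x0.
exists s, z; split => //; rewrite leNgt; apply/negP => es.
have : e `^ r i < s `^ r i.
  by apply: gt0_ltr_powR; rewrite ?nnegrE ?(ltW e0) ?(ltW s0).
rewrite ltNge -xi; apply/negP; rewrite negbK.
apply: (le_trans (cV_norm_le _ _)); apply: (le_trans (ltW xd)).
exact: bigmin_le.
Qed.

Lemma annulus_compact (a B : R) : compact [set x : 'cV[R]_N | a <= `|x| <= B].
Proof.
have -> : [set x : 'cV[R]_N | a <= `|x| <= B] =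
    [set x | `|x| <= B] `&` (fun x => `|x|) @^-1` `[a, +oo[%classic.
  by apply/seteqP; split => x /=; rewrite in_itv /= andbT; [move=> /andP[]|move=> [-> ->]].
apply: compact_closedI; first exact: closed_ball_compact_cV.
apply: closed_comp; last exact: interval_closed.
by move=> x _; exact: norm_continuous.
Qed.

(** In contrast with the definition of homogeneity in a limit, uniformity holds on whole balls, the
    origin included; this matters because the injected value [q (w)] may come arbitrarily close to
    0. *)
Definition unif_lim (G : set_system R) phi r (d : R) phi0 :=
  forall B e : R, 0 < e -> \forall s \near G,
    0 < s /\ forall x, `|x| <= B -> `|phi (dilation r s x) / s `^ d - phi0 x| <= e.

(** Away from the origin an annulus suffices. Near it, [x] is the dilation by a small [m] of a unit
    vector [z], and the hypothesis at scale [s * m] bounds the quotient by [(C + 1) * m ^ d], small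
    because [d > 0]. *)
Lemma homogeneous_0limit_unif phi r d phi0 : homogeneous_0limit phi r d phi0 ->
  0 < d -> phi 0 = 0 -> phi0 0 = 0 -> unif_lim 0^'+ phi r d phi0.
Proof.
move=> [r0 _ cphi [cphi0 _] lim] d0 p0 p00 B e e0.
have [C C0 HC] := continuous_bounded 1 cphi0.
have S0 : ~ [set x : 'cV[R]_N | 1 <= `|x| <= 1] 0 by rewrite /= normr0 ler10.
have [l1 l10 hl1] := lim _ (@annulus_compact 1 1) S0 1 ltr01.
have e2 : 0 < e / 2 by lra.
pose e' := Num.min 1 ((e / 2 / (C + 1)) `^ d^-1).
have C1 : 0 < C + 1 by lra.
have e'0 : 0 < e' by rewrite lt_min ltr01 powR_gt0// divr_gt0.
have [d1 d10 hd1] := dilation_polar_small r0 e'0.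
have /cvgrPdist_le/(_ _ e2)/nbhs_ballP[d2 /= d20 hd2] := @cphi0 0.
pose eta := Num.min d1 d2; have eta0 : 0 < eta by rewrite lt_min d10.
have A0 : ~ [set x : 'cV[R]_N | eta <= `|x| <= B] 0.
  by rewrite /= normr0 leNgt eta0.
have [l2 l20 hl2] := lim _ (@annulus_compact eta B) A0 e e0.
near=> s.
have s0 : 0 < s by near: s; exact: nbhs_right_gt.
have sl1 : s <= l1 by near: s; exact: nbhs_right_le.
have sl2 : s <= l2 by near: s; exact: nbhs_right_le.
split => // x xB; have [xeta|xeta] := leP eta `|x|.
  by apply: hl2; rewrite ?s0//= xeta.
have [->|x0] := eqVneq x 0.
  by rewrite dilation0 p0 p00 mul0r subrr normr0 ltW.
move: xeta; rewrite lt_min => /andP[xd1 xd2].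
have [m [z [m0 me' z1 xE]]] := hd1 x x0 xd1.
have x2 : `|phi0 x| <= e / 2.
  have := hd2 x; rewrite -ball_normE /= sub0r normrN p00 sub0r normrN.
  exact.
have z11 : [set x : 'cV[R]_N | 1 <= `|x| <= 1] z by rewrite /= z1 lexx.
have sm0 : 0 < s * m by rewrite mulr_gt0.
have m1 : m <= 1 by apply: le_trans me' _; rewrite ge_min lexx.
have sml1 : s * m <= l1 by apply: le_trans sl1; rewrite ler_piMr// ltW.
have := hl1 (s * m); rewrite sm0 sml1 => /(_ isT z z11) h1.
have h2 : `|phi (dilation r (s * m) z)| <= (C + 1) * (s * m) `^ d.
  have := ler_normD (phi (dilation r (s * m) z) / (s * m) `^ d - phi0 z) (phi0 z).
  rewrite subrK normrM normfV (ger0_norm (powR_ge0 _ _)).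
  have := HC z; rewrite z1 => /(_ (lexx _)) h3 h4.
  by rewrite -ler_pdivrMr ?powR_gt0//; lra.
apply: (le_trans (ler_normB _ _)).
suff : `|phi (dilation r s x) / s `^ d| <= e / 2 by lra.
rewrite xE -dilationM ?(ltW s0) ?(ltW m0)// normrM normfV (ger0_norm (powR_ge0 s _)).
rewrite ler_pdivrMr ?powR_gt0//; apply: (le_trans h2).
rewrite powRM ?(ltW s0) ?(ltW m0)// (mulrC (s `^ d)) mulrA.
apply: ler_wpM2r; first exact: powR_ge0.
have h5 : m `^ d <= e / 2 / (C + 1).
  have -> : e / 2 / (C + 1) = ((e / 2 / (C + 1)) `^ d^-1) `^ d.
    by rewrite -powRrM mulVf ?gt_eqF// powRr1// ltW// divr_gt0.
  apply: ge0_ler_powR; rewrite ?nnegrE ?powR_ge0 ?(ltW m0) ?(ltW d0)//.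
  by apply: (le_trans me'); rewrite ge_min lexx orbT.
by rewrite mulrC -ler_pdivlMr.
Unshelve. all: by end_near. Qed.

(** As for the 0-limit, except that [s * m] may be too small for the hypothesis; then [phi] is
    bounded by a constant [C2], and [C2] over [s ^ d] is small. *)
Lemma homogeneous_oolimit_unif phi r d phi0 : homogeneous_oolimit phi r d phi0 ->
  0 < d -> phi 0 = 0 -> phi0 0 = 0 -> unif_lim (pinfty_nbhs R) phi r d phi0.
Proof.
move=> [r0 _ cphi [cphi0 _] lim] d0 p0 p00 B e e0.
have [C C0 HC] := continuous_bounded 1 cphi0.
have S0 : ~ [set x : 'cV[R]_N | 1 <= `|x| <= 1] 0 by rewrite /= normr0 ler10.
have [l1 l10 hl1] := lim _ (@annulus_compact 1 1) S0 1 ltr01.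
pose B1 := \big[Num.max/0]_j (l1 `^ r j).
have [C2 C20 HC2] := continuous_bounded B1 cphi.
have e2 : 0 < e / 2 by lra.
have e4 : 0 < e / 4 by lra.
have C1 : 0 < C + 1 by lra.
pose e' := (e / 4 / (C + 1)) `^ d^-1.
have e'0 : 0 < e' by rewrite powR_gt0// divr_gt0.
have [d1 d10 hd1] := dilation_polar_small r0 e'0.
have /cvgrPdist_le/(_ _ e2)/nbhs_ballP[d2 /= d20 hd2] := @cphi0 0.
pose eta := Num.min d1 d2; have eta0 : 0 < eta by rewrite lt_min d10.
have A0 : ~ [set x : 'cV[R]_N | eta <= `|x| <= B] 0.
  by rewrite /= normr0 leNgt eta0.
have [l2 l20 hl2] := lim _ (@annulus_compact eta B) A0 e e0.
near=> s.
have s0 : 0 < s by near: s; apply: nbhs_pinfty_gt; exact: num_real.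
have sl2 : l2 <= s by near: s; apply: nbhs_pinfty_ge; exact: num_real.
have sC : (C2 / (e / 4)) `^ d^-1 <= s.
  by near: s; apply: nbhs_pinfty_ge; exact: num_real.
split => // x xB; have [xeta|xeta] := leP eta `|x|.
  by apply: hl2; rewrite ?s0//= xeta.
have [->|x0] := eqVneq x 0.
  by rewrite dilation0 p0 p00 mul0r subrr normr0 ltW.
move: xeta; rewrite lt_min => /andP[xd1 xd2].
have [m [z [m0 me' z1 xE]]] := hd1 x x0 xd1.
have x2 : `|phi0 x| <= e / 2.
  have := hd2 x; rewrite -ball_normE /= sub0r normrN p00 sub0r normrN.
  exact.
have z11 : [set x : 'cV[R]_N | 1 <= `|x| <= 1] z by rewrite /= z1 lexx.
have sm0 : 0 < s * m by rewrite mulr_gt0.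
have h2 : `|phi (dilation r (s * m) z)| <= (C + 1) * (s * m) `^ d + C2.
  have [sml1|sml1] := leP l1 (s * m).
    have h1 := hl1 _ sml1 z z11; rewrite -[leLHS]addr0 lerD// ?(ltW C20)//.
    have := ler_normD (phi (dilation r (s * m) z) / (s * m) `^ d - phi0 z) (phi0 z).
    rewrite subrK normrM normfV (ger0_norm (powR_ge0 _ _)).
    have := HC z; rewrite z1 => /(_ (lexx _)) h3 h4.
    by rewrite -ler_pdivrMr ?powR_gt0//; lra.
  rewrite -[leLHS]add0r lerD ?mulr_ge0 ?powR_ge0 ?(ltW C1)//; apply: HC2.
  apply/cV_norm_leP; first exact: bigmax_ge_id.
  move=> i; rewrite mxE normrM ger0_norm ?powR_ge0//.
  apply: (@le_trans _ _ (l1 `^ r i)); last exact: le_bigmax.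
  rewrite -[leRHS]mulr1; apply: ler_pM; rewrite ?powR_ge0//.
    by apply: ge0_ler_powR; rewrite ?nnegrE ?(ltW sm0) ?(ltW l10) ?(ltW sml1)// ltW.
  by rewrite -z1 cV_norm_le.
apply: (le_trans (ler_normB _ _)).
suff : `|phi (dilation r s x) / s `^ d| <= e / 2 by lra.
rewrite xE -dilationM ?(ltW s0) ?(ltW m0)// normrM normfV (ger0_norm (powR_ge0 s _)).
rewrite ler_pdivrMr ?powR_gt0//; apply: (le_trans h2).
have -> : e / 2 * s `^ d = e / 4 * s `^ d + e / 4 * s `^ d by lra.
apply: lerD.
  rewrite powRM ?(ltW s0) ?(ltW m0)// (mulrC (s `^ d)) mulrA.
  apply: ler_wpM2r; first exact: powR_ge0.
  have h5 : m `^ d <= e / 4 / (C + 1).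
    have -> : e / 4 / (C + 1) = e' `^ d.
      by rewrite -powRrM mulVf ?gt_eqF// powRr1// ltW// divr_gt0.
    by apply: ge0_ler_powR; rewrite ?nnegrE ?powR_ge0 ?(ltW m0) ?(ltW d0).
  by rewrite mulrC -ler_pdivlMr.
have h6 : C2 / (e / 4) <= s `^ d.
  have -> : C2 / (e / 4) = ((C2 / (e / 4)) `^ d^-1) `^ d.
    by rewrite -powRrM mulVf ?gt_eqF// powRr1// ltW// divr_gt0.
  by apply: ge0_ler_powR; rewrite ?nnegrE ?powR_ge0 ?(ltW s0) ?(ltW d0).
by rewrite mulrC -ler_pdivrMr.
Unshelve. all: by end_near. Qed.

Lemma unif_homogeneous_0limit phi r d phi0 : (forall j, 0 < r j) -> 0 <= d ->
  continuous phi -> continuous phi0 -> (exists x, phi0 x != 0) ->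
  unif_lim 0^'+ phi r d phi0 -> homogeneous_0limit phi r d phi0.
Proof.
move=> r0 d0 cphi cphi0 nz lim; split => // A cA _ e e0.
have [B [_ hB]] := compact_bounded cA.
have := lim (B + 1) e e0; rewrite near_withinE => /nbhs_ballP[s /= s0 hs].
exists (s / 2); first by lra.
move=> l /andP[l0 ls] x Ax.
have [|_ h] := hs l _ l0.
  by rewrite /ball /= sub0r normrN gtr0_norm//; lra.
by apply: h; apply: hB => //; lra.
Qed.

Lemma unif_homogeneous_oolimit phi r d phi0 : (forall j, 0 < r j) -> 0 <= d ->
  continuous phi -> continuous phi0 -> (exists x, phi0 x != 0) ->
  unif_lim (pinfty_nbhs R) phi r d phi0 -> homogeneous_oolimit phi r d phi0.
Proof.
move=> r0 d0 cphi cphi0 nz lim; split => // A cA _ e e0.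
have [B [_ hB]] := compact_bounded cA.
have [s [_ hs]] := lim (B + 1) e e0.
exists (Num.max 1 (s + 1)); first by rewrite lt_max ltr01.
move=> l; rewrite ge_max => /andP[l1 ls] x Ax.
have [|_ h] := hs l; first by lra.
by apply: h; apply: hB => //; lra.
Qed.

(** Approximating functions are exactly homogeneous: the same value of [phi], normalised at scales
    [s] and [s * m], is close to both sides. *)
Lemma unif_lim_exact (G : set_system R) (GG : ProperFilter G) phi r d phi0 :
  (forall m : R, 0 < m -> s * m @[s --> G] --> G) -> unif_lim G phi r d phi0 ->
  forall m x, 0 < m -> phi0 (dilation r m x) = m `^ d * phi0 x.
Proof.
move=> GM lim m x m0.
suff H (e : R) : 0 < e ->
    `|phi0 (dilation r m x) - m `^ d * phi0 x| <= e + m `^ d * e.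
  apply/eqP; rewrite -subr_eq0 -normr_le0; apply/ler_addgt0Pr => e e0.
  have md : 0 < 1 + m `^ d by rewrite ltr_pwDl// powR_ge0.
  have := H (e / (1 + m `^ d)) (divr_gt0 e0 md).
  rewrite add0r => /le_trans; apply.
  by rewrite le_eqVlt; apply/orP; left; apply/eqP; field; rewrite gt_eqF.
move=> e0; pose B := Num.max `|x| `|dilation r m x|.
have l1 := lim B e e0; have l2 := GM m m0 _ l1.
have [s [[s0 h1] [sm0 h2]]] := filter_ex (filterI l1 l2).
have {}h1 := h1 (dilation r m x); rewrite /B le_max lexx orbT in h1.
have {}h2 := h2 x; rewrite /B le_max lexx /= in h2.
have {}h1 := h1 isT; have {}h2 := h2 isT.
rewrite dilationM ?(ltW s0) ?(ltW m0)// in h2.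
have E : phi (dilation r s (dilation r m x)) / s `^ d =
    m `^ d * (phi (dilation r s (dilation r m x)) / (s * m) `^ d).
  rewrite powRM ?(ltW s0) ?(ltW m0)//; field.
  by rewrite !gt_eqF ?powR_gt0.
rewrite E in h1; rewrite distrC in h1.
set A := phi _ / (s * m) `^ d in h1 h2.
have -> : phi0 (dilation r m x) - m `^ d * phi0 x =
  (phi0 (dilation r m x) - m `^ d * A) + m `^ d * (A - phi0 x) by ring.
apply: (le_trans (ler_normD _ _)); rewrite lerD// normrM ger0_norm ?powR_ge0//.
by rewrite ler_wpM2l ?powR_ge0.
Qed.

End UniformLimits.

Lemma unif_continuous_ball (R : realType) N (f : 'cV[R]_N -> R) (B e : R) :
  continuous f -> 0 < e -> exists2 d, 0 < d &
    forall x y, `|x| <= B -> `|x - y| < d -> `|f x - f y| <= e.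
Proof.
move=> cf e0.
have : \forall d \near (0 : R)^'+, forall x, `|x| <= B ->
    forall y, `|x - y| < d -> `|f x - f y| <= e.
  move/compact_near_coveringP : (@closed_ball_compact_cV R N B).
  apply => x _; have e2 : 0 < e / 2 by lra.
  have /cvgrPdist_le/(_ _ e2)/nbhs_ballP[d /= d0 hd] := @cf x.
  exists ([set y | `|x - y| < d / 2], [set d' | d' < d / 2]) => /=.
    split; last by apply: nbhs_right_lt; lra.
    by apply/nbhs_ballP; exists (d / 2); [rewrite /=; lra|move=> y; rewrite -ball_normE].
  move=> [y d'] [/= xy d'd] z yz.
  have h1 : `|f x - f y| <= e / 2 by apply: hd; rewrite -ball_normE /=; lra.
  have h2 : `|f x - f z| <= e / 2.
    apply: hd; rewrite -ball_normE /=.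
    by have := ler_normD (x - y) (y - z); rewrite subrKA; lra.
  rewrite distrC in h1.
  by have := ler_normD (f y - f x) (f x - f z); rewrite subrKA; lra.
rewrite near_withinE => /nbhs_ballP[d /= d0 hd]; exists (d / 2); first by lra.
move=> x y xB xy; apply: (hd (d / 2) _ _ x xB y xy); last by lra.
by rewrite /ball /= sub0r normrN gtr0_norm; lra.
Qed.

(** * Pure powers as the two limits of the power with two exponents *)

Section HomogeneousPower.
Context {R : realType}.

Lemma bipow_diag (al w : R) : 0 < al -> 0 <= w -> bipow al al w = w `^ al.
Proof.
move=> al0 w0; rewrite bipow_pos//.
by have [w1|w1] := leP w 1; [rewrite bipow_half_le1|rewrite bipow_half_ge1// ltW].
Qed.

Lemma bipow_surj (al z : R) : 0 < al -> exists w, bipow al al w = z.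
Proof.
move=> al0.
have pos y : 0 <= y -> exists w, bipow al al w = y.
  move=> y0; exists (y `^ al^-1); rewrite bipow_diag ?powR_ge0//.
  by rewrite -powRrM mulVf ?gt_eqF// powRr1.
have [z0|z0] := leP 0 z; first exact: pos.
have [|w wz] := pos (- z); first by rewrite oppr_ge0 ltW.
by exists (- w); rewrite bipow_odd wz opprK.
Qed.

Definition scalar_lim (G : set_system R) (q : R -> R) (a0 a1 : R) (q0 : R -> R) :=
  forall B e : R, 0 < e -> \forall s \near G,
    0 < s /\ forall w, `|w| <= B -> `|q (s `^ a0 * w) / s `^ a1 - q0 w| <= e.

Variables a0 b0 a1 b1 : R.
Hypotheses (a00 : 0 < a0) (b00 : 0 < b0) (a10 : 0 < a1) (b10 : 0 < b1).

Let al0 : 0 < a1 / a0. Proof. exact: divr_gt0. Qed.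
Let be0 : 0 < b1 / b0. Proof. exact: divr_gt0. Qed.

Lemma odd_lim (al be s c0 c1 q0 : R) e B : 
  (forall w, 0 <= w -> w <= B ->
    `|bipow al be (s `^ c0 * w) / s `^ c1 - bipow q0 q0 w| <= e) ->
  forall w, `|w| <= B ->
    `|bipow al be (s `^ c0 * w) / s `^ c1 - bipow q0 q0 w| <= e.
Proof.
move=> H w; have [w0|w0] := leP 0 w; first by rewrite ger0_norm//; exact: H.
rewrite ltr0_norm// => wB; have := H (- w); rewrite oppr_ge0 ltW// => /(_ isT wB).
by rewrite mulrN !bipow_odd mulNr -opprD normrN.
Qed.

(** The difference is exactly zero for small [s], since the argument then stays in the range of the
    first exponent. *)
Lemma bipow_lim0 : scalar_lim 0^'+ (bipow (a1 / a0) (b1 / b0)) a0 a1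
  (bipow (a1 / a0) (a1 / a0)).
Proof.
move=> B e e0; pose B' := Num.max 1 B.
have B'0 : 0 < B' by rewrite lt_max ltr01.
near=> s.
have s0 : 0 < s by near: s; exact: nbhs_right_gt.
have sB : s <= B'^-1 `^ a0^-1.
  by near: s; apply: nbhs_right_le; rewrite powR_gt0// invr_gt0.
split => //; apply: odd_lim => w w0 wB.
have sa0 : s `^ a0 <= B'^-1.
  have -> : B'^-1 = (B'^-1 `^ a0^-1) `^ a0.
    by rewrite -powRrM mulVf ?gt_eqF// powRr1// invr_ge0 ltW.
  by apply: ge0_ler_powR; rewrite ?nnegrE ?powR_ge0 ?(ltW s0) ?(ltW a00).
have sw1 : s `^ a0 * w <= 1.
  apply: (@le_trans _ _ (B'^-1 * B')); last by rewrite mulVf// gt_eqF.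
  by apply: ler_pM; rewrite ?powR_ge0// (le_trans wB)// le_max lexx orbT.
have sw0 : 0 <= s `^ a0 * w by rewrite mulr_ge0 ?powR_ge0.
rewrite bipow_diag// bipow_pos// bipow_half_le1// powRM ?powR_ge0//.
rewrite -powRrM mulrCA divff ?gt_eqF// mulr1 mulrAC divff ?mul1r; last first.
  by rewrite gt_eqF ?powR_gt0.
by rewrite subrr normr0 ltW.
Unshelve. all: by end_near. Qed.

(** The two powers agree where [s ^ b0 * w >= 1]. Elsewhere both lie in [0, 1] before division by
    [s ^ b1], which makes the difference small. *)
Lemma bipow_limoo : scalar_lim (pinfty_nbhs R) (bipow (a1 / a0) (b1 / b0)) b0 b1
  (bipow (b1 / b0) (b1 / b0)).
Proof.
move=> B e e0; near=> s.
have s0 : 0 < s by near: s; apply: nbhs_pinfty_gt; exact: num_real.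
have sB : e^-1 `^ b1^-1 <= s.
  by near: s; apply: nbhs_pinfty_ge; exact: num_real.
split => //; apply: odd_lim => w w0 wB.
have p0 : 0 < s `^ b0 by exact: powR_gt0.
have p1 : 0 < s `^ b1 by exact: powR_gt0.
have sw0 : 0 <= s `^ b0 * w by rewrite mulr_ge0 ?powR_ge0.
have wE : w `^ (b1 / b0) = (s `^ b0 * w) `^ (b1 / b0) / s `^ b1.
  rewrite powRM ?powR_ge0// -powRrM mulrCA divff ?gt_eqF// mulr1.
  by rewrite mulrAC divff ?mul1r// gt_eqF.
rewrite bipow_diag// wE -mulrBl.
have [sw1|sw1] := leP 1 (s `^ b0 * w).
  by rewrite bipow_pos// bipow_half_ge1// subrr mul0r normr0 ltW.
have e1 : (s `^ b1)^-1 <= e.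
  rewrite -[leRHS]invrK lef_pV2 ?posrE ?invr_gt0//.
  have -> : e^-1 = (e^-1 `^ b1^-1) `^ b1.
    by rewrite -powRrM mulVf ?gt_eqF// powRr1// invr_ge0 ltW.
  by apply: ge0_ler_powR; rewrite ?nnegrE ?powR_ge0 ?(ltW s0) ?(ltW b10).
rewrite normrM normfV (gtr0_norm p1) -[leRHS]mul1r; apply: ler_pM => //.
  by rewrite invr_ge0 ltW.
have le1 c : 0 < c -> 0 <= (s `^ b0 * w) `^ c <= 1.
  move=> c0; rewrite powR_ge0 /=.
  apply: (@le_trans _ _ (1 `^ c)); last by rewrite powR1.
  by apply: ge0_ler_powR; rewrite ?nnegrE ?ler01 ?(ltW c0) ?(ltW sw1).
rewrite bipow_pos// bipow_half_le1// ?(ltW sw1)//.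
have /andP[? ?] := le1 _ al0; have /andP[? ?] := le1 _ be0.
by rewrite ler_norml; apply/andP; split; lra.
Unshelve. all: by end_near. Qed.

End HomogeneousPower.

Section ObserverHomogeneity.
Context {R : realType}.
Variables (m : nat) (G : set_system R) (l : R) (a : nat -> R) (q q0 : R -> R).
Variables (K K0 : 'cV[R]_m.+1 -> 'cV[R]_m.+1).
Hypotheses (GG : Filter G) (l0 : 0 < l).
Hypothesis qlim : scalar_lim G q (a 0) (a 1) q0.
Hypotheses (q0mono : {homo q0 : u v / u <= v}) (q0odd : forall u, q0 (- u) = - q0 u).
Hypothesis cK0 : forall j, continuous (fun x => K0 x j 0).
Hypothesis Klim : forall j : 'I_m.+1, unif_lim G (fun x => K x j 0)
  (fun i : 'I_m.+1 => a i.+1) (a j.+2) (fun x => K0 x j 0).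

(** For a tail component, the rescaled argument [g] of [K] is uniformly close to [obs_arg l q0 x]
    and stays in a fixed ball, so uniform convergence of [K] there combines with uniform continuity
    of [K0]. *)
Lemma obs_field_unif (i : 'I_m.+2) : unif_lim G (fun x => obs_field K l q x i 0)
  (fun i : 'I_m.+2 => a i) (a i.+1) (fun x => obs_field K0 l q0 x i 0).
Proof.
move=> B e e0.
have headB x : `|x| <= B -> `|l * (x : 'cV[R]_m.+2) 0 0| <= l * B.
  move=> xB; rewrite normrM gtr0_norm// ler_pM2l//.
  exact: le_trans (cV_norm_le _ _) xB.
have headE s x : l * dilation (fun i : 'I_m.+2 => a i) s x 0 0 = s `^ a 0 * (l * x 0 0).
  by rewrite mxE; ring.
case: (unliftP ord0 i) => [j|] ->; last first.
  apply: filterS (qlim (l * B) e0) => s [s0 hs]; split => // x xB.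
  rewrite !obs_field_head headE mulNr -opprD normrN.
  exact/hs/headB.
pose B' := Num.max B `|q0 (l * B)|.
have e2 : 0 < e / 2 by lra.
have [d d0 hd] := unif_continuous_ball (B' + 1) (@cK0 j) e2.
pose eps := Num.min 1 (d / 2).
have eps0 : 0 < eps by rewrite lt_min; apply/andP; split; lra.
apply: filterS (filterI (qlim (l * B) eps0) (Klim j (B' + 1) e2)).
move=> s [[s0 hq] [_ hK]]; split => // x xB.
pose g : 'cV[R]_m.+1 := \col_j' if j' == 0 then q (s `^ a 0 * (l * x 0 0)) / s `^ a 1
                 else x (lift ord0 j') 0.
have argE : obs_arg l q (dilation (fun i : 'I_m.+2 => a i) s x) =
    dilation (fun i : 'I_m.+1 => a i.+1) s g.
  apply/matrixP => j' o; rewrite mxE headE [RHS]mxE [in RHS]mxE.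
  case: ifP => [/eqP ->|_]; last by rewrite mxE lift0.
  by rewrite [RHS]mulrC divfK// gt_eqF ?powR_gt0.
have gB : `|obs_arg l q0 x - g| <= eps.
  apply/cV_norm_leP; first exact: ltW.
  move=> j'; rewrite !mxE; case: ifP => _; last by rewrite subrr normr0 ltW.
  by rewrite distrC; apply/hq/headB.
have oB : `|obs_arg l q0 x| <= B'.
  have B'0 : 0 <= B' by rewrite le_max (le_trans _ xB).
  apply/cV_norm_leP => // j'; rewrite mxE le_max; case: ifP => _; last first.
    by rewrite (le_trans (cV_norm_le _ _) xB).
  apply/orP; right; have := odd_mono_norm_le q0mono q0odd (headB x xB) => h1.
  exact: le_trans h1 (ler_norm _).
have eps1 : eps <= 1 by rewrite ge_min lexx.
have epsd : eps <= d / 2 by rewrite ge_min lexx orbT.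
have gB' : `|g| <= B' + 1.
  have := ler_normB (obs_arg l q0 x) (obs_arg l q0 x - g).
  by rewrite opprB addrC subrK; lra.
have h1 := hK g gB'.
have h2 : `|K0 (obs_arg l q0 x) j 0 - K0 g j 0| <= e / 2.
  by apply: hd; lra.
rewrite !obs_field_tail argE lift0.
set A := _ / _ in h1 *.
have := ler_normD (A - K0 g j 0) (K0 g j 0 - K0 (obs_arg l q0 x) j 0).
by rewrite subrKA (distrC (K0 g j 0)); lra.
Qed.

End ObserverHomogeneity.

(** * Attractivity and its invariance under rescaling *)

Section Attractivity.
Context {R : realType} {N : nat}.
Implicit Types (F G : 'cV[R]_N -> 'cV[R]_N).

(** A solution that is global or unbounded is maximal: an extension past a finite [T] would be
    continuous, hence bounded, on [[0, T]]. *)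
Lemma gas_attractive F : globally_asymptotically_stable F -> attractive F.
Proof.
move=> [_ _ att] T x sx Tend e e0.
have mx : is_maximal_solution F T x.
  split => // T' y sy TT' yx; case: Tend => [Too|unb].
    by apply/eqP; rewrite eq_le TT' andbT Too leey.
  apply/eqP; rewrite eq_le TT' andbT leNgt; apply/negP => TltT'.
  have [t0 [t00 t0T _]] := unb 0.
  case: T sx unb yx TT' TltT' t0T => [T| |] sx unb yx TT' TltT' t0T.
  - have [cy _] := is_solution_solves sy TltT'.
    have [B [_ hB]] := compact_bounded (continuous_compact cy (@segment_compact _ 0 T)).
    have [t [t0' tT]] := unb (B + 1); rewrite -yx// ltNge => /negP; apply.
    apply: hB; first by rewrite ltrDl.
    exists t => //; rewrite /= in_itv /= t0' /=.
    by apply: ltW; rewrite -lte_fin.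
  - by rewrite ltNge leey in TltT'.
  - by rewrite ltNge leNye in t0T.
have [Too xlim] := att T x mx.
have /cvgrPdist_lt/(_ _ e0)[M [_ hM]] := xlim.
pose t := Num.max 1 (M + 1).
have Mt : M < t by rewrite lt_max ltrDl ltr01 orbT.
exists t; split; first by rewrite lt_max ltr01.
  by rewrite Too ltry.
by have := hM t Mt; rewrite sub0r normrN.
Qed.

Lemma solves_is_solution F T x : (0 < T)%E ->
  (forall b : R, (b%:E < T)%E -> solves F b x) -> is_solution F T x.
Proof.
move=> T0 sx.
have ext (t : R) : (t%:E < T)%E -> exists2 b, t < b & (b%:E < T)%E.
  case: (T) => [T'| |] //.
    rewrite lte_fin => tT; exists ((t + T') / 2); first by lra.
    by rewrite lte_fin; lra.
  by move=> _; exists (t + 1); [rewrite ltrDl|rewrite ltry].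
split => //.
  apply/subspace_continuousP => t /= [t0 tT]; have [b tb bT] := ext t tT.
  have [/within_itvccP cx _] := sx b bT.
  apply/cvgrPdist_lt => e e0; rewrite near_withinE.
  have [|d d0 hd] := cx t _ e e0; first by rewrite t0 ltW.
  near=> s => /= -[s0 sT].
  have sb : s < b by near: s; exact: lt_nbhsl.
  rewrite distrC; apply: hd; first by rewrite s0 ltW.
  by rewrite distrC; near: s; exact: (@cvgr_dist_lt _ _ _ _ _ id).
move=> t t0 tT; have [b tb bT] := ext t tT.
by apply: (sx b bT).2; rewrite t0.
Unshelve. all: by end_near. Qed.

Lemma scale_cV_ge (d : 'I_N -> R) : (forall i, 0 < d i) ->
  exists2 D, 0 < D & forall z, `|z| <= D * `|scale_cV d z|.
Proof.
move=> d0; pose eta := \big[Num.min/1]_j (d j).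
have eta0 : 0 < eta by apply: lt_bigmin => // i _; exact: d0.
exists eta^-1; first by rewrite invr_gt0.
move=> z; apply/cV_norm_leP; first by rewrite mulr_ge0 ?invr_ge0 ?(ltW eta0).
move=> i; rewrite mulrC ler_pdivlMr//.
apply: le_trans (cV_norm_le (scale_cV d z) i).
rewrite mxE normrM (gtr0_norm (d0 i)) mulrC ler_wpM2r//.
exact: bigmin_le.
Qed.

Lemma attractive_rescale F G (d : 'I_N -> R) (k : R) : (forall i, 0 < d i) ->
  0 < k -> (forall z, F (scale_cV d z) = k *: scale_cV d (G z)) ->
  attractive F -> attractive G.
Proof.
move=> d0 k0 FG aF T x sx Tend e e0.
have [D D0 hD] := scale_cV_ge d0.
pose T' : \bar R := (T * (k^-1)%:E)%E.
have T'E s : (s%:E < T')%E = ((s * k)%:E < T)%E.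
  by rewrite /T' lte_pdivlMr// EFinM.
pose y s := scale_cV d (x (0 + s * k)).
have sy : is_solution F T' y.
  apply: solves_is_solution.
    by rewrite T'E mul0r; case: sx.
  move=> b bT; rewrite T'E in bT.
  apply: (solves_rescale (is_solution_solves sx bT)) => //.
  by rewrite add0r.
have Tend' : T' = +oo%E \/
    (forall B, exists t, [/\ 0 <= t, (t%:E < T')%E & B < `|y t|]).
  case: Tend => [Too|unb]; [left|right].
    by rewrite /T' Too gt0_mulye// lte_fin invr_gt0.
  move=> B; have [t [t0 tT Bt]] := unb (D * B); exists (t / k); split.
  - by rewrite divr_ge0// ltW.
  - by rewrite T'E divfK// gt_eqF.
  rewrite /y add0r divfK ?gt_eqF// -(ltr_pM2l D0); exact: lt_le_trans Bt (hD _).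
have [t [t0 tT yt]] := aF T' y sy Tend' (e / D) (divr_gt0 e0 D0).
exists (t * k); split; [exact: mulr_gt0|by rewrite -T'E|].
rewrite /y add0r ltr_pdivlMr// mulrC in yt; exact: le_lt_trans (hD _) yt.
Qed.

End Attractivity.

(** * Limits of the rescaled gains along an ultrafilter *)

Section Family.
Context {R : realType}.
Variables (m : nat) (a b : nat -> R) (d0 doo : R).
Hypotheses (aS : forall j, a j.+1 = a j + d0) (bS : forall j, b j.+1 = b j + doo).
Variables K K0 Koo : 'cV[R]_m.+1 -> 'cV[R]_m.+1.
Hypotheses (cK : continuous K) (cK0 : continuous K0) (cKoo : continuous Koo).
Hypothesis lim0 : forall j : 'I_m.+1, unif_lim 0^'+ (fun x => K x j 0)
  (fun i : 'I_m.+1 => a i.+1) (a j.+2) (fun x => K0 x j 0).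
Hypothesis limoo : forall j : 'I_m.+1, unif_lim (pinfty_nbhs R) (fun x => K x j 0)
  (fun i : 'I_m.+1 => b i.+1) (b j.+2) (fun x => Koo x j 0).
Hypotheses (aK : attractive (error_system K)).
Hypotheses (aK0 : attractive (error_system K0)) (aKoo : attractive (error_system Koo)).

Let P (j : nat) (u : R) : R := expR (pl (a j) (b j) u).

(** Extends [rescaled_gain] off the first axis by the same change of units; its error system is
    conjugate to that of [K] up to a change of time, which transfers attractivity. *)
Definition rescaled_field (u : R) (y : 'cV[R]_m.+1) : 'cV[R]_m.+1 :=
  \col_j (K (scale_cV (fun i : 'I_m.+1 => P i.+1 u) y) j 0 / P j.+2 u).

Lemma scale_on_first (c : 'I_m.+1 -> R) v :
  scale_cV c (on_first m v) = on_first m (c 0 * v).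
Proof.
by apply/matrixP => i o; rewrite !mxE; case: eqP => [->|_]; rewrite ?mulr0.
Qed.

Lemma rescaled_gainE u v : rescaled_gain a b K u v = rescaled_field u (on_first m v).
Proof. by apply/matrixP => i o; rewrite !mxE scale_on_first. Qed.

Lemma attractive_rescaled_field u : attractive (error_system (rescaled_field u)).
Proof.
apply: (@attractive_rescale _ _ (error_system K) _
  (fun i : 'I_m.+1 => P i.+1 u) (expR (pl d0 doo u))) => //.
- by move=> i; exact: expR_gt0.
- exact: expR_gt0.
have PS j : P j.+1 u = P j u * expR (pl d0 doo u) by rewrite /P aS bS plD expRD.
move=> z; apply/matrixP => i o; rewrite (ord1 o) /error_system !first_onlyE.
rewrite [LHS]mxE [RHS]mxE [in RHS]mxE [in RHS]mxE mulrA -(mulrC (P i.+1 u)) -PS mulrDr.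
congr (_ + _); last first.
  rewrite [in RHS]mxE scale_on_first mulrC divfK ?gt_eqF ?expR_gt0//.
  by rewrite [scale_cV _ _ _ _]mxE.
have [im|mi] := ltnP i.+1 m.+1.
  by rewrite !(@shift_mxE_lt _ _ _ _ (Ordinal im))// mxE.
by rewrite !shift_mxE_max// mulr0.
Qed.

Lemma continuous_pl (c d : R) : continuous (pl c d).
Proof.
move=> u; apply: cvgD.
  apply: (@continuous_comp _ _ _ (fun u : R => Num.min u 0) ( *%R c)).
    by apply: continuous_min; [exact: cvg_id|exact: cvg_cst].
  exact: mulrl_continuous.
apply: (@continuous_comp _ _ _ (fun u : R => Num.max u 0) ( *%R d)).
  by apply: continuous_max; [exact: cvg_id|exact: cvg_cst].
exact: mulrl_continuous.
Qed.

Lemma continuous_rescaled_gain2 :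
  continuous (fun p : R * R => rescaled_gain a b K p.1 p.2).
Proof.
have cE c d : continuous (fun p : R * R => expR (pl c d p.1)).
  move=> p; apply: (@continuous_comp _ _ _ (fun p : R * R => p.1)
    (fun u => expR (pl c d u))); first exact: cvg_fst.
  by apply: continuous_comp; [exact: continuous_pl|exact: continuous_expR].
have cK1 : continuous (fun p : R * R =>
    K (on_first m (expR (pl (a 1) (b 1) p.1) * p.2))).
  move=> p; apply: (@continuous_comp _ _ _ (fun p : R * R =>
    on_first m (expR (pl (a 1) (b 1) p.1) * p.2)) K); last exact: cK.
  apply: (@continuous_comp _ _ _ (fun p : R * R => expR (pl (a 1) (b 1) p.1) * p.2)
    (on_first m)); last exact: continuous_on_first.
  by apply: cvgM; [exact: cE|exact: cvg_snd].
apply: continuous_cV => j.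
have -> : (fun p : R * R => rescaled_gain a b K p.1 p.2 j 0) = (fun p =>
    K (on_first m (expR (pl (a 1) (b 1) p.1) * p.2)) j 0 /
    expR (pl (a j.+2) (b j.+2) p.1)).
  by apply: funext => p; rewrite mxE.
move=> p; apply: cvgM.
  by apply: (@continuous_comp _ _ _ (fun p : R * R =>
    K (on_first m (expR (pl (a 1) (b 1) p.1) * p.2)))
    (fun z : 'cV[R]_m.+1 => z j 0)); [exact: cK1|exact: coord_continuous].
by apply: cvgV; [rewrite gt_eqF ?expR_gt0|exact: cE].
Qed.

(** Covers both unbounded cases: [w] is [a] or [b], according to the half-line on which almost all
    [u k] lie, where [pl] is linear and the rescaling is an ordinary dilation. *)
Lemma family_limit (U : set_system nat) (UU : UltraFilter U) (u : nat -> R)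
    (G : set_system R) (w : nat -> R)
    (Kst : 'cV[R]_m.+1 -> 'cV[R]_m.+1) :
  (forall A : set R, G A -> \forall k \near U, A (expR (u k))) ->
  continuous Kst ->
  (forall j : 'I_m.+1, unif_lim G (fun x => K x j 0)
    (fun i : 'I_m.+1 => w i.+1) (w j.+2) (fun x => Kst x j 0)) ->
  (forall j, \forall k \near U, pl (a j) (b j) (u k) = w j * u k) ->
  forall v e : R, 0 < e -> exists2 d : R, 0 < d &
    \forall k \near U, forall v' : R, `|v' - v| < d ->
      `|rescaled_gain a b K (u k) v' - Kst (on_first m v)| <= e.
Proof.
move=> Gu cKst lim plw v e e0; have e2 : 0 < e / 2 by lra.
have cg : continuous (fun v => Kst (on_first m v)).
  by move=> z; apply: continuous_comp; [exact: continuous_on_first|exact: cKst].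
have /cvgrPdist_le/(_ _ e2)/nbhs_ballP[d /= d0' hd] := cg v.
exists (Num.min d 1); first by rewrite lt_min d0' ltr01.
near=> k => v'; rewrite lt_min => /andP[vd v1].
have w1 : pl (a 1) (b 1) (u k) = w 1 * u k by near: k; exact: plw.
have lk : forall j : 'I_m.+1, pl (a j.+2) (b j.+2) (u k) = w j.+2 * u k /\
    forall x, `|x| <= `|v| + 1 -> `|K (dilation (fun i : 'I_m.+1 => w i.+1)
      (expR (u k)) x) j 0 / expR (u k) `^ w j.+2 - Kst x j 0| <= e / 2.
  near: k; apply: filter_forall => j; apply: filterI; first exact: plw.
  have := Gu _ (lim j (`|v| + 1) _ e2).
  by apply: filterS => k [].
have h2 : `|Kst (on_first m v) - Kst (on_first m v')| <= e / 2.
  by apply: hd; rewrite -ball_normE /= distrC.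
apply/cV_norm_leP; first exact: ltW.
move=> j; have [w2 hj] := lk j.
have v'v : `|on_first m v'| <= `|v| + 1.
  by rewrite on_first_norm; have := ler_normD (v' - v) v; rewrite subrK; lra.
have := hj _ v'v; rewrite -expRM (mulrC (u k)).
have -> : dilation (fun i : 'I_m.+1 => w i.+1) (expR (u k)) (on_first m v') =
    on_first m (expR (w 1 * u k) * v').
  apply/matrixP => i o; rewrite !mxE; case: eqP => [->|_]; rewrite ?mulr0//.
  by rewrite -expRM (mulrC (u k)).
have := cV_norm_le (Kst (on_first m v) - Kst (on_first m v')) j.
rewrite !mxE w1 w2; set A := K _ j 0 / _.
set z := Kst _ _ _; set z' := Kst _ _ _ => h3 h4.
by have := ler_normD (A - z) (z - z'); rewrite subrKA (distrC z); lra.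
Unshelve. all: by end_near. Qed.

Lemma family_attractive (U : set_system nat) : UltraFilter U ->
  forall u : nat -> R, exists Kst : 'cV[R]_m.+1 -> 'cV[R]_m.+1,
  [/\ continuous Kst, attractive (error_system Kst) &
    forall v e : R, 0 < e -> exists2 d : R, 0 < d &
      \forall k \near U, forall v' : R, `|v' - v| < d ->
        `|rescaled_gain a b K (u k) v' - Kst (on_first m v)| <= e].
Proof.
move=> UU u.
have [[A bA]|nb] := pselect (exists A, \forall k \near U, `|u k| <= A).
  have [|u0 _ ulim] := @ultra_compact R nat U UU `[- A, A]%classic u (@segment_compact _ _ _).
    by apply: filterS bA => k; rewrite /= in_itv /= ler_norml.
  exists (rescaled_field u0); split; last 1 first.
  - move=> v e e0.
    have /cvgrPdist_le/(_ _ e0)/nbhs_ballP[d /= d0' hd] :=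
      @continuous_rescaled_gain2 (u0, v).
    exists d => //.
    have /cvgrPdist_lt/(_ _ d0') := ulim.
    apply: filterS => k ud v' vd; rewrite -rescaled_gainE distrC.
    by apply: (hd (u k, v')); split; rewrite -ball_normE //= distrC.
  - apply: continuous_cV => j.
    have -> : (fun y => rescaled_field u0 y j 0) = (fun y =>
        K (scale_cV (fun i : 'I_m.+1 => P i.+1 u0) y) j 0 / P j.+2 u0).
      by apply: funext => y; rewrite mxE.
    move=> y; apply: (@continuous_comp _ _ _ (fun y => K (scale_cV
      (fun i : 'I_m.+1 => P i.+1 u0) y) j 0) ( *%R^~ (P j.+2 u0)^-1));
      last exact: mulrr_continuous.
    apply: (@continuous_comp _ _ _ (fun y => K (scale_cV
      (fun i : 'I_m.+1 => P i.+1 u0) y)) (fun z : 'cV[R]_m.+1 => z j 0));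
      last exact: coord_continuous.
    by apply: continuous_comp; [exact: continuous_scale_cV|exact: cK].
  - exact: attractive_rescaled_field.
have far A : \forall k \near U, A < `|u k|.
  have [uA|] := ultra_or UU (fun k => `|u k| <= A); first by exfalso; apply: nb; exists A.
  by apply: filterS => k /negP; rewrite -ltNge.
have [upos|uneg] := ultra_or UU (fun k => 0 <= u k).
  exists Koo; split => //.
  apply: (family_limit UU (G := pinfty_nbhs R) (w := b)) => //.
    move=> A [M [_ hM]]; apply: filterS (filterI upos (far M)) => k [u0].
    by rewrite ger0_norm// => Mu; apply: hM; have := expR_ge1Dx (u k); lra.
  by move=> j; apply: filterS upos => k u0; rewrite pl_pos.
exists K0; split => //.
apply: (family_limit UU (G := 0^'+) (w := a)) => //.
  move=> A; rewrite /at_right /within /= => /nbhs_ballP[d /= d0' hd].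
  apply: filterS (filterI uneg (far d^-1)) => k [/negP]; rewrite -ltNge => u0.
  rewrite ltr0_norm// => du; apply: hd; last exact: expR_gt0.
  rewrite /ball /= sub0r normrN gtr0_norm ?expR_gt0//.
  rewrite -[u k]opprK expRN -[ltRHS]invrK ltf_pV2 ?posrE ?expR_gt0 ?invr_gt0//.
  by have := expR_ge1Dx (- u k); lra.
by move=> j; apply: filterS uneg => k /negP; rewrite -ltNge => u0; rewrite pl_neg// ltW.
Qed.

End Family.

Lemma gas_vanishes (R : realType) m (K : 'cV[R]_m.+1 -> 'cV[R]_m.+1) :
  globally_asymptotically_stable (error_system K) -> K 0 = 0.
Proof.
move=> [+ _ _]; rewrite /error_system mulmx0 add0r first_onlyE mxE.
suff -> : on_first m (0 : R) = 0 by [].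
by apply/matrixP => i j; rewrite !mxE; case: ifP.
Qed.

(** An exactly homogeneous function is its own approximation in either limit; this lets the limit
    fields be treated as bi-limit homogeneous fields. *)
Lemma unif_lim_self (R : realType) N (G : set_system R) (GG : Filter G)
    (phi : 'cV[R]_N -> R) r d :
  (\forall s \near G, 0 < s) ->
  (forall s x, 0 < s -> phi (dilation r s x) = s `^ d * phi x) ->
  unif_lim G phi r d phi.
Proof.
move=> G0 hphi B e e0; apply: filterS G0 => s s0; split => // x _.
by rewrite hphi// mulrAC divff ?mul1r ?subrr ?normr0 ?ltW// gt_eqF// powR_gt0.
Qed.

Lemma scale_at_right0 (R : realType) (c : R) : 0 < c -> s * c @[s --> 0^'+] --> 0^'+.
Proof.
move=> c0 A; rewrite /at_right /within /= => /nbhs_ballP[d /= d0 hd].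
apply/nbhs_ballP; exists (d / c); first by rewrite /= divr_gt0.
move=> s; rewrite /ball /= sub0r normrN => sd s0; apply: hd; last by rewrite mulr_gt0.
by rewrite /ball /= sub0r normrN normrM (gtr0_norm c0) -ltr_pdivlMr.
Qed.

Lemma scale_pinfty (R : realType) (c : R) : 0 < c -> s * c @[s --> +oo] --> +oo.
Proof.
move=> c0 A [M [_ hM]]; exists (M / c); split; first exact: num_real.
by move=> s sM; apply: hM; rewrite -ltr_pdivrMr.
Qed.

(** Surjectivity of [q] makes every argument of [K] attainable, in particular one where the chosen
    component does not vanish. *)
Lemma obs_field_neq0 (R : realType) m (K : 'cV[R]_m.+1 -> 'cV[R]_m.+1) l q i :
  l != 0 -> (forall z, exists w, q w = z) ->
  (forall j : 'I_m.+1, exists x, K x j 0 != 0) -> exists x, obs_field K l q x i 0 != 0.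
Proof.
move=> l0 qsurj Knz.
have head z w : exists x : 'cV[R]_m.+2, q (l * x 0 0) = z /\ tail x = w.
  have [v vz] := qsurj z.
  exists (\col_i if unlift ord0 i is Some j then w j 0 else v / l); split.
    by rewrite mxE unlift_none mulrC divfK.
  by apply/matrixP => j o; rewrite !mxE liftK (ord1 o).
case: (unliftP ord0 i) => [j|] ->.
  have [y y0] := Knz j; have [x [hx tx]] := head (y 0 0) y.
  exists x; rewrite obs_field_tail; suff -> : obs_arg l q x = y by [].
  apply/matrixP => k o; rewrite mxE (ord1 o) hx -tx; case: eqP => [->|_] //.
  by rewrite mxE.
have [x [hx _]] := head 1 0; exists x.
by rewrite obs_field_head hx oppr_eq0 oner_eq0.
Qed.

(** * Choice of the gain and proof of the statement *)

Section BilimitObserver.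
Context {R : realType}.
Variables (m : nat) (a b : nat -> R) (d0 doo : R).
Hypotheses (aS : forall j, a j.+1 = a j + d0) (bS : forall j, b j.+1 = b j + doo).
Hypotheses (a_gt0 : forall j, (j <= m.+2)%N -> 0 < a j).
Hypotheses (b_gt0 : forall j, (j <= m.+2)%N -> 0 < b j).
Variables K K0 Koo : 'cV[R]_m.+1 -> 'cV[R]_m.+1.
Hypotheses (cK : continuous K) (cK0 : continuous K0) (cKoo : continuous Koo).
Hypothesis lim0 : forall j : 'I_m.+1, unif_lim 0^'+ (fun x => K x j 0)
  (fun i : 'I_m.+1 => a i.+1) (a j.+2) (fun x => K0 x j 0).
Hypothesis limoo : forall j : 'I_m.+1, unif_lim (pinfty_nbhs R) (fun x => K x j 0)
  (fun i : 'I_m.+1 => b i.+1) (b j.+2) (fun x => Koo x j 0).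
Hypotheses (gas : globally_asymptotically_stable (error_system K)).
Hypotheses (gas0 : globally_asymptotically_stable (error_system K0)).
Hypotheses (gasoo : globally_asymptotically_stable (error_system Koo)).

Lemma bilimit_obs_gas : exists L, forall l, 0 < l -> L <= l ->
  globally_asymptotically_stable
    (error_system (obs_field K l (bipow (a 1 / a 0) (b 1 / b 0)))).
Proof.
apply: (obs_gas aS bS a_gt0 b_gt0 cK (gas_vanishes gas)) => U UU.
by apply: (family_attractive aS bS cK cK0 cKoo lim0 limoo) => //; exact: gas_attractive.
Qed.

End BilimitObserver.

(** The weight is affine in [j], and its extreme values at [j = 1] and [j = n + 1] are positive by
    the upper and the lower bound on [d]. The index [n + 1] is included because it gives the degree
    of the last component. *)
Lemma weight_gt0 (R : realType) (n j : nat) (d : R) : (2 <= n)%N ->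
  -1 < d < 1 / (n%:R - 1) -> (1 <= j <= n.+1)%N -> 0 < weight n d j.
Proof.
move=> n2 /andP[dm dn] /andP[j1 jn]; rewrite /weight.
have n1 : 0 < n%:R - 1 :> R by rewrite subr_gt0 ltr1n.
rewrite ltr_pdivlMr// in dn.
have j1' : 1 <= j%:R :> R by rewrite ler1n.
have jn' : j%:R <= n%:R + 1 :> R by rewrite natr1 ler_nat.
have [d0|d0] := leP 0 d.
  have : d * (n%:R - j%:R) <= d * (n%:R - 1) by rewrite ler_wpM2l// lerB.
  by lra.
have : - d * (- 1) <= - d * (n%:R - j%:R).
  by rewrite ler_wpM2l//; lra.
by lra.
Qed.

Theorem theorem3p1 (R : realType) (n : nat) (hn : (2 <= n)%N)
  (d0 doo : R)
  (hd0 : -1 < d0 < 1 / (n%:R - 1)) (hdoo : -1 < doo < 1 / (n%:R - 1))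
  (i : nat) (hi : (1 <= i <= n - 1)%N)
  (K K0 Koo : 'cV[R]_(n - i) -> 'cV[R]_(n - i))
  (hK : vf_homogeneous_bilimit K
          (@weights_from R n d0 i.+1 (n - i)) d0 K0
          (@weights_from R n doo i.+1 (n - i)) doo Koo)
  (hgas : globally_asymptotically_stable (error_system K))
  (hgas0 : globally_asymptotically_stable (error_system K0))
  (hgasoo : globally_asymptotically_stable (error_system Koo)) :
  exists Ki Ki0 Kioo : 'cV[R]_(n - i + 1) -> 'cV[R]_(n - i + 1),
    [/\ vf_homogeneous_bilimit Ki
          (@weights_from R n d0 i (n - i + 1)) d0 Ki0
          (@weights_from R n doo i (n - i + 1)) doo Kioo,
        globally_asymptotically_stable (error_system Ki),
        globally_asymptotically_stable (error_system Ki0) &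
        globally_asymptotically_stable (error_system Kioo)].
Proof.
move: hi => /andP[i1 in1].
have [m km] : exists m, (n - i)%N = m.+1.
  by exists (n - i).-1; rewrite prednK// subn_gt0; lia.
move: K K0 Koo hK hgas hgas0 hgasoo; rewrite km addn1.
move=> K K0 Koo [hom0 homoo] gas gas0 gasoo.
(* [w d 0] is the weight of the new coordinate [e_i], and [w d j.+1] that of coordinate [j] of the
   given field. *)
pose w d j : R := weight n d (i + j).
have wS d j : w d j.+1 = w d j + d.
  by rewrite /w /weight addnS -natr1; ring.
have w_gt0 d j : -1 < d < 1 / (n%:R - 1) -> (j <= m.+2)%N -> 0 < w d j.
  by move=> hd jm; apply: weight_gt0 => //; lia.
have wfS d : @weights_from R n d i.+1 m.+1 = fun j => w d j.+1.
  by apply: funext => j; rewrite /weights_from /w addnS.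
have wf d : @weights_from R n d i m.+2 = fun j => w d j by [].
have degS d j : d + w d j = w d j.+1 by rewrite wS addrC.
rewrite !wfS in hom0 homoo.
have p0 := gas_vanishes gas.
have p00 := gas_vanishes gas0.
have p0oo := gas_vanishes gasoo.
have cK : continuous K by apply: continuous_cV => j; have [_ []] := hom0 j.
have cK0 : continuous K0 by apply: continuous_cV => j; have [_ [_ _ _ []]] := hom0 j.
have cKoo : continuous Koo by apply: continuous_cV => j; have [_ [_ _ _ []]] := homoo j.
have lim0 j : unif_lim 0^'+ (fun x => K x j 0)
    (fun i : 'I_m.+1 => w d0 i.+1) (w d0 j.+2) (fun x => K0 x j 0).
  have [_] := hom0 j; rewrite degS => /homogeneous_0limit_unif; apply.
  - by apply: w_gt0 => //; have := ltn_ord j; lia.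
  - by rewrite p0 mxE.
  - by rewrite p00 mxE.
have limoo j : unif_lim (pinfty_nbhs R) (fun x => K x j 0)
    (fun i : 'I_m.+1 => w doo i.+1) (w doo j.+2) (fun x => Koo x j 0).
  have [_] := homoo j; rewrite degS => /homogeneous_oolimit_unif; apply.
  - by apply: w_gt0 => //; have := ltn_ord j; lia.
  - by rewrite p0 mxE.
  - by rewrite p0oo mxE.
have ex0 (j : 'I_m.+1) s x : 0 < s ->
    K0 (dilation (fun i : 'I_m.+1 => w d0 i.+1) s x) j 0 = s `^ w d0 j.+2 * K0 x j 0.
  by move=> s0; apply: (unif_lim_exact _ (@scale_at_right0 R) (lim0 j)).
have exoo (j : 'I_m.+1) s x : 0 < s ->
    Koo (dilation (fun i : 'I_m.+1 => w doo i.+1) s x) j 0 = s `^ w doo j.+2 * Koo x j 0.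
  by move=> s0; apply: (unif_lim_exact _ (@scale_pinfty R) (limoo j)).
have pos0 : \forall s \near (0 : R)^'+, 0 < s by exact: nbhs_right_gt.
have posoo : \forall s \near +oo, 0 < (s : R).
  by apply: nbhs_pinfty_gt; exact: num_real.
have A j (jm : (j <= m.+2)%N) := w_gt0 d0 j hd0 jm.
have B j (jm : (j <= m.+2)%N) := w_gt0 doo j hdoo jm.
have [L hL] := bilimit_obs_gas (wS d0) (wS doo) A B cK cK0 cKoo
  lim0 limoo gas gas0 gasoo.
have self0 (G : set_system R) (GG : Filter G) (G0 : \forall s \near G, 0 < s)
    (j : 'I_m.+1) := unif_lim_self GG G0 (ex0 j).
have selfoo (G : set_system R) (GG : Filter G) (G0 : \forall s \near G, 0 < s)
    (j : 'I_m.+1) := unif_lim_self GG G0 (exoo j).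
(* For a limit system the same weights and the same field serve in both limits, so [q] becomes a
   pure power. *)
have [L0 hL0] := bilimit_obs_gas (wS d0) (wS d0) A A cK0 cK0 cK0
  (self0 _ _ pos0) (self0 _ _ posoo) gas0 gas0 gas0.
have [Loo hLoo] := bilimit_obs_gas (wS doo) (wS doo) B B cKoo cKoo cKoo
  (selfoo _ _ pos0) (selfoo _ _ posoo) gasoo gasoo gasoo.
(* The same gain must serve the three systems, since the approximating fields are built from the
   same [l]. *)
pose l := Num.max (Num.max 1 L) (Num.max L0 Loo).
have l0 : 0 < l by rewrite !lt_max ltr01.
pose al := w d0 1 / w d0 0; pose be := w doo 1 / w doo 0.
have al0 : 0 < al by rewrite divr_gt0 ?A.
have be0 : 0 < be by rewrite divr_gt0 ?B.
have cO (F : 'cV[R]_m.+1 -> 'cV[R]_m.+1) q j : continuous F -> continuous q ->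
    continuous (fun x => obs_field F l q x j 0).
  move=> cF cq x; apply: (@continuous_comp _ _ _ (obs_field F l q)
    (fun z : 'cV[R]_m.+2 => z j 0)); last exact: coord_continuous.
  exact: continuous_obs_field.
(* In the 0-limit the power keeps only its inner exponent [al], in the oo-limit only its outer
   exponent [be]. *)
exists (obs_field K l (bipow al be)), (obs_field K0 l (bipow al al)),
  (obs_field Koo l (bipow be be)); split; last 1 first.
- by apply: hLoo => //; rewrite !le_max lexx !orbT.
- rewrite !wf; split => j; rewrite degS.
    split; first by apply/ltW/A; have := ltn_ord j; lia.
    apply: unif_homogeneous_0limit.
    + by move=> j'; apply: A; exact: ltnW.
    + by apply/ltW/A; have := ltn_ord j; lia.
    + by apply: cO => //; exact: continuous_bipow.
    + by apply: cO => //; exact: continuous_bipow.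
    + apply: obs_field_neq0; [by rewrite gt_eqF|by move=> z; exact: bipow_surj|].
      by move=> j'; have [_ [_ _ _ []]] := hom0 j'.
    apply: obs_field_unif => //.
    + by apply: bipow_lim0; first [exact: A|exact: B].
    + exact: bipow_mono.
    + exact: bipow_odd.
    + by move=> j'; have [_ [_ _ _ []]] := hom0 j'.
  split; first by apply/ltW/B; have := ltn_ord j; lia.
  apply: unif_homogeneous_oolimit.
  + by move=> j'; apply: B; exact: ltnW.
  + by apply/ltW/B; have := ltn_ord j; lia.
  + by apply: cO => //; exact: continuous_bipow.
  + by apply: cO => //; exact: continuous_bipow.
  + apply: obs_field_neq0; [by rewrite gt_eqF|by move=> z; exact: bipow_surj|].
    by move=> j'; have [_ [_ _ _ []]] := homoo j'.
  apply: obs_field_unif => //.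
  + by apply: bipow_limoo; first [exact: A|exact: B].
  + exact: bipow_mono.
  + exact: bipow_odd.
  + by move=> j'; have [_ [_ _ _ []]] := homoo j'.
- by apply: hL => //; rewrite !le_max lexx !orbT.
- by apply: hL0 => //; rewrite !le_max lexx !orbT.
Qed.
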